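(* Let $Z\mid\mu$ be $\mathrm{IBP}(G_A|\mu)$ where $\mu$ is a $\mathrm{CRM}(\rho B_0)$ with $\rho(s)$ a homogeneous Lévy density, so that $Z$ has the $\mathrm{IBP}(A,\rho B_0)$ marginal distribution. Suppose that $\varphi:=\varphi(\rho|\pi_A)=\int_0^\infty\pi_A(s)\rho(s)\,ds<\infty$. Then there exists a sequence of iid pairs $((H_i,X_i))_{i\ge1}$ such that $$Z\overset{d}{=}\sum_{i=1}^{\xi(\varphi)}X_i\,\delta_{\tilde\omega_i},$$ where $\xi(\varphi)$ is a Poisson random variable with mean $\varphi$ independent of $((H_i,X_i))$, and the $\tilde\omega_i$ are iid with distribution $B_0$, independent of $\xi(\varphi)$ and $((H_i,X_i))$. The pairs have the following distributional properties: (i) $X_i\mid H_i=s$ has distribution, not depending on $\rho$, $$\frac{\mathbb{I}_{\{a\neq0\}}G_A(da|s)}{\pi_A(s)},$$ which is the conditional distribution of $A\mid A\neq0$ under $G_A(\cdot|s)$, and $H_i$ has marginal density $$\frac{\pi_A(s)\rho(s)}{\varphi(\rho|\pi_A)}.$$ (ii) The marginal distribution of $X_i$ is $$\mathbb{P}(X_i\in da)=\frac{\mathbb{I}_{\{a\neq0\}}\int_0^\infty G_A(da|s)\rho(s)\,ds}{\varphi(\rho|\pi_A)},$$ and the distribution of $H_i\mid X_i=a$ is given by $$\mathbb{P}(H_i\in ds\mid X_i=a)=\frac{\mathbb{I}_{\{a\neq0\}}G_A(da|s)\rho(s)\,ds}{\int_0^\infty G_A(da|v)\rho(v)\,dv}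.$$
   Context: **Setting.** $\Omega$ is a Polish space with a probability measure $B_0$. $\rho(s)\ge0$ is a homogeneous (i.e. not depending on $\omega\in\Omega$) Lévy density on $(0,\infty)$ with $\int_0^\infty\min(s,1)\rho(s)\,ds<\infty$; its total mass may be infinite or finite. **CRM.** Let $N=\sum_k\delta_{(\tau_k,\tilde\omega_k)}$ be a Poisson random measure on $(0,\infty)\times\Omega$ with mean intensity $\rho(s)\,ds\,B_0(d\omega)$. Then $\mu(d\omega)=\int_0^\infty sN(ds,d\omega)=\sum_k\tau_k\delta_{\tilde\omega_k}$ is said to be $\mathrm{CRM}(\rho B_0)$. **IBP processes.** $G_A(da|s)$ is a probability kernel giving, for each $s$, the distribution of a variable $A$ (possibly vector valued, discrete or continuous or mixed). Write $\pi_A(s)=\mathbb{P}(A\neq0|s)$; it is assumed that $1-\pi_A(s)=\mathbb{P}(A=0|s)>0$. $Z\mid\mu$ is $\mathrm{IBP}(G_A|\mu)$ if $Z=\sum_kA_k\delta_{\tilde\omega_k}$, where conditionally on $N$ the $A_k$ are independent with $A_k\sim G_A(da|\tau_k)$. The marginal (unconditional) distribution of $Z$ is denoted $\mathrm{IBP}(A,\rho B_0)$. **Conventions.** It is understood that $\varphi>0$, so that the normalised densities make sense. The conditional law of $H_i$ given $X_i=a$ in (ii) is understood as the disintegration with respect to $a$ of the joint measure $\mathbb{I}_{\{a\neq0\}}G_A(da|s)\rho(s)\,ds$. *)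

(* Defs.v *)
From HB Require Import structures.
From mathcomp Require Import all_boot all_order all_algebra.
From mathcomp Require Import all_classical all_reals all_analysis.
From mathcomp Require Import measurable_realfun.

Set Implicit Arguments.
Unset Strict Implicit.
Unset Printing Implicit Defensive.

Import Order.TTheory GRing.Theory Num.Theory.
Import numFieldNormedType.Exports.

Local Open Scope classical_set_scope.
Local Open Scope ring_scope.
Local Open Scope ereal_scope.

(* A Polish space is a [completePseudoMetricType] that is Hausdorff (so that the
   pseudometric separates points) and separable; it carries its Borel sets. *)
Definition polish (R : realType) (T : completePseudoMetricType R) : Prop :=
  hausdorff_space T /\ exists2 S : set T, countable S & dense S.

Notation borel T := (g_sigma_algebraType (@open T)).

Definition rv_sigma d d' (U : measurableType d) (T : measurableType d')
    (X : U -> T) : set (set U) :=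
  preimage_set_system [set: U] X measurable.

Definition seq_sigma d d' (U : measurableType d) (T : measurableType d')
    (X : nat -> U -> T) : set (set U) :=
  <<s \bigcup_i rv_sigma (X i) >>.

Definition indep d (U : measurableType d) (R : realType) (P : probability U R)
    (F G : set (set U)) : Prop :=
  forall A B, F A -> G B -> P (A `&` B) = P A * P B.

Definition mutual_indep d (U : measurableType d) (R : realType)
    (P : probability U R) (I : choiceType) (F : I -> set (set U)) : Prop :=
  forall (J : seq I) (A : I -> set U), uniq J -> (forall i, i \in J -> F i (A i)) ->
    P (\bigcap_(i in [set` J]) A i) = \prod_(i <- J) P (A i).

Definition iid d d' (U : measurableType d) (T : measurableType d')
    (R : realType) (P : probability U R) (X : nat -> U -> T) : Prop :=
  mutual_indep P (fun i => rv_sigma (X i)) /\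
  forall i B, measurable B -> P (X i @^-1` B) = P (X 0%N @^-1` B).

(* The second argument of [poisson_prob] is a dummy. *)
Definition poisson_law d (U : measurableType d) (R : realType)
    (P : probability U R) (Y : U -> \bar R) (m : \bar R) : Prop :=
  match m with
  | r%:E => forall n : nat, P (Y @^-1` [set n%:R%:E]) = poisson_prob r 0%N [set n]
  | +oo => P (Y @^-1` [set +oo]) = 1
  | -oo => False
  end.

Definition poisson_random_measure d d' (U : measurableType d)
    (S : measurableType d') (R : realType) (P : probability U R)
    (nu : set S -> \bar R) (N : U -> set S -> \bar R) : Prop :=
  [/\ forall C, measurable C -> measurable_fun [set: U] (N ^~ C),
      forall C, measurable C -> poisson_law P (N ^~ C) (nu C) &
      forall n (C : 'I_n -> set S), (forall i, measurable (C i)) ->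
        trivIset [set: 'I_n] C ->
        mutual_indep P (fun i => rv_sigma (N ^~ (C i)))].

(* A countable family of random atoms is encoded by a sequence [x] together with
   random flags [live]: the number of atoms may be finite or infinite, and [x k u]
   is meaningful only when [live k u] holds. *)
Definition atomic_measure d d' (U : measurableType d) (S : measurableType d')
    (R : realType) (live : nat -> U -> bool) (x : nat -> U -> S)
    (u : U) (C : set S) : \bar R :=
  \sum_(0 <= k <oo | live k u) \d_(x k u) C.

(* The sigma-algebra of the enumerated atoms. *)
Definition atom_sigma d d' (U : measurableType d) (S : measurableType d')
    (live : nat -> U -> bool) (x : nat -> U -> S) : set (set U) :=
  <<s [set D | exists k, exists2 C, measurable C &
                 D = [set u | live k u /\ C (x k u)]] >>.

Section ibp.
Context {R : realType}.

Local Notation leb := (@lebesgue_measure R).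
Local Notation pos := `]0%R, +oo[%classic.

Definition levy_density (rho : R -> R) : Prop :=
  [/\ measurable_fun (pos : set R) rho,
      forall s : R, (0 < s)%R -> (0 <= rho s)%R &
      \int[leb]_(s in pos) (Num.min s 1 * rho s)%:E < +oo].

(* rho(s) ds B0(dw), as a measure on R * Omega carried by ]0, +oo[ * Omega *)
Definition crm_intensity d (T : measurableType d) (rho : R -> R)
    (B0 : probability T R) (C : set (R * T)) : \bar R :=
  \int[leb]_(s in pos) ((rho s)%:E * B0 (xsection C s)).

Definition is_crm dU (U : measurableType dU) d (T : measurableType d)
    (P : probability U R) (rho : R -> R) (B0 : probability T R)
    (live : nat -> U -> bool) (tau : nat -> U -> R) (omega : nat -> U -> T)
    (mu : U -> set T -> \bar R) : Prop :=
  [/\ forall k u, live k u -> (0 < tau k u)%R,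
      poisson_random_measure P (crm_intensity rho B0)
        (atomic_measure R live (fun k u => (tau k u, omega k u))) &
      forall u C, measurable C ->
        mu u C = \sum_(0 <= k <oo | live k u) (tau k u)%:E * \d_(omega k u) C].

Section vector_valued.
Variable p : nat.
Local Notation E := (p.-tuple R).

Definition nonzero : set E := [set a | a != [tuple 0%R | _ < p]].

Definition pi_A (G : R.-pker R ~> E) (s : R) : R := fine (G s nonzero).

Definition varphi (rho : R -> R) (G : R.-pker R ~> E) : \bar R :=
  \int[leb]_(s in pos) (pi_A G s * rho s)%:E.

(* Conditional law of A given A != 0 under G(.|s); it is 0 when pi_A(s) = 0. *)
Definition cond_nonzero (G : R.-pker R ~> E) (s : R) (B : set E) : \bar R :=
  (fine (G s (B `&` nonzero)) / pi_A G s)%:E.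

(* Z|mu is IBP(G|mu): given the atoms, the marks A_k of the live atoms are
   independent with A_k ~ G(.|tau_k), stated on finite initial segments, and
   Z(C) = sum_k A_k 1_C(omega_k), taken coordinatewise as a limit of partial sums. *)
Definition is_ibp dU (U : measurableType dU) d (T : measurableType d)
    (P : probability U R) (G : R.-pker R ~> E)
    (live : nat -> U -> bool) (tau : nat -> U -> R) (omega : nat -> U -> T)
    (Z : U -> set T -> E) : Prop :=
  exists A : nat -> {mfun U >-> E},
    (forall (D : set U) (n : nat) (B : nat -> set E),
       atom_sigma live (fun k u => (tau k u, omega k u)) D ->
       (forall k, measurable (B k)) ->
       P (D `&` [set u | forall k, (k < n)%N -> live k u -> B k (A k u)]) =
       \int[P]_(u in D) \prod_(0 <= k < n | live k u) G (tau k u) (B k)) /\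
    forall u C, measurable C ->
      Z u C = [tuple limn (fun n : nat =>
                 \sum_(0 <= k < n | live k u)
                    tnth (A k u) j * \1_C (omega k u))%R | j < p].

(* sum_{i < xi} X_i delta_{omega_i} *)
Definition compound_sum dU (U : measurableType dU) d (T : measurableType d)
    (xi : U -> nat) (X : nat -> U -> E) (omega : nat -> U -> T)
    (u : U) (C : set T) : E :=
  [tuple (\sum_(i < xi u) tnth (X i u) j * \1_C (omega i u))%R | j < p].

(* Random R^p-valued measures have the same law when they agree on the
   sigma-algebra generated by the evaluations z |-> z(C), C measurable. *)
Definition eval_sigma d (T : measurableType d) : set (set (set T -> E)) :=
  <<s [set F | exists C B, [/\ measurable C, measurable B &
                 F = [set z : set T -> E | B (z C)]]] >>.

Definition eq_law d (T : measurableType d)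
    dU (U : measurableType dU) (P : probability U R) (Z : U -> set T -> E)
    dU' (U' : measurableType dU') (P' : probability U' R)
    (Z' : U' -> set T -> E) : Prop :=
  forall F, eval_sigma F -> P (Z @^-1` F) = P' (Z' @^-1` F).

(* The joint measure I{a != 0} G(da|s) rho(s) ds of (a, s). *)
Definition joint_measure (rho : R -> R) (G : R.-pker R ~> E)
    (C : set (E * R)) : \bar R :=
  \int[leb]_(s in pos) (G s (ysection C s `&` nonzero) * (rho s)%:E).

End vector_valued.

(* K(x, .) is a regular version of the conditional law of Y given X = x. *)
Definition regular_cond_law dU (U : measurableType dU)
    d1 (T1 : measurableType d1) d2 (T2 : measurableType d2)
    (P : probability U R) (Y : U -> T2) (X : U -> T1)
    (K : T1 -> set T2 -> \bar R) : Prop :=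
  [/\ forall B, measurable B -> measurable_fun [set: T1] (K ^~ B),
      \forall u \ae P, exists Q : probability T2 R,
        forall B, measurable B -> K (X u) B = Q B &
      forall A B, measurable A -> measurable B ->
        P (X @^-1` A `&` Y @^-1` B) = \int[P]_(u in X @^-1` A) K (X u) B].

(* J(da, ds) = Q(a, ds) nu(da), where nu is the first marginal of J. *)
Definition disintegration d1 (T1 : measurableType d1)
    d2 (T2 : measurableType d2) (J : set (T1 * T2) -> \bar R)
    (Q : R.-pker T1 ~> T2) : Prop :=
  exists2 nu : {measure set T1 -> \bar R},
    forall A, measurable A -> nu A = J (A `*` [set: T2]) &
    forall A B, measurable A -> measurable B ->
      J (A `*` B) = \int[nu]_(a in A) Q a B.

End ibp.

(* Main.v *)
(** The law of a family of nonnegative variables is determined by its joint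
    Laplace transform, so it suffices to compare the Laplace functionals of Z
    and of the compound sum, split into positive and negative parts. By the
    marking of the Poisson measure, for g >= 0 with g (t, 0) = 0 the functional of
    Z is the exponential of [- int rho ds (int (1 - exp (- g)) dG dB0)]. The
    integrand vanishes where a = 0, so this is [- varphi (1 - E exp (- g))] for a
    mark with law I{a != 0} G(da|s) rho(s) ds / varphi, which is the functional of
    a Poisson(varphi) number of iid marks. Taking g = t I{a != 0} and letting t
    tend to 0 shows that almost surely only finitely many A_k are nonzero, so that
    the limit defining Z exists. *)

(* Three obstacles shape the proof. The hypotheses on counts and marks speak of events only. They
   become identities for integrals of products of functions by exchanging, one coordinate at a time,
   the Dirac kernel at a random variable for its law or conditional law. Marks are then integrated
   out by putting minus the logarithm of the conditional transform of [exp (- g)] in place of [g],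
   which leaves an unmarked functional. Secondly, [Z] is indexed by all measurable sets, an
   uncountable family, and its atom sums may be infinite on a null event. Uniqueness of Laplace
   transforms is therefore proved for arbitrary index types, from the fact that powers of
   [1 - exp (- s Y)] are combinations of exponentials and can be made to converge to the indicator
   of [c < Y]. Thirdly, objects must be produced. The iid pairs come from a product measure on
   sequences, whose countable additivity is obtained without topology by choosing coordinates one by
   one. The conditional law of [H] given [X] comes from Radon-Nikodym derivatives along half-lines,
   turned into a kernel by a quantile transform. *)
Require Import Defs.
From HB Require Import structures.
From mathcomp Require Import all_boot all_order all_algebra finmap.
From mathcomp Require Import all_classical all_reals all_analysis.
From mathcomp Require Import measurable_realfun.
From mathcomp Require Import ring lra.

Set Implicit Arguments.
Unset Strict Implicit.
Unset Printing Implicit Defensive.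

Import Order.TTheory GRing.Theory Num.Theory.
Import numFieldNormedType.Exports.

Local Open Scope classical_set_scope.
Local Open Scope ring_scope.
Local Open Scope ereal_scope.

(** * Mixtures of measures *)

Section mixture.
Context d1 d2 (X : measurableType d1) (Y : measurableType d2) (R : realType).
Variables (m : {measure set X -> \bar R}) (D : set X) (w : X -> R).
Variable k : X -> {measure set Y -> \bar R}.
Hypotheses (mD : measurable D) (mw : measurable_fun D w).
Hypothesis w0 : forall x, (0 <= w x)%R.
Hypothesis mk : forall C, measurable C -> measurable_fun D (k ^~ C).

Import HBNNSimple.

Let sintE (h : {nnsfun Y >-> R}) x :
  \int[k x]_y (h y)%:E = \sum_(r \in range h) (r%:E * k x (h @^-1` [set r])).
Proof. by rewrite integralT_nnsfun sintegralE. Qed.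

Let mksint (h : {nnsfun Y >-> R}) :
  measurable_fun D (fun x => \int[k x]_y (h y)%:E).
Proof.
under eq_fun do rewrite sintE.
by apply: emeasurable_fsum => // r; apply: measurable_funeM; exact: mk.
Qed.

Lemma measurable_integral_kernel (f : Y -> \bar R) :
  measurable_fun [set: Y] f -> (forall y, 0 <= f y) ->
  measurable_fun D (fun x => \int[k x]_y f y).
Proof.
move=> mf f0; pose g := nnsfun_approx measurableT mf.
rewrite (_ : (fun x => _) = fun x => limn_esup (fun n => \int[k x]_y (g n y)%:E)).
  by apply: measurable_fun_limn_esup => n; exact: mksint.
apply/funext => x; apply/esym.
have nd : {homo (fun n => \int[k x]_y (g n y)%:E) : p q / (p <= q)%N >-> p <= q}.
  move=> p q pq; apply: ge0_le_integral => //.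
  - by move=> y _; rewrite lee_fin.
  - by apply/measurable_EFinP.
  - by apply/measurable_EFinP.
  - by move=> y _; rewrite lee_fin; exact/lefP/nd_nnsfun_approx.
rewrite is_cvg_limn_esupE; last exact: ereal_nondecreasing_is_cvgn.
rewrite -monotone_convergence//.
- by apply: eq_integral => y _; apply/cvg_lim => //; exact: cvg_nnsfun_approx.
- by move=> n; apply/measurable_EFinP.
- by move=> n y _; rewrite lee_fin.
- by move=> y _ p q pq; rewrite lee_fin; exact/lefP/nd_nnsfun_approx.
Qed.

(** The common source of the measures below: Dirac kernels give image laws and restrictions,
    probability kernels give the Poisson intensity, the law of a mark and sequence laws. Both
    countable additivity and the integral formula come from monotone convergence. *)
Lemma mixture_measure : exists2 M : {measure set Y -> \bar R},
  (forall C, M C = \int[m]_(x in D) ((w x)%:E * k x C)) &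
  forall f, measurable_fun [set: Y] f -> (forall y, 0 <= f y) ->
    \int[M]_y f y = \int[m]_(x in D) ((w x)%:E * \int[k x]_y f y).
Proof.
pose M C := \int[m]_(x in D) ((w x)%:E * k x C).
have mwk C : measurable C -> measurable_fun D (fun x => (w x)%:E * k x C).
  by move=> mC; apply: emeasurable_funM; [exact/measurable_EFinP|exact: mk].
have wk0 C x : 0 <= (w x)%:E * k x C by rewrite mule_ge0// lee_fin.
have M0 : M set0 = 0.
  by rewrite /M; under eq_integral do rewrite measure0 mule0; rewrite integral0.
have Mge0 C : 0 <= M C by apply: integral_ge0 => x _; exact: wk0.
have Madd : semi_sigma_additive M.
  move=> F mF tF mUF; rewrite [X in _ --> X](_ : _ =
      \int[m]_(x in D) (\sum_(0 <= i <oo) (w x)%:E * k x (F i))); last first.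
    apply: eq_integral => x _; rewrite nneseriesZl//; congr (_ * _).
    by apply/esym/cvg_lim => //; exact: measure_sigma_additive.
  rewrite [X in X @ _](_ : _ =
     (fun n => \int[m]_(x in D) (\sum_(0 <= i < n) (w x)%:E * k x (F i)))); last first.
    apply/funext => n; rewrite -ge0_integral_sum// => i; exact: mwk.
  apply: cvg_monotone_convergence => //.
  - by move=> n; apply: emeasurable_sum => i; exact: mwk.
  - by move=> n x _; rewrite sume_ge0.
  - by move=> x _ a b ab; exact: ereal_nondecreasing_series.
pose Mm := isMeasure.Build d2 Y R M M0 Mge0 Madd.
pose MM : {measure set Y -> \bar R} := HB.pack M Mm.
exists MM => // f mf f0.
pose g := nnsfun_approx measurableT mf.
pose gE := fun n => EFin \o g n.
have mgE n : measurable_fun [set: Y] (gE n) by exact/measurable_EFinP.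
have gE_ge0 n x : 0 <= gE n x by rewrite lee_fin.
have nd_gE x : {homo gE ^~ x : n m / (n <= m)%O >-> n <= m}.
  by move=> *; exact/lefP/nd_nnsfun_approx.
transitivity (limn (fun n => \int[MM]_x gE n x)).
  rewrite -monotone_convergence//; apply: eq_integral => t _.
  by apply/esym/cvg_lim => //; exact: cvg_nnsfun_approx.
transitivity (limn (fun n => \int[m]_(x in D) ((w x)%:E * \int[k x]_y gE n y))).
  apply: congr_lim; apply/funext => n.
  transitivity (\int[m]_(x in D)
      \sum_(r \in range (g n)) ((w x)%:E * (r%:E * k x (g n @^-1` [set r])))).
    rewrite ge0_integral_fsum//.
    - rewrite integralT_nnsfun sintegralE; apply: eq_fsbigr => r rh.
      rewrite /= /M -ge0_integralZl//.
      + by apply: eq_integral => x _; rewrite muleCA.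
      + exact: mwk.
      + by move: rh; rewrite inE => -[y _ <-]; rewrite lee_fin.
    - move=> r; under eq_fun do rewrite muleCA.
      by apply: measurable_funeM; exact: mwk.
    - by move=> r x _; rewrite mule_ge0 ?lee_fin//; exact: nnsfun_mulemu_ge0.
  apply: eq_integral => x _; rewrite /gE/= sintE ge0_mule_fsumr// => r.
  exact: nnsfun_mulemu_ge0.
rewrite -[LHS]monotone_convergence//.
- apply: eq_integral => x _; rewrite limeMl//.
    rewrite -monotone_convergence//; congr (_ * _).
    by apply: eq_integral => t _; apply/cvg_lim => //; exact: cvg_nnsfun_approx.
  apply: ereal_nondecreasing_is_cvgn => p q pq.
  by apply: ge0_le_integral => // t _; exact: nd_gE.
- move=> n; apply: emeasurable_funM; first exact/measurable_EFinP.
  exact: mksint.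
- by move=> n x _; rewrite mule_ge0 ?lee_fin//; exact: integral_ge0.
- move=> x _ p q pq; rewrite lee_wpmul2l ?lee_fin//.
  by apply: ge0_le_integral => // t _; exact: nd_gE.
Qed.

End mixture.

(** Both mixtures are measures that agree on a pi-system. As it contains the whole space, the
    constant sequence [setT] exhausts the space and finiteness of the first mixture suffices. *)
Lemma mixture_unique d1 d1' d2 (X : measurableType d1) (X' : measurableType d1')
  (Y : measurableType d2) (R : realType)
  (m : {measure set X -> \bar R}) (D : set X) (w : X -> R)
  (k : X -> {measure set Y -> \bar R})
  (m' : {measure set X' -> \bar R}) (D' : set X') (w' : X' -> R)
  (k' : X' -> {measure set Y -> \bar R}) (G : set (set Y)) :
  measurable D -> measurable_fun D w -> (forall x, (0 <= w x)%R) ->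
  (forall C, measurable C -> measurable_fun D (k ^~ C)) ->
  measurable D' -> measurable_fun D' w' -> (forall x, (0 <= w' x)%R) ->
  (forall C, measurable C -> measurable_fun D' (k' ^~ C)) ->
  @measurable _ Y = <<s G >> -> setI_closed G -> G setT ->
  \int[m]_(x in D) ((w x)%:E * k x setT) < +oo ->
  (forall C, G C -> \int[m]_(x in D) ((w x)%:E * k x C) =
                    \int[m']_(x in D') ((w' x)%:E * k' x C)) ->
  forall f, measurable_fun [set: Y] f -> (forall y, 0 <= f y) ->
    \int[m]_(x in D) ((w x)%:E * \int[k x]_y f y) =
    \int[m']_(x in D') ((w' x)%:E * \int[k' x]_y f y).
Proof.
move=> mD mw w0 mk mD' mw' w'0 mk' Ggen GI GT fin eqG f mf f0.
have [M ME Mf] := mixture_measure m mD mw w0 mk.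
have [M' M'E M'f] := mixture_measure m' mD' mw' w'0 mk'.
rewrite -Mf// -M'f//; apply: eq_measure_integral => C mC _.
apply: (@measure_unique _ R _ G (fun=> setT)) => //.
- exact: bigcup_const.
- by move=> B GB; rewrite ME M'E eqG.
- by move=> _; rewrite ME.
Qed.

(** * Uniqueness of joint Laplace transforms *)

Lemma expR_opp_nat_le {R : realType} (n : nat) :
  (expR (- n%:R) <= (n.+1%:R)^-1 :> R)%R.
Proof.
rewrite expRN lef_pV2 ?posrE ?expR_gt0//.
by rewrite -natr1 addrC expR_ge1Dx.
Qed.

Lemma bernoulli_ineq {R : realType} (a : R) n :
  (0 <= a <= 1 -> 1 - n%:R * a <= (1 - a) ^+ n)%R.
Proof.
move=> /andP[a0 a1]; elim: n => [|n IH]; first by rewrite mul0r subr0 expr0.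
rewrite exprS (le_trans _ (ler_wpM2l _ IH)) ?subr_ge0//.
rewrite -natr1; have : (0 <= n%:R * a ^+ 2)%R by rewrite mulr_ge0// sqr_ge0.
by nra.
Qed.

(* The exponent grows like [exp (n^2 c + n)], so that the base
   [1 - exp (- n^2 y)] wins exactly when [c < y]. *)
Lemma cvg_threshold {R : realType} (c y : R) : (0 <= c)%R -> (0 <= y)%R ->
  (fun n : nat => (1 - expR (- (n%:R ^+ 2 * y)))
     ^+ (Num.truncn (expR (n%:R ^+ 2 * c + n%:R))).+1)%R @ \oo -->
  ((c < y)%R%:R : R).
Proof.
move=> c0 y0.
pose a (n : nat) : R := expR (- (n%:R ^+ 2 * y))%R.
pose E (n : nat) : R := expR (n%:R ^+ 2 * c + n%:R)%R.
pose M (n : nat) := (Num.truncn (E n)).+1.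
have a01 n : (0 <= a n <= 1)%R.
  by rewrite expR_ge0/= -[leRHS]expR0 ler_expR oppr_le0 mulr_ge0// sqr_ge0.
have h0 : (fun n : nat => (n.+1%:R^-1)%R : R) @ \oo --> (0%R : R).
  exact: cvg_harmonic.
have EM n : (E n <= (M n)%:R)%R by apply/ltW/truncnS_gt.
have E1 n : (1 <= E n)%R.
  by rewrite -[leLHS]expR0 ler_expR addr_ge0// mulr_ge0// sqr_ge0.
have ME n : ((M n)%:R <= 2 * E n)%R.
  rewrite /M -natr1; have := E1 n.
  have : ((Num.truncn (E n))%:R <= E n)%R by rewrite truncn_le expR_ge0.
  by lra.
change (((fun n => (1 - a n) ^+ M n)%R) @ \oo --> ((c < y)%R%:R : R)).
have [cy|yc] := ltP c y.
  apply: (@squeeze_cvgr _ _ _ _ (fun n : nat => 1 - 2 * n.+1%:R^-1)%R (fun=> 1%R)).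
  - near=> n; apply/andP; split; last first.
      by apply: exprn_ile1; have /andP[] := a01 n; lra.
    rewrite (le_trans _ (bernoulli_ineq _ (a01 n)))// lerD2l lerN2.
    rewrite (le_trans (ler_wpM2r _ (ME n)))//; first by have /andP[] := a01 n.
    rewrite -mulrA ler_wpM2l// -expRD (le_trans _ (expR_opp_nat_le n))//.
    rewrite ler_expR.
    (* This bound gives [n^2 c + n - n^2 y <= - n], so that [M n * a n] is at most [2 exp (- n)] and
       Bernoulli's inequality applies. *)
    have n2 : (2 <= n%:R * (y - c))%R.
      rewrite -ler_pdivrMr ?subr_gt0//; near: n; exact: nbhs_infty_ger.
    have n0 : (0 <= n%:R :> R)%R by [].
    by nra.
  - rewrite -[X in _ --> X]subr0 -[X in (_ - X)%R](mulr0 2%R).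
    by apply: cvgB; [exact: cvg_cst|apply: cvgMr].
  - exact: cvg_cst.
(* Here [a n * M n] is at least [n]. In the boundary case [y = c] this is due to the linear term [n]
   in the exponent alone. *)
apply: (@squeeze_cvgr _ _ _ _ (fun=> 0%R) (fun n : nat => n.+1%:R^-1)%R) => //.
  near=> n; apply/andP; split.
    by rewrite exprn_ge0//; have /andP[] := a01 n; lra.
  have /andP[an0 an1] := a01 n.
  have ea : (1 - a n <= expR (- a n))%R by rewrite (le_trans _ (expR_ge1Dx _)).
  rewrite (@le_trans _ _ (expR (- a n) ^+ M n)%R)//.
    by rewrite lerXn2r ?nnegrE ?expR_ge0// subr_ge0.
  rewrite -expRM_natr mulNr expRN lef_pV2 ?posrE ?expR_gt0//.
  have En : (n%:R <= a n * (M n)%:R)%R.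
    rewrite (le_trans _ (ler_wpM2l an0 (EM n)))// -expRD.
    rewrite (le_trans _ (expR_ge1Dx _))//.
    have : (0 <= n%:R ^+ 2 * (c - y))%R by rewrite mulr_ge0 ?sqr_ge0// subr_ge0.
    by nra.
  by rewrite (le_trans _ (expR_ge1Dx _))// -natr1; lra.
exact: cvg_cst.
Unshelve. all: by end_near. Qed.

Section laplace_step.
Context d (U : measurableType d) (R : realType) (P : probability U R).
Context (I : Type) (Y : I -> U -> R).
Hypotheses (mY : forall i, measurable_fun [set: U] (Y i))
           (Y0 : forall i u, (0 <= Y i u)%R).

Definition laplace (l : seq (R * I)) (u : U) : R :=
  expR (- \sum_(x <- l) x.1 * Y x.2 u)%R.

(** Expanded by the binomial formula this is a combination of exponentials of [Y i], hence
    controlled by Laplace transforms. With [s] and [N] tuned as in [cvg_threshold] it tends to the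
    indicator of [c < Y i]. *)
Definition thresh (s : R) (N : nat) (i : I) (u : U) : R :=
  ((1 - expR (- (s * Y i u))) ^+ N)%R.

Lemma laplace_itv01 l u : all (fun x => 0 <= x.1)%R l -> (0 <= laplace l u <= 1)%R.
Proof.
move=> l0; rewrite expR_ge0/= -[leRHS]expR0 ler_expR oppr_le0.
elim: l l0 => [|x l IH]/=; first by rewrite big_nil.
by move=> /andP[x0 /IH l0]; rewrite big_cons addr_ge0// mulr_ge0.
Qed.

Lemma thresh_itv01 s N i u : (0 <= s -> 0 <= thresh s N i u <= 1)%R.
Proof.
move=> s0.
have h : (0 <= 1 - expR (- (s * Y i u)) <= 1)%R.
  rewrite subr_ge0 -[X in (_ <= X)%R]expR0 ler_expR oppr_le0 mulr_ge0//.
  by rewrite lerBlDr lerDl expR_ge0.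
by rewrite /thresh exprn_ge0 ?exprn_ile1//; case/andP: h.
Qed.

Lemma measurable_laplace l : measurable_fun [set: U] (laplace l).
Proof.
apply: measurableT_comp => //; apply: measurableT_comp => //.
apply: measurable_sum => x; exact: measurable_funM.
Qed.

Lemma measurable_thresh s N i : measurable_fun [set: U] (thresh s N i).
Proof.
apply: measurable_funX; apply: measurable_funB => //.
apply: measurableT_comp => //; apply: measurableT_comp => //.
exact: measurable_funM.
Qed.

Lemma integrable_itv01 (D : set U) (f : U -> R) : measurable D ->
  measurable_fun [set: U] f -> (forall u, 0 <= f u <= 1)%R ->
  P.-integrable D (EFin \o f).
Proof.
move=> mD mf f01; apply: measurable_bounded_integrable => //.
- by rewrite (le_lt_trans (probability_le1 P mD))// ltry.
- exact: measurable_funTS.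
- exists 1%R; split => // x x1 u Du /=.
  by have /andP[f0 f1] := f01 u; rewrite ger0_norm// (le_trans f1)// ltW.
Qed.

Lemma integrable_thresh_laplace (D : set U) s N i l : measurable D -> (0 <= s)%R ->
  all (fun x => 0 <= x.1)%R l ->
  P.-integrable D (EFin \o (fun u => thresh s N i u * laplace l u)%R).
Proof.
move=> mD s0 l0; apply: integrable_itv01 => //.
  by apply: measurable_funM; [exact: measurable_thresh|exact: measurable_laplace].
move=> u; have /andP[a0 a1] := thresh_itv01 N i u s0.
by have /andP[b0 b1] := laplace_itv01 u l0; rewrite mulr_ge0//= mulr_ile1.
Qed.

(** One factor [1 - exp (- s Y)] is traded for a difference of two transforms, the second with a
    longer list. Iterating it expresses thresholds through Laplace transforms alone. *)
Lemma integral_threshS (D : set U) s N i l : measurable D -> (0 <= s)%R ->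
  all (fun x => 0 <= x.1)%R l ->
  \int[P]_(u in D) (thresh s N.+1 i u * laplace l u)%:E =
  \int[P]_(u in D) (thresh s N i u * laplace l u)%:E -
  \int[P]_(u in D) (thresh s N i u * laplace ((s, i) :: l) u)%:E.
Proof.
move=> mD s0 l0; rewrite -integralB_EFin//; last 2 first.
- exact: integrable_thresh_laplace.
- by apply: integrable_thresh_laplace => //=; rewrite s0.
apply: eq_integral => u _; rewrite -EFinB /thresh /laplace big_cons/=.
by congr EFin; rewrite opprD expRD exprS; ring.
Qed.

Lemma cvg_integral_thresh (D : set U) (c : R) i l : measurable D -> (0 <= c)%R ->
  all (fun x => 0 <= x.1)%R l ->
  (fun n : nat => \int[P]_(u in D) (thresh (n%:R ^+ 2)
     (Num.truncn (expR (n%:R ^+ 2 * c + n%:R)%R)).+1 i u * laplace l u)%:E) @ \oo -->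
  \int[P]_(u in D `&` [set u | (c < Y i u)%R]) (laplace l u)%:E.
Proof.
move=> mD c0 l0; rewrite integral_mkcondr.
have [|||||_ _ ] := @dominated_convergence _ _ _ P _ mD
  (fun n u => (thresh (n%:R ^+ 2)
     (Num.truncn (expR (n%:R ^+ 2 * c + n%:R)%R)).+1 i u * laplace l u)%:E)
  ((fun u => (laplace l u)%:E) \_ [set u | (c < Y i u)%R]) (cst 1).
- move=> n; apply/measurable_EFinP/measurable_funTS/measurable_funM.
    exact: measurable_thresh.
  exact: measurable_laplace.
- apply: measurable_funTS; apply/(measurable_restrictT _ _).1.
    rewrite -[X in measurable X]setTI.
    by apply: measurable_fun_ltr => //; exact: measurable_funTS.
  by apply: measurable_funTS; apply/measurable_EFinP; exact: measurable_laplace.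
- apply: aeW => u _; rewrite /patch mem_setE.
  have -> : (if (c < Y i u)%R then (laplace l u)%:E else 0) =
      ((c < Y i u)%R%:R * laplace l u)%:E.
    by case: ifPn => _; rewrite ?mul1r ?mul0r.
  apply: cvg_EFin; first by apply: nearW.
  apply: cvgMl; exact: cvg_threshold.
- exact: finite_measure_integrable_cst.
- apply: aeW => u n _ /=; rewrite lee_fin.
  have /andP[a0 a1] := thresh_itv01
     (Num.truncn (expR (n%:R ^+ 2 * c + n%:R)%R)).+1 i u (sqr_ge0 (n%:R : R)).
  have /andP[b0 b1] := laplace_itv01 u l0.
  by rewrite ger0_norm ?mulr_ge0// mulr_ile1.
- exact.
Qed.

End laplace_step.

Section laplace_unique.
Context d d' (U : measurableType d) (U' : measurableType d') (R : realType).
Context (P : probability U R) (P' : probability U' R).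
Context (I : Type) (Y : I -> U -> R) (Y' : I -> U' -> R).
Hypotheses (mY : forall i, measurable_fun [set: U] (Y i))
           (Y0 : forall i u, (0 <= Y i u)%R)
           (mY' : forall i, measurable_fun [set: U'] (Y' i))
           (Y'0 : forall i u, (0 <= Y' i u)%R).
Hypothesis eqL : forall l, all (fun x => 0 <= x.1)%R l ->
  \int[P]_u (laplace Y l u)%:E = \int[P']_u (laplace Y' l u)%:E.

Let tail d0 (V : measurableType d0) (W : I -> V -> R) (J : seq (I * R)) :=
  [set v : V | all (fun x => x.2 < W x.1 v)%R J].

Let measurable_tail d0 (V : measurableType d0) (W : I -> V -> R) J :
  (forall i, measurable_fun [set: V] (W i)) -> measurable (tail W J).
Proof.
move=> mW; elim: J => [|[i c] J IH].
  by rewrite (_ : tail _ _ = setT)//; apply/seteqP.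
rewrite (_ : tail _ _ = [set v | (c < W i v)%R] `&` tail W J); last first.
  by apply/seteqP; split=> v /=; [move=> /andP|move/andP].
apply: measurableI => //; rewrite -[X in measurable X]setTI.
exact: measurable_fun_ltr.
Qed.

(** Each constraint of [J] is added as a limit of thresholds. The list [l] stays general because the
    recursion on the exponent lengthens it. *)
Let laplace_tail J l : all (fun x => 0 <= x.1)%R l ->
  \int[P]_(u in tail Y J) (laplace Y l u)%:E =
  \int[P']_(u in tail Y' J) (laplace Y' l u)%:E.
Proof.
elim: J l => [|[i c] J IH] l l0.
  rewrite (_ : tail Y [::] = setT); last exact/seteqP.
  by rewrite (_ : tail Y' [::] = setT); [exact: eqL|exact/seteqP].
have tE d0 (V : measurableType d0) (W : I -> V -> R) :
    tail W ((i, c) :: J) = tail W J `&` [set v | (c < W i v)%R].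
  by apply/seteqP; split=> v /=; [move=> /andP[]|case=> ? ?; apply/andP].
(* A negative threshold is vacuous for nonnegative variables; the limit of thresholds handles
   [0 <= c]. *)
rewrite !tE; have [c0|c0] := ltP c 0%R.
  rewrite (_ : [set _ | _] = setT); last first.
    by apply/seteqP; split => // u _ /=; exact: lt_le_trans c0 _.
  rewrite (_ : [set v | (c < Y' i v)%R] = setT); last first.
    by apply/seteqP; split => // u _ /=; exact: lt_le_trans c0 _.
  by rewrite !setIT; exact: IH.
have := cvg_integral_thresh mY Y0 (P := P) (i := i) (measurable_tail J mY) c0 l0.
rewrite (_ : (fun n : nat => _) = fun n : nat => \int[P']_(u in tail Y' J)
    (thresh Y' (n%:R ^+ 2) (Num.truncn (expR (n%:R ^+ 2 * c + n%:R)%R)).+1 i u *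
       laplace Y' l u)%:E).
  move=> /cvg_lim <-//; apply/cvg_lim => //.
  exact: (cvg_integral_thresh mY' Y'0 (measurable_tail J mY') c0 l0).
apply/funext => n; have := sqr_ge0 (n%:R : R).
move: (n%:R ^+ 2)%R (Num.truncn _).+1 => s N s0.
elim: N l l0 => [|N IHN] l l0.
  under eq_integral do rewrite /thresh expr0 mul1r.
  by under [RHS]eq_integral do rewrite /thresh expr0 mul1r; exact: IH.
rewrite !integral_threshS//; try exact: measurable_tail.
by rewrite !IHN//= s0.
Qed.

(** Finite conjunctions of strict lower bounds form a pi-system that generates the sigma-algebra,
    and the sets on which the two laws agree form a lambda-system. Measurability of both preimages
    belongs to the induction predicate because the difference and limit steps rely on it. *)
Lemma laplace_unique (F : set (I -> R)) :
  <<s [set H | exists i c, H = [set y : I -> R | (c < y i)%R]] >> F ->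
  [/\ measurable [set u | F (Y ^~ u)], measurable [set u | F (Y' ^~ u)] &
      P [set u | F (Y ^~ u)] = P' [set u | F (Y' ^~ u)]].
Proof.
pose G := [set H | exists J : seq (I * R),
   H = [set y : I -> R | all (fun x => x.2 < y x.1)%R J]].
pose Q (H : set (I -> R)) := [/\ measurable [set u | H (Y ^~ u)],
   measurable [set u | H (Y' ^~ u)] &
   P [set u | H (Y ^~ u)] = P' [set u | H (Y' ^~ u)]].
suff GQ : <<s G >> `<=` Q.
  move=> sF; apply: GQ; move: F sF; apply: smallest_sub.
    exact: smallest_sigma_algebra.
  move=> H [i [c ->]]; apply: sub_sigma_algebra.
  by exists [:: (i, c)]; apply/seteqP; split => y /=; rewrite andbT.
apply: lambda_system_subset => //.
- move=> _ _ [J ->] [K ->]; exists (J ++ K).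
  by apply/seteqP; split=> y /=; rewrite all_cat; [move=> [-> ->]|move/andP].
- split => //.
  + by split; [exact: measurableT|exact: measurableT|rewrite !probability_setT].
  + move=> A B BA [mA mA' eA] [mB mB' eB]; split.
    * exact: measurableD.
    * exact: measurableD.
    * rewrite (_ : [set u | _] = [set u | A (Y ^~ u)] `\` [set u | B (Y ^~ u)])//.
      rewrite (_ : [set u | (A `\` B) (Y' ^~ u)] =
        [set u | A (Y' ^~ u)] `\` [set u | B (Y' ^~ u)])//.
      rewrite !measureD//; try by rewrite (le_lt_trans (probability_le1 _ _))// ltry.
      rewrite [X in _ - P X](_ : _ = [set u | B (Y ^~ u)]); last first.
        by rewrite setIidr// => u; exact: BA.
      rewrite [X in _ - P' X](_ : _ = [set u | B (Y' ^~ u)]); last first.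
        by rewrite setIidr// => u; exact: BA.
      by congr (_ - _); [exact: eA|exact: eB].
  + move=> H ndH' QH.
    have ndH n m : (n <= m)%N -> H n `<=` H m by move=> /ndH' /subsetPset.
    have mH : forall n, measurable [set u | H n (Y ^~ u)] by move=> n; case: (QH n).
    have mH' : forall n, measurable [set u | H n (Y' ^~ u)] by move=> n; case: (QH n).
    have E : [set u | (\bigcup_n H n) (Y ^~ u)] = \bigcup_n [set u | H n (Y ^~ u)].
      by [].
    have E' : [set u | (\bigcup_n H n) (Y' ^~ u)] = \bigcup_n [set u | H n (Y' ^~ u)].
      by [].
    rewrite /Q E E'; split; try exact: bigcupT_measurable.
    have nd : {homo (fun n => [set u | H n (Y ^~ u)]) : n m / (n <= m)%N >-> (n <= m)%O}.
      by move=> n m nm; apply/subsetPset => u; exact: ndH.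
    have nd' : {homo (fun n => [set u | H n (Y' ^~ u)]) : n m / (n <= m)%N >-> (n <= m)%O}.
      by move=> n m nm; apply/subsetPset => u; exact: ndH.
    have := nondecreasing_cvg_mu mH (bigcupT_measurable _ mH) nd (mu := P).
    move=> /cvg_lim <-//.
    have := nondecreasing_cvg_mu mH' (bigcupT_measurable _ mH') nd' (mu := P').
    move=> /cvg_lim <-//.
    by congr (limn _); apply/funext => n /=; case: (QH n).
- move=> _ [J ->]; split; try exact: measurable_tail.
  have := @laplace_tail J [::] isT; rewrite /laplace.
  under eq_integral do rewrite big_nil oppr0 expR0.
  under [in RHS]eq_integral do rewrite big_nil oppr0 expR0.
  by rewrite !integral_cst ?mul1e//; exact: measurable_tail.
Qed.

End laplace_unique.

(** * Exchanging random kernels in expectations of products *)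

Section replacement.
Context d (U : measurableType d) (R : realType) (P : probability U R).
Context d2 (T : measurableType d2) (act : nat -> U -> bool).
Hypothesis mact : forall k, measurable [set u | act k u].

(** In the applications [kap k u] is either the Dirac mass at a random variable, where the integral
    is [f k] evaluated there, or a law or conditional law of that variable. An inactive coordinate
    is neutral in a product. *)
Definition factor (kap : nat -> U -> {measure set T -> \bar R}) (f : nat -> T -> R)
    (k : nat) (u : U) : R :=
  if act k u then fine (\int[kap k u]_y (f k y)%:E) else 1%R.

Section one_family.
Variables (kap : nat -> U -> {measure set T -> \bar R}) (f : nat -> T -> R).
Hypotheses (mkap : forall k C, measurable C -> measurable_fun [set: U] (kap k ^~ C))
  (kap1 : forall k u, kap k u setT <= 1)
  (mf : forall k, measurable_fun [set: T] (f k))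
  (f01 : forall k y, (0 <= f k y <= 1)%R).

Lemma integral_kernel_itv01 k u : 0 <= \int[kap k u]_y (f k y)%:E <= 1.
Proof.
have f0 y : 0 <= (f k y)%:E by rewrite lee_fin; have /andP[] := f01 k y.
rewrite integral_ge0//= (le_trans _ (kap1 k u))//.
rewrite -[leRHS]mul1e -[leRHS]integral_cst//.
apply: ge0_le_integral => //; first exact/measurable_EFinP.
by move=> y _; rewrite lee_fin; have /andP[] := f01 k y.
Qed.

Lemma integral_kernel_fin k u : \int[kap k u]_y (f k y)%:E \is a fin_num.
Proof.
have /andP[h0 h1] := integral_kernel_itv01 k u.
by rewrite ge0_fin_numE// (le_lt_trans h1)// ltry.
Qed.

Lemma factor_itv01 k u : (0 <= factor kap f k u <= 1)%R.
Proof.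
rewrite /factor; case: ifP => _; last by rewrite ler01 lexx.
by rewrite -!lee_fin fineK ?integral_kernel_fin// integral_kernel_itv01.
Qed.

Lemma measurable_factor k : measurable_fun [set: U] (factor kap f k).
Proof.
apply: measurable_fun_ifT => //.
  by apply: (measurable_fun_bool true); rewrite setTI; exact: mact.
apply/measurableT_comp => //.
apply: measurable_integral_kernel => //.
- by move=> C mC; exact: mkap.
- exact/measurable_EFinP.
- by move=> y; rewrite lee_fin; have /andP[] := f01 k y.
Qed.

Lemma prod_factor_itv01 (n : nat) (Q : pred 'I_n) u :
  (0 <= \prod_(k < n | Q k) factor kap f k u <= 1)%R.
Proof.
rewrite prodr_ge0 ?prodr_ile1//= => k _; first exact: factor_itv01.
by have /andP[] := factor_itv01 k u.
Qed.

Lemma measurable_prod_factor (n : nat) (Q : pred 'I_n) :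
  measurable_fun [set: U] (fun u => \prod_(k < n | Q k) factor kap f k u)%R.
Proof.
under eq_fun do rewrite big_mkcond.
apply: measurable_prod => k _; case: (Q k) => //; exact: measurable_factor.
Qed.

(** The first summand is a mixture of the measures [kap j u] applied to [f j], the setting of
    [mixture_unique]; the second does not involve [f j]. *)
Lemma integral_prod_factor_split (n : nat) (j : 'I_n) :
  \int[P]_u (\prod_(k < n) factor kap f k u)%:E =
  \int[P]_(u in [set u | act j u])
    ((\prod_(k < n | k != j) factor kap f k u)%:E * \int[kap j u]_y (f j y)%:E) +
  \int[P]_(u in ~` [set u | act j u]) (\prod_(k < n | k != j) factor kap f k u)%:E.
Proof.
rewrite -(setUv [set u | act j u]) ge0_integral_setU//.
- congr (_ + _); apply: eq_integral => u; rewrite inE/= => au.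
    rewrite (bigD1 j)//= mulrC EFinM; congr (_ * _).
    by rewrite /factor au fineK// integral_kernel_fin.
  by rewrite (bigD1 j)//= /factor (negbTE (introN idP au)) mul1r.
- exact: measurableC.
- rewrite setUv; apply/measurable_EFinP; exact: measurable_prod_factor.
- by move=> u _; rewrite lee_fin; have /andP[] := @prod_factor_itv01 n xpredT u.
- by apply/disj_set2P; rewrite setICr.
Qed.

End one_family.

Variables (kap lam : nat -> U -> {measure set T -> \bar R}) (G : set (set T)).
Hypotheses (mkap : forall k C, measurable C -> measurable_fun [set: U] (kap k ^~ C))
  (kap1 : forall k u, kap k u setT <= 1)
  (mlam : forall k C, measurable C -> measurable_fun [set: U] (lam k ^~ C))
  (lam1 : forall k u, lam k u setT <= 1)
  (GE : @measurable _ T = <<s G >>) (GI : setI_closed G) (GT : G setT) (G0 : G set0).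
Variable n : nat.
Hypothesis eqG : forall B : nat -> set T, (forall k, G (B k)) ->
  \int[P]_u (\prod_(k < n) factor kap (fun k => \1_(B k)) k u)%:E =
  \int[P]_u (\prod_(k < n) factor lam (fun k => \1_(B k)) k u)%:E.

Let mG B : G B -> measurable B.
Proof. by move=> GB; rewrite GE; exact: sub_sigma_algebra. Qed.

(* The functions are freed one coordinate at a time; taking [B = set0] isolates
   the part of the integral where the coordinate is inactive. *)
Let replace_upto (j : nat) (f : nat -> T -> R) :
  (forall k, measurable_fun [set: T] (f k)) -> (forall k y, (0 <= f k y <= 1)%R) ->
  (forall k, (j <= k)%N -> exists2 B, G B & f k = \1_B) ->
  \int[P]_u (\prod_(k < n) factor kap f k u)%:E =
  \int[P]_u (\prod_(k < n) factor lam f k u)%:E.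
Proof.
elim: j f => [|j IH] f mf f01 fG.
  have /choice[B GB] k : exists B, G B /\ f k = \1_B.
    by have [//|B] := fG k; exists B.
  have -> : f = fun k => \1_(B k) by apply/funext => k; case: (GB k).
  by apply: eqG => k; case: (GB k).
(* Coordinates from [n] on do not enter the product, so [f] may be changed there to the indicator of
   [setT], which is admissible since [setT] is in [G]. *)
have [jn|nj] := ltnP j n; last first.
  pose f' k := if (k < n)%N then f k else \1_setT.
  have E K u : (\prod_(k < n) factor K f k u = \prod_(k < n) factor K f' k u)%R.
    by apply: eq_bigr => k _; rewrite /factor /f' ltn_ord.
  under eq_integral do rewrite E.
  under [RHS]eq_integral do rewrite E.
  apply: IH.
  - by move=> k; rewrite /f'; case: ifP.
  - by move=> k y; rewrite /f'; case: ifP => // _; rewrite indicT ler01 lexx.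
  - move=> k jk; rewrite /f' ltnNge (leq_trans nj jk)/=.
    by exists setT.
pose J := Ordinal jn.
pose fB (B : set T) k := if k == j then \1_B else f k.
have mfB B : G B -> forall k, measurable_fun [set: T] (fB B k).
  by move=> GB k; rewrite /fB; case: ifP => // _; apply: measurable_indic; exact: mG.
have fB01 B k y : (0 <= fB B k y <= 1)%R.
  rewrite /fB; case: ifP => // _; rewrite indicE.
  by case: (_ \in _); rewrite ?ler01 ?lexx.
have vE K B u : (\prod_(k < n | k != J) factor K (fB B) k u =
                 \prod_(k < n | k != J) factor K f k u)%R.
  apply: eq_bigr => k kJ; rewrite /factor /fB.
  by rewrite (_ : (k : nat) == j = false)//; exact: negbTE.
have IHB B : G B ->
  \int[P]_(u in [set u | act j u])
    ((\prod_(k < n | k != J) factor kap f k u)%:E * kap j u B) +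
  \int[P]_(u in ~` [set u | act j u]) (\prod_(k < n | k != J) factor kap f k u)%:E =
  \int[P]_(u in [set u | act j u])
    ((\prod_(k < n | k != J) factor lam f k u)%:E * lam j u B) +
  \int[P]_(u in ~` [set u | act j u]) (\prod_(k < n | k != J) factor lam f k u)%:E.
  move=> GB; have := IH (fB B) (mfB B GB) (fB01 B).
  rewrite (integral_prod_factor_split mkap kap1 (mfB B GB) (fB01 B) J).
  rewrite (integral_prod_factor_split mlam lam1 (mfB B GB) (fB01 B) J).
  have hE K : \int[P]_(u in [set u | act J u])
      ((\prod_(k < n | k != J) factor K (fB B) k u)%:E *
        \int[K J u]_y (fB B J y)%:E) =
    \int[P]_(u in [set u | act j u])
      ((\prod_(k < n | k != J) factor K f k u)%:E * K j u B).
    apply: eq_integral => u _; rewrite vE /fB eqxx integral_indic ?setIT//.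
    exact: mG.
  have hC K : \int[P]_(u in ~` [set u | act J u])
      (\prod_(k < n | k != J) factor K (fB B) k u)%:E =
    \int[P]_(u in ~` [set u | act j u])
      (\prod_(k < n | k != J) factor K f k u)%:E.
    by apply: eq_integral => u _; rewrite vE.
  rewrite (hE kap) (hE lam) (hC kap) (hC lam).
  apply=> k jk; rewrite /fB; case: eqVneq => [_|kj]; first by exists B.
  by apply: fG; rewrite ltn_neqAle eq_sym kj.
have fin_neg (K : nat -> U -> {measure set T -> \bar R}) D : measurable D ->
   (forall k C, measurable C -> measurable_fun [set: U] (K k ^~ C)) ->
   (forall k u, K k u setT <= 1) ->
   \int[P]_(u in D) (\prod_(k < n | k != J) factor K f k u)%:E \is a fin_num.
  move=> mD mK K1; apply: integrable_fin_num => //.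
  apply: integrable_itv01 => //; first exact: measurable_prod_factor.
  by move=> u; exact: prod_factor_itv01.
have mC : measurable (~` [set u | act j u]) by exact: measurableC.
have eqN : \int[P]_(u in ~` [set u | act j u])
     (\prod_(k < n | k != J) factor kap f k u)%:E =
   \int[P]_(u in ~` [set u | act j u])
     (\prod_(k < n | k != J) factor lam f k u)%:E.
  have := IHB set0 G0; under eq_integral do rewrite measure0 mule0.
  rewrite integral0 add0e => ->; under eq_integral do rewrite measure0 mule0.
  by rewrite integral0 add0e.
rewrite (integral_prod_factor_split mkap kap1 mf f01 J).
rewrite (integral_prod_factor_split mlam lam1 mf f01 J) eqN; congr (_ + _).
apply: (@mixture_unique _ _ _ _ _ _ _ P _ _ _ P _ _ _ G) => //.
- by apply: measurable_funTS; exact: measurable_prod_factor.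
- by move=> u; have /andP[] := prod_factor_itv01 kap1 mf f01 (fun k => k != J) u.
- by move=> C mC'; apply: measurable_funTS; exact: mkap.
- by apply: measurable_funTS; exact: measurable_prod_factor.
- by move=> u; have /andP[] := prod_factor_itv01 lam1 mf f01 (fun k => k != J) u.
- by move=> C mC'; apply: measurable_funTS; exact: mlam.
- apply: (@le_lt_trans _ _
    (\int[P]_(u in [set u | act j u]) (\prod_(k < n | k != J) factor kap f k u)%:E)).
    apply: ge0_le_integral => //.
    + move=> u _; rewrite mule_ge0// lee_fin.
      by have /andP[] := prod_factor_itv01 kap1 mf f01 (fun k => k != J) u.
    + apply: emeasurable_funM; apply: measurable_funTS; last exact: mkap.
      by apply/measurable_EFinP; exact: measurable_prod_factor.
    + apply: measurable_funTS; apply/measurable_EFinP.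
      exact: measurable_prod_factor.
    + move=> u _; rewrite -[leRHS]mule1 lee_wpmul2l// lee_fin.
      by have /andP[] := prod_factor_itv01 kap1 mf f01 (fun k => k != J) u.
  by rewrite ltey_eq fin_neg.
(* The inactive parts are finite and equal, so they cancel from [IHB C GC]. *)
- move=> C GC; have finN := fin_neg lam _ mC mlam lam1.
  have := congr1 (fun z => z - \int[P]_(u in ~` [set u | act j u])
     (\prod_(k < n | k != J) factor lam f k u)%:E) (IHB C GC).
  by rewrite eqN (addeK _ finN) (addeK _ finN).
- exact/measurable_EFinP.
- by move=> y; rewrite lee_fin; have /andP[] := f01 j y.
Qed.

(** Turns a product formula for events into one for functions. It serves three times: for
    independent Poisson counts, for marks given the atoms, and for iid sequences. *)
Lemma integral_prod_factor_replace (f : nat -> T -> R) :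
  (forall k, measurable_fun [set: T] (f k)) -> (forall k y, (0 <= f k y <= 1)%R) ->
  \int[P]_u (\prod_(k < n) factor kap f k u)%:E =
  \int[P]_u (\prod_(k < n) factor lam f k u)%:E.
Proof.
move=> mf f01; pose f' k := if (k < n)%N then f k else \1_setT.
have E K u : (\prod_(k < n) factor K f k u = \prod_(k < n) factor K f' k u)%R.
  by apply: eq_bigr => k _; rewrite /factor /f' ltn_ord.
under eq_integral do rewrite E.
under [RHS]eq_integral do rewrite E.
apply: (@replace_upto n).
- by move=> k; rewrite /f'; case: ifP.
- by move=> k y; rewrite /f'; case: ifP => // _; rewrite indicT ler01 lexx.
- by move=> k nk; rewrite /f' ltnNge nk/=; exists setT.
Qed.

End replacement.

(** * Laplace functionals of Poisson random measures *)

Section eexpN.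
Context {R : realType}.
Implicit Types x y : \bar R.

(* [exp (- |x|)] on the extended reals; it vanishes at infinity. *)
Definition eexpN x : R := if x \is a fin_num then expR (- `|fine x|) else 0%R.

Lemma eexpN_itv01 x : (0 <= eexpN x <= 1)%R.
Proof.
rewrite /eexpN; case: ifP => _; last by rewrite lexx ler01.
by rewrite expR_ge0 -[leRHS]expR0 ler_expR oppr_le0 normr_ge0.
Qed.

Lemma eexpN_EFin (r : R) : (0 <= r)%R -> eexpN r%:E = expR (- r).
Proof. by move=> r0; rewrite /eexpN/= ger0_norm. Qed.

Lemma eexpNy : eexpN +oo = 0%R. Proof. by []. Qed.

Lemma eexpN0 : eexpN 0 = 1%R.
Proof. by rewrite eexpN_EFin// oppr0 expR0. Qed.

Lemma eexpND x y : 0 <= x -> 0 <= y -> eexpN (x + y) = (eexpN x * eexpN y)%R.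
Proof.
move=> x0 y0; case: x x0 => [r| |]// r0; case: y y0 => [s| |]// s0.
- by rewrite -EFinD !eexpN_EFin ?addr_ge0// opprD expRD.
- by rewrite addey// eexpNy mulr0.
- by rewrite addye// eexpNy mul0r.
- by rewrite addye// eexpNy mul0r.
Qed.

Lemma eexpN_sum (I : Type) (s : seq I) (Q : pred I) (f : I -> \bar R) :
  (forall i, Q i -> 0 <= f i) ->
  eexpN (\sum_(i <- s | Q i) f i) = (\prod_(i <- s | Q i) eexpN (f i))%R.
Proof.
move=> f0; elim: s => [|i s IH]; first by rewrite !big_nil eexpN0.
rewrite !big_cons; case: ifP => // Qi.
by rewrite eexpND ?f0 ?IH//; exact: sume_ge0.
Qed.

Lemma measurable_eexpN : measurable_fun [set: \bar R] eexpN.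
Proof.
apply: measurable_fun_ifT => //.
  apply: (measurable_fun_bool true); rewrite setTI.
  by rewrite -[X in measurable X]setTI; exact: emeasurable_fin_num.
apply: measurableT_comp => //; apply: measurableT_comp => //.
by apply: measurableT_comp => //; exact: fine_measurable.
Qed.

Lemma cvg_eexpN (f : nat -> \bar R) x : (forall n, 0 <= f n) ->
  f @ \oo --> x -> (eexpN \o f) @ \oo --> eexpN x.
Proof.
move=> f0; have x0 : f @ \oo --> x -> 0 <= x.
  by move=> fx; rewrite -(cvg_lim _ fx)//; apply: lime_ge; [apply/cvg_ex; exists x|exact: nearW].
case: x x0 => [r| |] x0 fx; last by have := x0 fx.
  have r0 := x0 fx; move/fine_cvgP : fx => [ffin fr].
  have h : (fun n => expR (- fine (f n))) @ \oo --> (expR (- r) : R).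
    apply: continuous_cvg; first exact: continuous_expR.
    exact: cvgN.
  rewrite eexpN_EFin//; apply: cvg_trans h; apply: near_eq_cvg.
  near=> n; rewrite /= -[in RHS](@fineK _ (f n)); last by near: n.
  by rewrite eexpN_EFin// fine_ge0.
rewrite eexpNy; apply/cvgrPdist_le => e e0; near=> n.
rewrite sub0r normrN ger0_norm; last by have /andP[] := eexpN_itv01 (f n).
rewrite /=; have : (e^-1)%:E <= f n by near: n; move/cvgeyPge : fx; exact.
case: (f n) => [r| |]; last 2 first.
- by move=> _; rewrite eexpNy ltW.
- by [].
rewrite lee_fin => er; have r0 : (0 <= r)%R by rewrite (le_trans _ er)// invr_ge0 ltW.
rewrite eexpN_EFin// expRN -[leRHS]invrK lef_pV2 ?posrE ?expR_gt0 ?invr_gt0//.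
by rewrite (le_trans er)// (le_trans _ (expR_ge1Dx _))// lerDr.
Unshelve. all: by end_near. Qed.

End eexpN.

Lemma nneseries_set1 {R : realType} (m : {measure set nat -> \bar R}) :
  \sum_(0 <= n <oo) m [set n] = m setT.
Proof.
rewrite (_ : setT = \bigcup_(n in setT) [set n]); last first.
  by apply/seteqP; split => // n _; exists n.
rewrite measure_bigcup//; last by move=> i j _ _ [x [-> ->]].
by apply: eq_eseriesl => n; rewrite in_setT.
Qed.

(** Exponential tilting: weighting the Poisson law of mean [r] by [exp (- c n)] gives a multiple of
    the one of mean [r exp (- c)]. The Laplace transform is then read off from the total mass 1
    instead of a series. *)
Lemma poisson_prob_tilt {R : realType} (r c : R) n : (0 <= r)%R ->
  (expR (- (c * n%:R)))%:E * poisson_prob r 0%N [set n] =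
  (expR (- ((1 - expR (- c)) * r)))%:E * poisson_prob (r * expR (- c))%R 0%N [set n].
Proof.
(* At rate 0 the law [poisson_prob] is the Dirac mass at 0, so this case is separate. *)
rewrite le_eqVlt => /predU1P[<-|r0].
  rewrite mul0r mulr0 oppr0 expR0 mul1e /poisson_prob ltxx diracE.
  case: n => [|n]; first by rewrite mulr0 oppr0 expR0 mul1e.
  by rewrite memNset ?mule0.
have rc0 : (0 < r * expR (- c))%R by rewrite mulr_gt0// expR_gt0.
rewrite /poisson_prob r0 rc0 !esum_set1 ?lee_fin ?poisson_pmf_ge0//.
rewrite -!EFinM /poisson_pmf r0 rc0 exprMn -expRM_natr.
have -> : (- c * n%:R = - (c * n%:R))%R by rewrite mulNr.
have -> : (- ((1 - expR (- c)) * r) = - r + r * expR (- c))%R by ring.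
rewrite expRD; congr EFin.
rewrite (expRN (r * expR (- c))%R).
have h : expR (r * expR (- c))%R != 0%R by rewrite gt_eqF ?expR_gt0.
by field; rewrite h pnatr_eq0 -lt0n fact_gt0.
Qed.

Lemma integral_eexpN_poisson d (U : measurableType d) (R : realType)
    (P : probability U R) (Y : U -> \bar R) (m : \bar R) (c : R) :
  measurable_fun [set: U] Y -> (0 <= c)%R -> 0 <= m -> poisson_law P Y m ->
  \int[P]_u (eexpN (c%:E * Y u))%:E = (eexpN ((1 - expR (- c))%:E * m))%:E.
Proof.
move=> mY c0 m0.
have mcY : measurable_fun [set: U] (fun u => (eexpN (c%:E * Y u))%:E).
  apply/measurable_EFinP; apply: measurableT_comp; first exact: measurable_eexpN.
  exact: measurable_funeM.
have c1 : (0 <= 1 - expR (- c))%R.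
  by rewrite subr_ge0 -[leRHS]expR0 ler_expR oppr_le0.
have e0 (x : \bar R) : 0 <= (eexpN x)%:E by rewrite lee_fin; have /andP[] := eexpN_itv01 x.
case: m m0 => [r| |]// r0 pY; last first.
  have mA : measurable (Y @^-1` [set +oo]).
    by rewrite -[X in measurable X]setTI; exact: mY.
  have -> : \int[P]_u (eexpN (c%:E * Y u))%:E =
      \int[P]_u (eexpN (c%:E * +oo))%:E.
    apply: ge0_ae_eq_integral => //.
    exists (~` (Y @^-1` [set +oo])); split; first exact: measurableC.
      transitivity (1 - P (Y @^-1` [set +oo])); first exact: probability_setC.
      by rewrite [X in 1 - X](_ : _ = 1); [rewrite subee|exact: pY].
    by move=> u /= h Yu; apply: h => _; rewrite Yu.
  rewrite integral_cst//= probability_setT mule1.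
  have [->|cn0] := eqVneq c 0%R.
    by rewrite oppr0 expR0 subrr !mul0e eexpN0.
  have cgt : (0 < c)%R by rewrite lt_def cn0.
  rewrite !gt0_muley ?lte_fin// subr_gt0 -[ltRHS]expR0 ltr_expR oppr_lt0//.
(* [poisson_law] prescribes the probabilities of integer values only. They add up to 1, so all other
   values of [Y] are negligible and the integral splits over the sets [A n]. *)
pose A n : set U := Y @^-1` [set n%:R%:E].
have mA n : measurable (A n) by rewrite -[X in measurable X]setTI; exact: mY.
have tA : trivIset setT A.
  move=> i j _ _ [u []]; rewrite /A/= => -> /eqP.
  by rewrite eqe eqr_nat => /eqP.
have mUA : measurable (\bigcup_n A n) by exact: bigcupT_measurable.
have PUA : P (\bigcup_n A n) = 1.
  rewrite measure_bigcup//.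
  transitivity (\sum_(0 <= n <oo) poisson_prob r 0%N [set n]).
    by rewrite eseries_mkcond; apply: eq_eseriesr => n _; rewrite in_setT; exact: pY.
  by rewrite nneseries_set1; exact: probability_setT.
have iY : P.-integrable setT (fun u => (eexpN (c%:E * Y u))%:E).
  apply: (@integrable_itv01 _ _ _ P setT (fun u => eexpN (c%:E * Y u))) => //.
    exact/measurable_EFinP.
  by move=> u; exact: eexpN_itv01.
rewrite (ge0_negligible_integral (N := ~` \bigcup_n A n))//; last 2 first.
- exact: measurableC.
- transitivity (1 - P (\bigcup_n A n)); first exact: probability_setC.
  by rewrite [X in 1 - X]PUA subee.
rewrite setDE setCK setTI integral_bigcup//; last first.
  by apply: integrableS iY.
transitivity (\sum_(0 <= n <oo) ((expR (- ((1 - expR (- c)) * r)))%:E *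
    poisson_prob (r * expR (- c))%R 0%N [set n])).
  apply: eq_eseriesr => n _; rewrite -poisson_prob_tilt//.
  transitivity (\int[P]_(u in A n) (expR (- (c * n%:R)))%:E).
    apply: eq_integral => u; rewrite inE /A/= => ->.
    by rewrite -EFinM eexpN_EFin// mulr_ge0.
  by rewrite integral_cst//; congr (_ * _); exact: pY.
rewrite nneseriesZl; last by move=> n _; exact: measure_ge0.
rewrite nneseries_set1 [X in _ * X](_ : _ = 1); last exact: probability_setT.
by rewrite mule1 -EFinM eexpN_EFin// mulr_ge0.
Qed.

Lemma law_measure d (U : measurableType d) (R : realType) (P : {measure set U -> \bar R})
    d2 (T : measurableType d2) (Y : U -> T) : measurable_fun [set: U] Y ->
  exists2 M : {measure set T -> \bar R},
    (forall C, measurable C -> M C = P (Y @^-1` C)) &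
    forall f, measurable_fun [set: T] f -> (forall y, 0 <= f y) ->
      \int[M]_y f y = \int[P]_u f (Y u).
Proof.
move=> mY.
have mk C : measurable C -> measurable_fun [set: U] (fun u => (\d_(Y u) C : \bar R)).
  move=> mC; apply/measurable_EFinP => /=.
  by apply: measurableT_comp => //; exact: measurable_indic.
have [M ME Mf] := @mixture_measure _ _ U T R P setT (fun=> 1%R)
  (fun u => \d_(Y u)) measurableT (measurable_cst _) (fun=> ler01) mk.
exists M => [C mC|f mf f0].
  rewrite ME; under eq_integral do rewrite mul1e.
  transitivity (\int[P]_u (\1_(Y @^-1` C) u)%:E); first exact: eq_integral.
  rewrite integral_indic ?setIT//.
  by rewrite -[X in measurable X]setTI; exact: mY.
rewrite Mf//; apply: eq_integral => u _.
by rewrite mul1e integral_dirac// diracT mul1e.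
Qed.

(* The library's Lebesgue measure lives on [measurableTypeR R], whose measurable
   structure is a different record from the one inferred for [R]. *)
Lemma lebesgue_measure_real (R : realType) : exists2 L : {measure set R -> \bar R},
  (forall C, measurable C -> L C = lebesgue_measure C) &
  forall (D : set R) f, measurable D -> measurable_fun D f ->
    (forall x, D x -> 0 <= f x) ->
    \int[L]_(x in D) f x = \int[lebesgue_measure]_(x in D) f x.
Proof.
have mid : measurable_fun [set: measurableTypeR R] (idfun : measurableTypeR R -> R).
  by move=> _ B mB; rewrite setTI; exact: mB.
have [L LE Lf] := law_measure (@lebesgue_measure R) mid.
exists L => // D f mD mf f0.
rewrite integral_mkcond Lf; last 2 first.
- exact/(measurable_restrictT _ _).1.
- by apply: erestrict_ge0.
by rewrite [RHS]integral_mkcond.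
Qed.

Lemma prod_indic (R : realType) (U : Type) (n : nat) (A : 'I_n -> set U) u :
  (\prod_(k < n) \1_(A k) u = \1_[set v | forall k, A k v] u :> R)%R.
Proof.
have [h|h] := pselect (forall k, A k u).
  rewrite (@indicE _ R [set v | _]) mem_set// big1// => k _.
  by rewrite indicE mem_set.
rewrite (@indicE _ R [set v | _]) memNset//.
have [k hk] : exists k, ~ A k u by exact/existsNP.
by rewrite (bigD1 k)//= indicE memNset// mul0r.
Qed.

Lemma nondecreasing_cvg_integral d (T : measurableType d) (R : realType)
    (m : {measure set T -> \bar R}) (f_ : nat -> T -> \bar R) (f : T -> \bar R) :
  (forall n, measurable_fun [set: T] (f_ n)) -> (forall n t, 0 <= f_ n t) ->
  (forall t, {homo f_ ^~ t : p q / (p <= q)%N >-> p <= q}) ->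
  (forall t, f_ ^~ t @ \oo --> f t) ->
  (fun n => \int[m]_t f_ n t) @ \oo --> \int[m]_t f t.
Proof.
move=> mf f0 nd cf.
rewrite (_ : \int[m]_t f t = \int[m]_t limn (f_ ^~ t)).
  by apply: cvg_monotone_convergence => // t _ p q pq; exact: nd.
by apply: eq_integral => t _; apply/esym/cvg_lim => //; exact: cf.
Qed.

Section prm_laplace.
Import HBNNSimple.
Context d (U : measurableType d) (R : realType) (P : probability U R).
Context dS (S : measurableType dS) (live : nat -> U -> bool) (x : nat -> U -> S).
Variable nu : {measure set S -> \bar R}.
Hypotheses (mlive : forall k, measurable [set u | live k u])
  (mx : forall k, measurable_fun [set: U] (x k))
  (prm : poisson_random_measure P nu (atomic_measure R live x)).

(** The integral of [g] against the point measure [atomic_measure R live x]. *)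
Definition atom_sum (g : S -> R) (u : U) : \bar R :=
  \sum_(0 <= k <oo | live k u) (g (x k u))%:E.

Let measurable_term (g : S -> R) k : measurable_fun [set: S] g ->
  measurable_fun [set: U] (fun u => if live k u then (g (x k u))%:E else 0).
Proof.
move=> mg; apply: measurable_fun_ifT => //.
  by apply: (measurable_fun_bool true); rewrite setTI; exact: mlive.
by apply/measurable_EFinP; exact: measurableT_comp.
Qed.

Lemma measurable_atom_sum (g : S -> R) : measurable_fun [set: S] g ->
  (forall s, (0 <= g s)%R) -> measurable_fun [set: U] (atom_sum g).
Proof.
move=> mg g0.
rewrite (_ : atom_sum g = fun u => \sum_(0 <= k <oo | k \in xpredT)
    (if live k u then (g (x k u))%:E else 0)).
  apply: ge0_emeasurable_sum => k; last by move=> _; exact: measurable_term.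
  by move=> u _ _; case: ifP => // _; rewrite lee_fin.
by apply/funext => u; rewrite /atom_sum eseries_mkcond.
Qed.

(** For a simple [g] the atom sum is a combination of the counts on the level sets of [g]; these are
    disjoint, so the counts are independent Poisson variables and the transform factorises. *)
Lemma laplace_prm_nnsfun (g : {nnsfun S >-> R}) :
  \int[P]_u (eexpN (atom_sum g u))%:E =
  (eexpN (\int[nu]_s (1 - expR (- g s))%:E))%:E.
Proof.
pose r : seq R := enum_fset (fset_set (range g)); pose n := size r.
pose y k := nth (-1)%R r k; pose C k := g @^-1` [set y k].
pose N k u := atomic_measure R live x u (C k).
have ur : uniq r by exact: fset_uniq.
have gr s : g s \in r.
  suff : g s \in fset_set (range g) by [].
  by rewrite in_fset_set ?inE//; exact: fimfunP.
have y0 k : (k < n)%N -> (0 <= y k)%R.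
  move=> kn; have : y k \in fset_set (range g) by exact: mem_nth.
  by rewrite in_fset_set ?inE; [move=> [s _ <-]|exact: fimfunP].
have mC k : measurable (C k).
  by rewrite -[X in measurable X]setTI; apply: (@measurable_funPT _ _ _ _ g).
(* Used with the identity for the atom sum and with [1 - exp (- r)] for the exponent. *)
have phiE (phi : R -> R) s : phi (g s) = (\sum_(i < n) phi (y i) * \1_(C i) s)%R.
  have ks : (index (g s) r < n)%N by rewrite index_mem.
  rewrite (bigD1 (Ordinal ks))//= big1 ?addr0.
    by rewrite indicE mem_set ?mulr1 /C /y/= nth_index.
  move=> i ik; rewrite indicE memNset ?mulr0//= => gsi.
  by move/eqP : ik; apply; apply/val_inj; rewrite /= gsi index_uniq.
have N0 k u : 0 <= N k u by apply: nneseries_ge0.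
have mN k : measurable_fun [set: U] (N k) by case: prm => + _ _; apply.
have NE k u : N k u = \sum_(0 <= j <oo) if live j u then \d_(x j u) (C k) else 0.
  by rewrite /N /atomic_measure eseries_mkcond.
have sumE u : atom_sum g u = \sum_(i < n) (y i)%:E * N i u.
  rewrite /atom_sum eseries_mkcond.
  transitivity (\sum_(0 <= j <oo) \sum_(i < n)
      ((y i)%:E * if live j u then \d_(x j u) (C i) else 0)).
    apply: eq_eseriesr => j _; case: ifP => _; last first.
      by rewrite big1// => i _; rewrite mule0.
    by rewrite (phiE id) -sumEFin.
  rewrite nneseries_sum; last first.
    by move=> i j _; rewrite mule_ge0 ?lee_fin ?y0//; case: ifP.
  apply: eq_bigr => i _; rewrite NE nneseriesZl//.
  by move=> j _; case: ifP.
have c0 i : (i < n)%N -> (0 <= 1 - expR (- y i))%R.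
  by move=> /y0 yi; rewrite subr_ge0 -[leRHS]expR0 ler_expR oppr_le0.
have nuE : \int[nu]_s (1 - expR (- g s))%:E =
    \sum_(i < n) (1 - expR (- y i))%:E * nu (C i).
  transitivity (\int[nu]_s \sum_(i < n) ((1 - expR (- y i)) * \1_(C i) s)%:E).
    apply: eq_integral => s _.
    by rewrite (phiE (fun r => 1 - expR (- r))%R) -sumEFin.
  rewrite ge0_integral_sum//.
  - apply: eq_bigr => i _; under eq_integral do rewrite EFinM.
    rewrite ge0_integralZl//; first by rewrite integral_indic ?setIT.
    + by apply/measurable_EFinP; exact: measurable_indic.
    + by rewrite lee_fin c0.
  - by move=> i; apply/measurable_EFinP; apply: measurable_funM.
  - by move=> i s _; rewrite lee_fin mulr_ge0// c0.
have /choice[M HM] k : exists M : {measure set (\bar R) -> \bar R},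
    (forall C, measurable C -> M C = P (N k @^-1` C)) /\
    forall f, measurable_fun [set: \bar R] f -> (forall y, 0 <= f y) ->
      \int[M]_y f y = \int[P]_u f (N k u).
  by have [M M1 M2] := law_measure P (mN k); exists M.
pose f k z := eexpN ((y k)%:E * z).
have mf k : measurable_fun [set: \bar R] (f k).
  by apply: measurableT_comp; [exact: measurable_eexpN|exact: measurable_funeM].
have f01 k z : (0 <= f k z <= 1)%R by exact: eexpN_itv01.
have mNB k B : measurable B -> measurable (N k @^-1` B).
  by move=> mB; rewrite -[X in measurable X]setTI; exact: mN.
have kapE (h : nat -> \bar R -> R) : (forall k, measurable_fun setT (h k)) ->
    forall k u, factor (fun _ _ => true) (fun k u => \d_(N k u)) h k u = h k (N k u).
  move=> mh k u; rewrite /factor integral_dirac ?diracT ?mul1e//.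
  exact/measurable_EFinP.
have lamE (h : nat -> \bar R -> R) : (forall k, measurable_fun setT (h k)) ->
    (forall k z, (0 <= h k z)%R) ->
    forall k (u : U), factor (fun _ _ => true) (fun k _ => M k) h k u =
      fine (\int[P]_u (h k (N k u))%:E).
  move=> mh h0 k u; rewrite /factor (HM k).2//; first exact/measurable_EFinP.
  by move=> z; rewrite lee_fin.
(* Independence of the counts: the Dirac mass at [N k u] is exchanged for the law [M k], after which
   the integrand is constant. *)
have key : \int[P]_u (\prod_(k < n)
      factor (fun _ _ => true) (fun k u => \d_(N k u)) f k u)%:E =
    \int[P]_u (\prod_(k < n)
      factor (fun _ _ => true) (fun k _ => M k) f k u)%:E.
  apply: (@integral_prod_factor_replace _ U R P _ (\bar R) (fun _ _ => true) _
    (fun k u => \d_(N k u)) (fun k _ => M k) measurable) => //.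
  - move=> k; rewrite (_ : [set _ | _] = setT)//; exact/seteqP.
  - move=> k B mB; apply/measurable_EFinP => /=.
    by apply: measurableT_comp => //; exact: measurable_indic.
  - by move=> k u; rewrite [leLHS](_ : _ = 1)//; exact: diracT.
  - by move=> k u; rewrite (HM k).1// preimage_setT probability_setT.
  - by rewrite sigma_algebra_id//; exact: sigma_algebra_measurable.
  - by move=> A B; exact: measurableI.
  move=> B mB.
  have mind k : measurable_fun setT (\1_(B k) : _ -> R) by exact: measurable_indic.
  under eq_integral do under eq_bigr do rewrite kapE//.
  under [RHS]eq_integral do under eq_bigr do rewrite lamE//.
  transitivity (\int[P]_u (\1_[set u | forall k : 'I_n, (N k @^-1` B k) u] u)%:E).
    by apply: eq_integral => u _; rewrite -prod_indic.
  have E : [set u | forall k : 'I_n, (N k @^-1` B k) u] =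
      \bigcap_(k in [set` enum 'I_n]) (N k @^-1` B k).
    apply/seteqP; split=> u /= h k; first by move=> _; exact: h.
    by apply: h; rewrite /= mem_enum.
  rewrite integral_indic ?setIT//; last first.
    by rewrite E; apply: fin_bigcap_measurable => [|k _]; [exact: finite_finset|exact: mNB].
  rewrite E integral_cst// [X in _ = _ * X](_ : _ = 1); last exact: probability_setT.
  rewrite mule1; case: prm => _ _ /(_ n (fun k : 'I_n => C k)).
  move=> /(_ (fun k => mC k)) ind.
  have tC : trivIset [set: 'I_n] (fun k : 'I_n => C k).
    move=> a c _ _ [s [/= gsa gsc]]; apply/val_inj => /=; apply/eqP.
    by rewrite -(nth_uniq (-1)%R _ _ ur)//; apply/eqP; rewrite -/(y a) -/(y c) -gsa.
  transitivity (\prod_(k <- enum 'I_n) P (N k @^-1` B k)).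
    apply: (ind tC (enum 'I_n) (fun k => N k @^-1` B k) (enum_uniq _)).
    by move=> k _; exists (B k) => //; rewrite setTI.
  rewrite big_enum/= -prodEFin; apply: eq_bigr => k _.
  under eq_integral do rewrite -[(\1_(B k) _)%R]/(\1_(N k @^-1` B k) _).
  rewrite integral_indic ?setIT//; last exact: mNB.
  by rewrite fineK// fin_num_measure//; exact: mNB.
rewrite nuE; transitivity (\int[P]_u (\prod_(k < n) f k (N k u))%:E).
  apply: eq_integral => u _; rewrite sumE eexpN_sum// => k _.
  by rewrite mule_ge0 ?lee_fin ?y0.
under eq_integral do under eq_bigr do rewrite -kapE//.
rewrite key.
have f0 k z : (0 <= f k z)%R by have /andP[] := f01 k z.
transitivity (\int[P]_u
    (\prod_(k < n) eexpN ((1 - expR (- y k))%:E * nu (C k)))%:E).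
  apply: eq_integral => u _; congr EFin; apply: eq_bigr => k _.
  rewrite lamE// /f (@integral_eexpN_poisson _ _ _ P _ (nu (C k)))// ?y0//.
  by case: prm => _ + _; apply.
rewrite integral_cst// [X in _ * X](_ : _ = 1); last exact: probability_setT.
rewrite mule1 eexpN_sum// => k _.
by rewrite mule_ge0 ?lee_fin ?c0.
Qed.

Let integral_gap_itv01 (g : S -> R) s : (0 <= g s)%R -> (0 <= 1 - expR (- g s))%R.
Proof. by move=> g0; rewrite subr_ge0 -[leRHS]expR0 ler_expR oppr_le0. Qed.

Lemma laplace_prm (g : S -> R) : measurable_fun [set: S] g ->
  (forall s, (0 <= g s)%R) ->
  \int[P]_u (eexpN (atom_sum g u))%:E =
  (eexpN (\int[nu]_s (1 - expR (- g s))%:E))%:E.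
Proof.
move=> mg g0.
have mgE : measurable_fun [set: S] (EFin \o g) by exact/measurable_EFinP.
pose h := nnsfun_approx measurableT mgE.
have hgE s : (fun n => (h n s)%:E) @ \oo --> (g s)%:E.
  by apply: cvg_nnsfun_approx => // t _; rewrite lee_fin.
have hg s : (fun n => h n s) @ \oo --> g s by have /fine_cvgP[] := hgE s.
have ndh s : {homo (fun n => h n s) : p q / (p <= q)%N >-> (p <= q)%R}.
  by move=> p q pq; exact/lefP/nd_nnsfun_approx.
have mh n : measurable_fun [set: S] (h n) by [].
have atom_cvg u : (fun n => atom_sum (h n) u) @ \oo --> atom_sum g u.
  pose q (f : S -> R) k := if live k u then (f (x k u))%:E else 0.
  have q0 f k : (forall s, 0 <= f s)%R -> 0 <= q f k.
    by move=> f0; rewrite /q; case: ifP => // _; rewrite lee_fin.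
  (* Written as an integral against the counting measure, the atom sum obeys monotone
     convergence. *)
  have qE f : (forall s, 0 <= f s)%R -> atom_sum f u = \int[counting]_k q f k.
    by move=> f0; rewrite ge0_integral_count ?/atom_sum 1?eseries_mkcond// => k; exact: q0.
  under eq_fun do rewrite qE//.
  rewrite qE//; apply: nondecreasing_cvg_integral => //.
  - by move=> n k; exact: q0.
  - by move=> k p r pr; rewrite /q; case: ifP => // _; rewrite lee_fin; exact: ndh.
  - move=> k; rewrite /q; case: (live k u); [exact: hgE|exact: cvg_cst].
have lhs : (fun n => \int[P]_u (eexpN (atom_sum (h n) u))%:E) @ \oo -->
    \int[P]_u (eexpN (atom_sum g u))%:E.
  have mE (f : S -> R) : measurable_fun [set: S] f -> (forall s, 0 <= f s)%R ->
      measurable_fun setT (fun u => (eexpN (atom_sum f u))%:E).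
    move=> mf f0; apply/measurable_EFinP.
    by apply: measurableT_comp; [exact: measurable_eexpN|exact: measurable_atom_sum].
  have [|||||_ _] := @dominated_convergence _ _ _ P setT measurableT
    (fun n u => (eexpN (atom_sum (h n) u))%:E)
    (fun u => (eexpN (atom_sum g u))%:E) (cst 1); last exact.
  - by move=> n; exact: mE.
  - exact: mE.
  - apply: aeW => u _; apply: cvg_EFin; first exact: nearW.
    apply: cvg_eexpN => [n|]; last exact: atom_cvg.
    by apply: nneseries_ge0 => k _ _; rewrite lee_fin.
  - exact: finite_measure_integrable_cst.
  - apply: aeW => u n _; rewrite lee_fin.
    by have /andP[e0 e1] := eexpN_itv01 (atom_sum (h n) u); rewrite ger0_norm.
have rhs : (fun n => \int[nu]_s (1 - expR (- h n s))%:E) @ \oo -->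
    \int[nu]_s (1 - expR (- g s))%:E.
  apply: nondecreasing_cvg_integral.
  - move=> n; apply/measurable_EFinP; apply: measurable_funB => //.
    by apply: measurableT_comp => //; exact: measurableT_comp.
  - by move=> n s; rewrite lee_fin integral_gap_itv01.
  - by move=> s p q pq; rewrite lee_fin lerD2l lerN2 ler_expR lerN2; exact: ndh.
  - move=> s; apply: cvg_EFin; first exact: nearW.
    apply: cvgB; first exact: cvg_cst.
    apply: continuous_cvg; first exact: continuous_expR.
    by apply: cvgN; exact: hg.
rewrite -(cvg_lim _ lhs)//; apply/cvg_lim => //.
under eq_fun do rewrite laplace_prm_nnsfun.
apply: cvg_EFin; first exact: nearW.
apply: cvg_eexpN => [n|]; last exact: rhs.
by apply: integral_ge0 => s _; rewrite lee_fin integral_gap_itv01.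
Qed.

End prm_laplace.

(** * Marked Poisson random measures *)

Lemma bounded_cvg_integral d (U : measurableType d) (R : realType)
    (P : probability U R) (f_ : nat -> U -> R) (f : U -> R) :
  (forall n, measurable_fun [set: U] (f_ n)) -> measurable_fun [set: U] f ->
  (forall n u, (0 <= f_ n u <= 1)%R) ->
  (forall u, f_ ^~ u @ \oo --> f u) ->
  (fun n => \int[P]_u (f_ n u)%:E) @ \oo --> \int[P]_u (f u)%:E.
Proof.
move=> mf_ mf f01 cf.
have [|||||_ _] := @dominated_convergence _ _ _ P setT measurableT
  (fun n u => (f_ n u)%:E) (fun u => (f u)%:E) (cst 1); last exact.
- by move=> n; exact/measurable_EFinP.
- exact/measurable_EFinP.
- by apply: aeW => u _; apply: cvg_EFin; [exact: nearW|exact: cf].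
- exact: finite_measure_integrable_cst.
- apply: aeW => u n _; rewrite lee_fin.
  by have /andP[e0 e1] := f01 n u; rewrite ger0_norm.
Qed.

Section marked_exponent.
Context (R : realType) dS (S : measurableType dS) dE (E : measurableType dE).
Variable K : R.-pker S ~> E.

Let mpair s : measurable_fun [set: E] (fun a : E => (s, a) : S * E).
Proof. exact: measurable_fun_pair. Qed.

(** Strict positivity makes the logarithm in [marked_exponent] legitimate: if the integral of the
    positive function [exp (- g)] were 0, the probability [K s] would be null. *)
Lemma fine_integral_expR_gt0 (g : S * E -> R) s : measurable_fun [set: S * E] g ->
  (forall z, (0 <= g z)%R) ->
  (0 < fine (\int[K s]_a (expR (- g (s, a)))%:E) <= 1)%R.
Proof.
move=> mg g0.
have mh : measurable_fun [set: E] (fun a => (expR (- g (s, a)))%:E).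
  apply/measurable_EFinP; apply: measurableT_comp => //.
  by apply: measurableT_comp => //; apply: measurableT_comp (mpair s).
have h1 : \int[K s]_a (expR (- g (s, a)))%:E <= 1.
  rewrite -(prob_kernel (s := K) s) -[leRHS]mul1e -[leRHS]integral_cst//.
  apply: ge0_le_integral => //.
  by move=> a _; rewrite lee_fin -[leRHS]expR0 ler_expR oppr_le0.
have h0 : 0 <= \int[K s]_a (expR (- g (s, a)))%:E by exact: integral_ge0.
have hfin : \int[K s]_a (expR (- g (s, a)))%:E \is a fin_num.
  by rewrite ge0_fin_numE// (le_lt_trans h1)// ltry.
rewrite -lte_fin -lee_fin fineK// h1 andbT lt_def h0 andbT.
apply/eqP => h; have : \int[K s]_a `|(expR (- g (s, a)))%:E| = 0.
  by apply: etrans h; apply: eq_integral => a _; rewrite gee0_abs.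
move/ae_eq_integral_abs => /(_ measurableT mh) [N [mN N0 sN]].
have NT : N = setT.
  apply/seteqP; split => // a _; apply: sN => /= /(_ I) [].
  by apply/eqP; rewrite gt_eqF// expR_gt0.
by have := prob_kernel (s := K) s; rewrite -NT N0 => /esym/eqP; rewrite onee_eq0.
Qed.

(** The function [h] on unmarked points for which integrating out the marks turns the product of the
    [exp (- g (x k, A k))] into the product of the [exp (- h (x k))]. *)
Definition marked_exponent (g : S * E -> R) (s : S) : R :=
  (- ln (fine (\int[K s]_a (expR (- g (s, a)))%:E)))%R.

Lemma expR_marked_exponent (g : S * E -> R) s : measurable_fun [set: S * E] g ->
  (forall z, (0 <= g z)%R) ->
  expR (- marked_exponent g s) = fine (\int[K s]_a (expR (- g (s, a)))%:E).
Proof.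
move=> mg g0; rewrite opprK lnK// posrE.
by have /andP[] := fine_integral_expR_gt0 s mg g0.
Qed.

Lemma marked_exponent_ge0 (g : S * E -> R) s : measurable_fun [set: S * E] g ->
  (forall z, (0 <= g z)%R) -> (0 <= marked_exponent g s)%R.
Proof.
move=> mg g0; rewrite oppr_ge0 ln_le0//.
by have /andP[] := fine_integral_expR_gt0 s mg g0.
Qed.

Lemma measurable_marked_exponent (g : S * E -> R) : measurable_fun [set: S * E] g ->
  measurable_fun [set: S] (marked_exponent g).
Proof.
move=> mg; apply: measurableT_comp => //; apply: measurableT_comp; first exact: measurable_ln.
apply: measurableT_comp; first exact: fine_measurable.
apply: (measurable_fun_integral_finite_kernel
  (fun z => (expR (- g z))%:E) K) => //.
by apply/measurable_EFinP; apply: measurableT_comp => //; exact: measurableT_comp.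
Qed.

End marked_exponent.

Section marking.
Context d (U : measurableType d) (R : realType) (P : probability U R).
Context dS (S : measurableType dS) dE (E : measurableType dE).
Variables (live : nat -> U -> bool) (x : nat -> U -> S) (A : nat -> U -> E).
Variable K : R.-pker S ~> E.
Hypotheses (mlive : forall k, measurable [set u | live k u])
  (mx : forall k, measurable_fun [set: U] (x k))
  (mA : forall k, measurable_fun [set: U] (A k))
  (mark : forall (D : set U) (n : nat) (B : nat -> set E),
    atom_sigma live x D -> (forall k, measurable (B k)) ->
    P (D `&` [set u | forall k, (k < n)%N -> live k u -> B k (A k u)]) =
    \int[P]_(u in D) \prod_(0 <= k < n | live k u) K (x k u) (B k)).

Let mxA k : measurable_fun [set: U] (fun u => (x k u, A k u)).
Proof. exact: measurable_fun_pair. Qed.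

Let mpair s : measurable_fun [set: E] (fun a : E => (s, a) : S * E).
Proof. exact: measurable_fun_pair. Qed.

(** The event says that no live atom of index below [n] leaves its set: it is the complement of a
    union of generators, with [set0] for the remaining indices. *)
Lemma atom_sigma_bigcap (n : nat) (C : nat -> set S) :
  (forall k, measurable (C k)) ->
  atom_sigma live x [set u | forall k, (k < n)%N -> live k u -> C k (x k u)].
Proof.
move=> mC; pose F k := [set u | live k u /\ (if (k < n)%N then ~` C k else set0) (x k u)].
rewrite (_ : [set u | _] = setT `\` \bigcup_k F k).
  apply: sigma_algebraCD; apply: sigma_algebra_bigcup => k.
  apply: sub_sigma_algebra; exists k; exists (if (k < n)%N then ~` C k else set0) => //.
  by case: ifP => // _; exact: measurableC.
apply/seteqP; split=> [u h|u [_ h] k kn lk].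
  split => // -[k _ [lk]]; case: ifP => // kn; apply; exact: h.
apply: contrapT => Cx; apply: h; exists k => //; split => //.
by rewrite kn.
Qed.

(** On rectangles [C k] times [B k] the identity is the hypothesis [mark]: the constraints on the
    points form an event [D] of [atom_sigma], those on the marks are the other event. Rectangles
    form a generating pi-system, so the kernels can be exchanged. *)
Lemma integral_marks (n : nat) (f : S * E -> R) :
  measurable_fun [set: S * E] f -> (forall z, (0 <= f z <= 1)%R) ->
  \int[P]_u (\prod_(k < n) if live k u then f (x k u, A k u) else 1%R)%:E =
  \int[P]_u (\prod_(k < n) if live k u then
    fine (\int[K (x k u)]_a (f (x k u, a))%:E) else 1%R)%:E.
Proof.
move=> mf f01.
(* [L s] is the law of [(s, a)] with [a] drawn from [K s], hence [L (x k u)] is the conditional law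
   of the marked point. *)
have /choice[L HL] s : exists M : {measure set (S * E) -> \bar R},
    (forall C, measurable C -> M C = K s [set a | C (s, a)]) /\
    forall h, measurable_fun [set: S * E] h -> (forall y, 0 <= h y) ->
      \int[M]_y h y = \int[K s]_a h (s, a).
  by have [M M1 M2] := law_measure (K s) (mpair s); exists M.
pose kap k u : {measure set (S * E) -> \bar R} := \d_(x k u, A k u).
pose lam k u := L (x k u).
have kapE (h : nat -> S * E -> R) : (forall k, measurable_fun setT (h k)) ->
    forall k u, factor live kap h k u =
      if live k u then h k (x k u, A k u) else 1%R.
  move=> mh k u; rewrite /factor; case: ifP => // _.
  rewrite integral_dirac ?diracT ?mul1e//; exact/measurable_EFinP.
have lamE (h : nat -> S * E -> R) : (forall k, measurable_fun setT (h k)) ->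
    (forall k z, (0 <= h k z)%R) ->
    forall k u, factor live lam h k u =
      if live k u then fine (\int[K (x k u)]_a (h k (x k u, a))%:E) else 1%R.
  move=> mh h0 k u; rewrite /factor; case: ifP => // _.
  rewrite (HL (x k u)).2//; first exact/measurable_EFinP.
  by move=> z; rewrite lee_fin.
transitivity (\int[P]_u (\prod_(k < n) factor live kap (fun=> f) k u)%:E).
  by apply: eq_integral => u _; congr EFin; apply: eq_bigr => k _; rewrite kapE.
transitivity (\int[P]_u (\prod_(k < n) factor live lam (fun=> f) k u)%:E); last first.
  apply: eq_integral => u _; congr EFin; apply: eq_bigr => k _; rewrite lamE//.
  by move=> _ z; have /andP[] := f01 z.
apply: (@integral_prod_factor_replace _ U R P _ _ live _ kap lam
  [set C `*` B | C in measurable & B in measurable]) => //.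
- move=> k C mC; apply/measurable_EFinP => /=.
  by apply: measurableT_comp (mxA k); exact: measurable_indic.
- by move=> k u; rewrite [leLHS](_ : _ = 1)//; exact: diracT.
- move=> k C mC.
  rewrite (_ : (fun u => _) = (fun s => K s (xsection C s)) \o x k).
    apply: measurableT_comp (mx k).
    by apply: measurable_fun_xsection_finite_kernel; rewrite inE.
  apply/funext => u; rewrite /lam (HL _).1//=; congr (K _ _).
  by apply/seteqP; split=> a; rewrite /xsection/= inE.
- move=> k u; rewrite /lam (HL _).1//= (_ : [set _ | _] = setT)//.
  by rewrite prob_kernel.
- exact: measurable_prod_measurableType.
- move=> _ _ [C1 mC1 [B1 mB1 <-]] [C2 mC2 [B2 mB2 <-]].
  exists (C1 `&` C2); first exact: measurableI.
  by exists (B1 `&` B2); [exact: measurableI|rewrite setXI].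
- by exists setT => //; exists setT => //; rewrite setXTT.
- by exists set0 => //; exists set0 => //; rewrite setX0.
move=> CB GCB.
have /choice[C HC] k : exists C, measurable C /\
    exists2 B, measurable B & C `*` B = CB k by have [C ? ?] := GCB k; exists C.
have /choice[B HB] k : exists B, measurable B /\ C k `*` B = CB k.
  by have [_ [B ? ?]] := HC k; exists B.
have mC k : measurable (C k) by have [] := HC k.
have mB k : measurable (B k) by have [] := HB k.
have -> : CB = fun k => C k `*` B k by apply/funext => k; have [_ <-] := HB k.
have mCB k : measurable (C k `*` B k) by exact: measurableX.
pose D := [set u | forall k, (k < n)%N -> live k u -> C k (x k u)].
pose M := [set u | forall k, (k < n)%N -> live k u -> B k (A k u)].
have mD : measurable D.
  have : atom_sigma live x D by exact: atom_sigma_bigcap.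
  apply: smallest_sub; first exact: sigma_algebra_measurable.
  move=> _ [k [F mF ->]]; apply: measurableI; first exact: mlive.
  by rewrite -[X in measurable X]setTI; exact: mx.
have mM : measurable M.
  have -> : M = \bigcap_k (~` [set u | (k < n)%N && live k u] `|` A k @^-1` B k).
    apply/seteqP; split=> u h k /= kn.
      have [/andP[l kn']|l] := boolP ((k < n)%N && live k u); last by left.
      by right; exact: h.
    by move=> l; case: (h k I) => //=; rewrite kn l.
  apply: bigcapT_measurable => k; apply: measurableU.
    apply: measurableC; case: (k < n)%N => //=.
    rewrite (_ : [set _ | false] = set0); first exact: measurable0.
    by apply/seteqP; split.
  by rewrite -[X in measurable X]setTI; exact: mA.
have mind k : measurable_fun setT (\1_(C k `*` B k) : _ -> R).
  exact: measurable_indic.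
under eq_integral do under eq_bigr do rewrite kapE//.
under [RHS]eq_integral do under eq_bigr do rewrite lamE//.
transitivity (P (D `&` M)).
  transitivity (\int[P]_u (\1_(D `&` M) u)%:E); last first.
    by rewrite integral_indic ?setIT//; exact: measurableI.
  apply: eq_integral => u _; congr EFin.
  transitivity (\prod_(k < n)
    (\1_[set u | live k u -> (C k `*` B k) (x k u, A k u)] u : R))%R.
    apply: eq_bigr => k _; rewrite !indicE.
    case: ifPn => l; last by rewrite mem_set//= => l'; rewrite l' in l.
    rewrite (_ : (_ \in C k `*` B k) = (u \in [set v | live k v ->
      (C k `*` B k) (x k v, A k v)]))//.
    by apply/idP/idP; rewrite !inE/= => h; [move=> _|exact: h].
  rewrite prod_indic !indicE (_ : (u \in D `&` M) = (u \in
    [set v | forall k : 'I_n, [set w | live k w ->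
      (C k `*` B k) (x k w, A k w)] v]))//.
  apply/idP/idP; rewrite !inE => h.
    by move=> k l; split; [exact: h.1|exact: h.2].
  by split=> k kn l; have [] := h (Ordinal kn) l.
have -> : P (D `&` M) =
    \int[P]_(u in D) \prod_(0 <= k < n | live k u) K (x k u) (B k).
  exact: (mark n (atom_sigma_bigcap n mC) mB).
rewrite [in LHS]integral_mkcond.
apply: eq_integral => u _; rewrite /patch.
have KE k : \int[K (x k u)]_a (\1_(C k `*` B k) (x k u, a))%:E =
    (\1_(C k) (x k u))%:E * K (x k u) (B k).
  transitivity (\int[K (x k u)]_a ((\1_(C k) (x k u))%:E * (\1_(B k) a)%:E)).
    by apply: eq_integral => a _; rewrite -EFinM !indicE in_setX -natrM mulnb.
  rewrite ge0_integralZl ?lee_fin//; last exact/measurable_EFinP/measurable_indic.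
  by rewrite integral_indic ?setIT.
case: ifPn => [|]; rewrite ?notin_setE ?inE => Du; last first.
  (* Off [D] some live point violates its constraint, and its factor makes the product 0. *)
  have [k [kn l Cx]] : exists k, [/\ (k < n)%N, live k u & ~ C k (x k u)].
    apply: contrapT => h; apply: Du => k kn l; apply: contrapT => Cx.
    by apply: h; exists k.
  rewrite (bigD1 (Ordinal kn))//= l KE indicE memNset//= mul0e/= mul0r.
  by [].
rewrite big_mkord [in LHS]big_mkcond -prodEFin; apply: eq_bigr => k _.
case: ifP => // l; rewrite KE indicE mem_set ?mul1e ?fineK//; last exact: Du.
rewrite ge0_fin_numE// (@le_lt_trans _ _ (K (x k u) setT))//.
  by apply: le_measure; rewrite ?inE.
by rewrite prob_kernel ltry.
Qed.

End marking.

Lemma cvg_prod_atom_sum d (U : measurableType d) (R : realType)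
    dS (S : measurableType dS) (live : nat -> U -> bool) (x : nat -> U -> S)
    (g : S -> R) (u : U) : (forall s, (0 <= g s)%R) ->
  (fun n => \prod_(k < n) if live k u then expR (- g (x k u)) else 1)%R @ \oo -->
  eexpN (atom_sum live x g u).
Proof.
move=> g0.
rewrite (_ : (fun n => _) = eexpN \o (fun n => \sum_(0 <= k < n | live k u) (g (x k u))%:E)).
  apply: cvg_eexpN => [n|]; first by apply: sume_ge0 => k _; rewrite lee_fin.
  by apply: is_cvg_nneseries => k _ _; rewrite lee_fin.
apply/funext => n /=; rewrite eexpN_sum; last by move=> k _; rewrite lee_fin.
rewrite big_mkord [RHS]big_mkcond; apply: eq_bigr => k _.
by case: ifP => // _; rewrite eexpN_EFin.
Qed.

(** Both functionals are limits of expectations of finite products. There the marks are integrated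
    out, which leaves the functional of the unmarked process at [marked_exponent K g]. *)
Lemma laplace_marked d (U : measurableType d) (R : realType) (P : probability U R)
    dS (S : measurableType dS) dE (E : measurableType dE)
    (live : nat -> U -> bool) (x : nat -> U -> S) (A : nat -> U -> E)
    (K : R.-pker S ~> E) (nu : {measure set S -> \bar R}) (g : S * E -> R) :
  (forall k, measurable [set u | live k u]) ->
  (forall k, measurable_fun [set: U] (x k)) ->
  (forall k, measurable_fun [set: U] (A k)) ->
  (forall (D : set U) (n : nat) (B : nat -> set E),
    atom_sigma live x D -> (forall k, measurable (B k)) ->
    P (D `&` [set u | forall k, (k < n)%N -> live k u -> B k (A k u)]) =
    \int[P]_(u in D) \prod_(0 <= k < n | live k u) K (x k u) (B k)) ->
  poisson_random_measure P nu (atomic_measure R live x) ->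
  measurable_fun [set: S * E] g -> (forall z, (0 <= g z)%R) ->
  \int[P]_u (eexpN (atom_sum live (fun k u => (x k u, A k u)) g u))%:E =
  (eexpN (\int[nu]_s (1 - fine (\int[K s]_a (expR (- g (s, a)))%:E))%:E))%:E.
Proof.
move=> mlive mx mA mark prm mg g0.
pose h := marked_exponent K g.
have mh : measurable_fun [set: S] h.
  exact: measurable_marked_exponent.
have h0 s : (0 <= h s)%R by exact: marked_exponent_ge0.
under [X in _ = (eexpN X)%:E]eq_integral do rewrite -(expR_marked_exponent K _ mg g0).
rewrite -(laplace_prm mlive mx prm mh h0).
have cvg_int dT (T : measurableType dT) (y : nat -> U -> T) (q : T -> R) :
    (forall k, measurable_fun [set: U] (y k)) -> measurable_fun [set: T] q ->
    (forall t, (0 <= q t)%R) ->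
    (fun n => \int[P]_u (\prod_(k < n)
       if live k u then expR (- q (y k u)) else 1)%R%:E) @ \oo -->
    \int[P]_u (eexpN (atom_sum live y q u))%:E.
  move=> my mq q0; apply: bounded_cvg_integral.
  - move=> n; apply: measurable_prod => k _; apply: measurable_fun_ifT => //.
      by apply: (measurable_fun_bool true); rewrite setTI; exact: mlive.
    apply: measurableT_comp => //; apply: measurableT_comp => //.
    exact: measurableT_comp.
  - by apply: measurableT_comp; [exact: measurable_eexpN|exact: measurable_atom_sum].
  - move=> n u; rewrite prodr_ge0 ?prodr_ile1// => k _; case: ifP => _; rewrite ?ler01 ?lexx//.
    by rewrite expR_ge0/= -[leRHS]expR0 ler_expR oppr_le0.
  - by move=> u; exact: cvg_prod_atom_sum.
have mxA k : measurable_fun [set: U] (fun u => (x k u, A k u)).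
  exact: measurable_fun_pair.
have <- := cvg_lim (@ereal_hausdorff R) (cvg_int _ _ x h mx mh h0).
have <- := cvg_lim (@ereal_hausdorff R) (cvg_int _ _ _ g mxA mg g0).
congr (limn _); apply/funext => n.
rewrite (integral_marks mlive mx mA mark n (f := fun z => expR (- g z))%R).
- apply: eq_integral => u _; congr EFin; apply: eq_bigr => k _.
  by case: ifP => // _; rewrite expR_marked_exponent.
- by apply: measurableT_comp => //; exact: measurableT_comp.
- by move=> z; rewrite expR_ge0/= -[leRHS]expR0 ler_expR oppr_le0.
Qed.

(** * Sequences of independent variables *)

Section sequence_space.
Context d (T : measurableType d).

Definition coord_sets : set (set (nat -> T)) :=
  [set A | exists i B, measurable B /\ A = [set s | B (s i)]].

Definition seq_space := g_sigma_algebraType coord_sets.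

Definition scons (x : T) (s : nat -> T) (n : nat) : T :=
  if n is n'.+1 then s n' else x.

(** Dependence on [n] coordinates is stated by agreement of sequences rather than by a base in a
    finite power, so that taking a section along [scons] simply lowers [n] by one. *)
Definition cylinder (n : nat) (A : set (nat -> T)) : Prop :=
  measurable (A : set seq_space) /\
  forall s s', (forall i, (i < n)%N -> s i = s' i) -> A s -> A s'.

Lemma measurable_coord i : measurable_fun [set: seq_space] (fun s : seq_space => s i).
Proof.
move=> _ B mB; rewrite setTI; apply: sub_sigma_algebra.
by exists i, B.
Qed.

Lemma measurable_scons :
  measurable_fun [set: T * seq_space] (fun z => scons z.1 z.2 : seq_space).
Proof.
apply: (@measurability _ _ _ seq_space _ _ coord_sets) => //.
move=> _ [_ [i [B [mB ->]]] <-]; rewrite setTI.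
case: i => [|i].
  rewrite (_ : _ @^-1` _ = fst @^-1` B)// -[X in measurable X]setTI.
  exact: measurable_fst.
rewrite (_ : _ @^-1` _ = (fun z : T * seq_space => z.2 i) @^-1` B)//.
rewrite -[X in measurable X]setTI.
apply: (@measurableT_comp _ _ _ _ _ _ (fun s : seq_space => s i)) => //.
exact: measurable_coord.
Qed.

Lemma measurable_scons1 x :
  measurable_fun [set: seq_space] (fun s => scons x s : seq_space).
Proof.
apply: (@measurability _ _ seq_space seq_space _ _ coord_sets) => //.
move=> _ [_ [i [B [mB ->]]] <-]; rewrite setTI.
case: i => [|i]; last first.
  by apply: sub_sigma_algebra; exists i, B.
have [Bx|Bx] := pselect (B x).
  by rewrite (_ : _ @^-1` _ = setT); [exact: measurableT|apply/seteqP; split].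
by rewrite (_ : _ @^-1` _ = set0); [exact: measurable0|apply/seteqP; split].
Qed.

Lemma cylinder0P A : cylinder 0 A -> A = set0 \/ A = setT.
Proof.
move=> [_ Adep]; have [[s As]|A0] := pselect (exists s, A s).
  by right; apply/seteqP; split => // s' _; exact: Adep As.
by left; apply/seteqP; split => // s As; apply: A0; exists s.
Qed.

Lemma cylinder_le n m A : (n <= m)%N -> cylinder n A -> cylinder m A.
Proof.
move=> nm [mA dA]; split=> // s s' h; apply: dA => i ni.
by apply: h; exact: leq_trans nm.
Qed.

Lemma cylinder_scons n A x : cylinder n.+1 A -> cylinder n [set s | A (scons x s)].
Proof.
move=> [mA dA]; split.
  by rewrite -[X in measurable X]setTI; exact: measurable_scons1.
move=> s s' h; apply: dA => -[|i]//= ni; exact: h.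
Qed.

Lemma cylinder_setC n A : cylinder n A -> cylinder n (~` A).
Proof.
move=> [mA dA]; split; first exact: measurableC.
by move=> s s' h As /(dA s' s) As'; apply: As; apply: As' => i /h.
Qed.

Lemma cylinder_setU n A B : cylinder n A -> cylinder n B -> cylinder n (A `|` B).
Proof.
move=> [mA dA] [mB dB]; split; first exact: measurableU.
by move=> s s' h [/(dA _ _ h)|/(dB _ _ h)]; [left|right].
Qed.

(** A separate name for the sequences, carrying only the algebra of cylinders on which the
    premeasure lives before its extension. *)
Definition cyl_space := nat -> T.

Definition cylinders : set (set cyl_space) := [set A | exists n, cylinder n A].

Lemma cylinders0 : cylinders set0.
Proof. by exists 0%N; split. Qed.

Lemma cylindersU : setU_closed cylinders.
Proof.
move=> A B [n An] [m Bm]; exists (maxn n m).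
by apply: cylinder_setU; [apply: cylinder_le An|apply: cylinder_le Bm];
  rewrite ?leq_maxl ?leq_maxr.
Qed.

Lemma cylindersC : setC_closed cylinders.
Proof. by move=> A [n An]; exists n; exact: cylinder_setC. Qed.

HB.instance Definition _ := Pointed.on cyl_space.
HB.instance Definition _ := isAlgebraOfSets.Build default_measure_display cyl_space
  cylinders0 cylindersU cylindersC.

End sequence_space.

Lemma probability_of_measure d (T : measurableType d) (R : realType)
    (M : {measure set T -> \bar R}) : M setT = 1 ->
  exists P : probability T R, forall A, P A = M A.
Proof.
move=> M1.
(* The Dirac mass is the default value of the normalisation for total mass 0 or infinity, both
   excluded by [M1]. *)
exists (mnormalize M (\d_point : probability T R)) => A.
rewrite /= /mnormalize M1; case: ifPn => [/orP[]|_]; first by rewrite onee_eq0.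
  by [].
by rewrite /= invr1 mule1.
Qed.

Section iid_sequence.
Context d (T : measurableType d) (R : realType) (Q : probability T R).
Local Notation X := (seq_space T).

Lemma measurable_prob_section (m : probability X R) (C : set X) : measurable C ->
  measurable_fun [set: T] (fun x => m [set s | C (scons x s)]).
Proof.
move=> mC; pose C' := [set z : T * X | C (scons z.1 z.2)].
have mC' : measurable C'.
  by rewrite -[X in measurable X]setTI; exact: measurable_scons.
rewrite (_ : (fun x => _) = m \o xsection C'); first exact: measurable_fun_xsection.
apply/funext => x /=; congr (m _).
by apply/seteqP; split=> s; rewrite /xsection/= inE.
Qed.

(** The law [m'] arises by placing an independent coordinate of law [Q] in front of a sequence of
    law [m]. *)
Lemma extend_prob (m : probability X R) : exists m' : probability X R,
  forall A, measurable A -> m' A = \int[Q]_x m [set s | A (scons x s)].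
Proof.
have /choice[L HL] x : exists M : {measure set X -> \bar R},
    forall C, measurable C -> M C = m [set s | C (scons x s)].
  by have [M M1 _] := law_measure m (@measurable_scons1 _ T x); exists M.
have mL C : measurable C -> measurable_fun [set: T] (fun x => L x C).
  move=> mC; under eq_fun do rewrite HL//; exact: measurable_prob_section.
have [M ME _] := @mixture_measure _ _ T X R Q setT (fun=> 1%R) L measurableT
  (measurable_cst _) (fun=> ler01) mL.
have M1 : M setT = 1.
  rewrite ME; under eq_integral do rewrite mul1e HL// (_ : [set _ | _] = setT)// probability_setT.
  by rewrite integral_cst// mul1e; exact: probability_setT.
have [M' M'E] := probability_of_measure M1.
exists M' => A mA; rewrite M'E ME; apply: eq_integral => x _.
by rewrite mul1e HL.
Qed.

Let ext (m : probability X R) : probability X R := projT1 (cid (extend_prob m)).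

Let extE m A : measurable A -> ext m A = \int[Q]_x m [set s | A (scons x s)].
Proof. by rewrite /ext; case: cid => /= m' + mA; exact. Qed.

(** Under [m n] the first [n] coordinates are iid of law [Q] and the rest follow a fixed default
    sequence. *)
Let m (n : nat) : probability X R := iter n ext (\d_(point : X) : probability X R).

Let m_stable n k A : cylinder n A -> m (n + k) A = m n A.
Proof.
elim: n A => [|n IH] A cA.
  by have [->|->] := cylinder0P cA; rewrite ?measure0 ?probability_setT.
rewrite addSn !extE; try exact: cA.1.
by apply: eq_integral => x _; exact/IH/cylinder_scons.
Qed.

(* The absolute value only matters off the cylinders, where the limit may not exist. *)
Let P0 (A : set (cyl_space T)) : \bar R := `|limn (fun n => m n A)|.

Let P0E n A : cylinder n A -> P0 A = m n A.
Proof.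
move=> cA; rewrite /P0 (_ : limn _ = m n A) ?gee0_abs//.
apply/cvg_lim => //; apply: cvg_near_cst.
by near=> k; rewrite -(subnKC (_ : n <= k)%N) ?m_stable//; near: k; exists n.
Unshelve. all: by end_near. Qed.

Let P0_scons n A : cylinder n A ->
  P0 A = \int[Q]_x P0 [set s | A (scons x s)].
Proof.
move=> cA; have cA' := cylinder_le (leqnSn n) cA.
rewrite (P0E cA') extE; last exact: cA.1.
by apply: eq_integral => x _; rewrite (P0E (cylinder_scons x cA')).
Qed.

Let P0_ge0 A : 0 <= P0 A. Proof. exact: abse_ge0. Qed.

Let P0_le1 A : cylinders A -> P0 A <= 1.
Proof. by move=> [n cA]; rewrite (P0E cA) probability_le1//; exact: cA.1. Qed.

Let P0_fin A : cylinders A -> P0 A \is a fin_num.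
Proof. by move=> cA; rewrite ge0_fin_numE// (le_lt_trans (P0_le1 cA))// ltry. Qed.

Let P0U A B : cylinders A -> cylinders B -> [disjoint A & B] ->
  P0 (A `|` B) = P0 A + P0 B.
Proof.
move=> [n cA] [k cB] AB.
have cA' := cylinder_le (leq_maxl n k) cA; have cB' := cylinder_le (leq_maxr n k) cB.
rewrite (P0E cA') (P0E cB') (P0E (cylinder_setU cA' cB')) measureU//.
- exact: cA.1.
- exact: cB.1.
- exact/disj_set2P.
Qed.

Let P0_le A B : cylinders A -> cylinders B -> A `<=` B -> P0 A <= P0 B.
Proof.
move=> [n cA] [k cB] AB.
have cA' := cylinder_le (leq_maxl n k) cA; have cB' := cylinder_le (leq_maxr n k) cB.
rewrite (P0E cA') (P0E cB') le_measure// inE; [exact: cA.1|exact: cB.1].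
Qed.

Let section_cylinders (A : set (nat -> T)) x : cylinders A -> cylinders [set s | A (scons x s)].
Proof. by move=> [n cA]; exists n; apply/cylinder_scons/(cylinder_le _ cA). Qed.

Let cvg0_of_small (p : nat -> R) : (forall n, 0 <= p n)%R ->
  (forall n, p n.+1 <= p n)%R -> (forall e, 0 < e -> exists n, p n < e)%R ->
  p @ \oo --> (0%R : R).
Proof.
move=> p0 pd ps; apply/cvgrPdist_lt => e e0; have [n pn] := ps e e0.
exists n => // k /= nk; rewrite sub0r normrN ger0_norm//.
have /nonincreasing_seqP nd := pd; exact: le_lt_trans (nd _ _ nk) pn.
Qed.

Let good (B : nat -> set (nat -> T)) := [/\ forall n, cylinders (B n),
  forall n, B n.+1 `<=` B n & exists2 e : R, (0 < e)%R & forall n, e%:E <= P0 (B n)].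

(** If no first coordinate [x] were good, the masses of the sections would decrease to 0 for every
    [x], and bounded convergence would force the masses of the [B n] to 0. *)
Let good_section B : good B -> exists x, good (fun n => [set s | B n (scons x s)]).
Proof.
move=> [cB dB [e e0 eB]]; apply: contrapT => noex.
pose f n x := fine (P0 [set s | B n (scons x s)]).
have cBx n x := section_cylinders x (cB n).
have fE n x : (f n x)%:E = P0 [set s | B n (scons x s)] by rewrite /f fineK// P0_fin.
have f01 n x : (0 <= f n x <= 1)%R by rewrite -!lee_fin fE P0_ge0 P0_le1.
have mf n : measurable_fun [set: T] (f n).
  have [k ck] := cB n; have ck' := cylinder_le (leqnSn k) ck.
  rewrite (_ : f n = fine \o (fun x => m k [set s | B n (scons x s)])).
    apply: measurableT_comp; first exact: fine_measurable.
    exact: measurable_prob_section ck.1.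
  by apply/funext => x; rewrite /f (P0E (cylinder_scons x ck')).
have cf x : f ^~ x @ \oo --> (0%R : R).
  apply: cvg0_of_small.
  - by move=> n; have /andP[] := f01 n x.
  - move=> n; rewrite -lee_fin !fE; apply: P0_le => // s; exact: dB.
  - move=> r r0; apply: contrapT => nr; apply: noex; exists x; split.
    + by move=> n; exact: cBx.
    + by move=> n s; exact: dB.
    + exists r => // n; rewrite -fE lee_fin leNgt; apply/negP => fr.
      by apply: nr; exists n.
have cI : (fun n => \int[Q]_x (f n x)%:E) @ \oo --> 0.
  rewrite -[X in _ --> X](integral0 Q setT).
  exact: (bounded_cvg_integral (P := Q) mf (measurable_cst (0%R : R)) f01 cf).
have : e%:E <= limn (fun n => \int[Q]_x (f n x)%:E).
  apply: lime_ge; first by apply/cvg_ex; exists 0; exact: cI.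
  apply: nearW => n; have [k ck] := cB n.
  by under eq_integral do rewrite fE; rewrite -(P0_scons ck).
by rewrite (cvg_lim _ cI)// lee_fin leNgt e0.
Qed.

Let pick (B : nat -> set (nat -> T)) : T :=
  get [set x | good (fun n => [set s | B n (scons x s)])].

Let step B := fun n => [set s | B n (scons (pick B) s)].

Let chain B (i : nat) : T := pick (iter i step B).

Let good_step B : good B -> good (step B).
Proof. by move=> /good_section; exact: getPex. Qed.

(** After [k] choices the section of [B n] no longer depends on the sequence, so it is empty or
    everything; its mass is bounded below, which excludes the empty set. *)
Let chain_mem k n B : good B -> cylinder k (B n) -> B n (chain B).
Proof.
elim: k B => [|k IH] B gB cB.
  have [B0|->//] := cylinder0P cB.
  have [_ _ [e e0 /(_ n)]] := gB; rewrite B0 (P0E (n := 0%N)) ?measure0; last by split.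
  by rewrite lee_fin leNgt e0.
have := IH _ (good_step gB) (cylinder_scons (pick B) cB).
rewrite /step/= (_ : scons _ _ = chain B)//.
by apply/funext => -[|i] //=; rewrite /chain iterSr.
Qed.

(** It is enough that the tails [B n] of the disjoint union have masses tending to 0. Otherwise
    [chain B] lies in all of them: it belongs to some [F k] through [B 0], and to some later [F j]
    through [B k.+1], against disjointness. *)
Let P0_sigma_additive : semi_sigma_additive (P0 : set (cyl_space T) -> \bar R).
Proof.
move=> F mF tF mUF.
pose B n := [set s | exists2 k, (n <= k)%N & F k s].
have B0 : B 0%N = \bigcup_k F k.
  by apply/seteqP; split => s; [move=> [k _ Fk]|move=> [k _ Fk]]; exists k.
have BS n : B n.+1 = B n `\` F n.
  apply/seteqP; split => s.
    move=> [k nk Fk]; split; first by exists k => //; exact: ltnW.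
    move=> Fn; have := tF k n Logic.I Logic.I; move/(_ (ex_intro _ s (conj Fk Fn))).
    by move=> kn; rewrite kn ltnn in nk.
  move=> [[k nk Fk] nF]; exists k => //; rewrite ltn_neqAle nk andbT.
  by apply/eqP => nk'; apply: nF; rewrite nk'.
have cB n : cylinders (B n).
  elim: n => [|n IH]; first by rewrite B0.
  by rewrite BS; exact: (@measurableD _ (cyl_space T)).
have FB n : F n `<=` B n by move=> s Fn; exists n.
have PB n : P0 (B n) = P0 (F n) + P0 (B n.+1).
  rewrite -(P0U (mF n) (cB n.+1)); first by rewrite BS setDUK.
  by rewrite BS; apply/disj_set2P/seteqP; split => // s [Fs [_ /(_ Fs)]].
have sumE n : P0 (\bigcup_k F k) = \sum_(0 <= i < n) P0 (F i) + P0 (B n).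
  elim: n => [|n IH]; first by rewrite big_nil add0e B0.
  by rewrite IH big_nat_recr//= PB addeA.
have finB n := P0_fin (cB n).
have PB0 : (fun n => P0 (B n)) @ \oo --> 0.
  rewrite (_ : (fun n => _) = EFin \o (fun n => fine (P0 (B n)))).
    apply: cvg_EFin; first exact: nearW.
    apply: cvg0_of_small.
    - by move=> n /=; exact: fine_ge0.
    - move=> n /=; rewrite fine_le//; apply: P0_le => // s [k nk Fk].
      by exists k => //; exact: ltnW.
    - move=> e e0; apply: contrapT => ne.
      have gB : good B.
        split => //.
          by move=> n s [k nk Fk]; exists k => //; exact: ltnW.
        exists e => // n; rewrite -(fineK (finB n)) lee_fin leNgt.
        by apply/negP => h; apply: ne; exists n.
      have inB n : B n (chain B) by have [k ck] := cB n; exact: chain_mem ck.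
      have [k _ Fk] := inB 0%N; have [j kj Fj] := inB k.+1.
      have := tF k j Logic.I Logic.I (ex_intro _ _ (conj Fk Fj)).
      by move=> kj'; rewrite kj' ltnn in kj.
  by apply/funext => n /=; rewrite fineK.
rewrite (_ : (fun n => _) = (fun n => P0 (\bigcup_k F k) - P0 (B n))).
  rewrite -[X in _ --> X]sube0; apply: cvgeB; [|exact: cvg_cst|exact: PB0].
  by rewrite oppe0 fin_num_adde_defl.
by apply/funext => n; rewrite (sumE n) addeK.
Qed.

(** Caratheodory extension of the premeasure [P0] from the cylinders; no topology on [T] enters. The
    conclusion is limited to initial segments, where [P0] is [m n] and the product formula follows
    by removing the first coordinate. *)
Lemma iid_sequence_exists : exists (dS : measure_display) (Sq : measurableType dS)
    (P : probability Sq R) (c : nat -> Sq -> T),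
  (forall i, measurable_fun [set: Sq] (c i)) /\
  forall n (B : nat -> set T), (forall i, measurable (B i)) ->
    P [set s | forall i, (i < n)%N -> B i (c i s)] = \prod_(i < n) Q (B i).
Proof.
have P00 : P0 set0 = 0 by rewrite (P0E (n := 0%N)) ?measure0//; split.
pose P0a := isMeasure.Build _ (cyl_space T) R P0 P00 P0_ge0 P0_sigma_additive.
pose P0m : {measure set (cyl_space T) -> \bar R} := HB.pack P0 P0a.
pose I := g_sigma_algebraType (@measurable _ (cyl_space T)).
pose PI : {measure set I -> \bar R} := measure_extension P0m.
have PIE A : cylinders A -> PI A = P0 A by move=> cA; exact: measurable_mu_extE.
have cT : cylinder 0 (setT : set (nat -> T)) by split.
have PI1 : PI setT = 1.
  by rewrite PIE; [rewrite (P0E cT) probability_setT|exists 0%N].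
have [P PE] := probability_of_measure PI1.
exists _, I, P, (fun i s => s i); split.
  move=> i _ B mB; rewrite setTI; apply: sub_sigma_algebra.
  exists i.+1; split; first by apply: sub_sigma_algebra; exists i, B.
  by move=> s s' h; rewrite /= h.
move=> n B mB.
have cA k (C : nat -> set T) : (forall i, measurable (C i)) ->
    cylinder k [set s : nat -> T | forall i, (i < k)%N -> C i (s i)].
  move=> mC; split.
    rewrite (_ : [set s | _] = \bigcap_(i in [set i | (i < k)%N]) [set s | C i (s i)]).
      apply: bigcap_measurableType => i _.
      by apply: sub_sigma_algebra; exists i, (C i).
    by apply/seteqP; split.
  by move=> s s' h Cs i ik; rewrite -h//; exact: Cs.
rewrite PE PIE; last by exists n; exact: cA.
rewrite (P0E (cA n B mB)).
elim: n B mB => [|n IH] B mB.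
  by rewrite big_ord0 (_ : [set s | _] = setT) ?probability_setT//; apply/seteqP; split.
rewrite extE; last exact: (cA _ _ mB).1.
rewrite big_ord_recl/= -(IH (fun i => B i.+1))//.
transitivity (\int[Q]_x ((\1_(B 0%N) x)%:E *
    m n [set s : nat -> T | forall i, (i < n)%N -> B i.+1 (s i)])).
  apply: eq_integral => x _; rewrite indicE.
  have [Bx|Bx] := pselect (B 0%N x).
    rewrite mem_set// mul1e; congr (m n _); apply/seteqP; split=> s h.
      by move=> i ni; exact: (h i.+1).
    by move=> [|i]//= ni; exact: h.
  rewrite memNset// mul0e (_ : [set s | _] = set0) ?measure0//.
  by apply/seteqP; split => // s /(_ 0%N isT).
rewrite ge0_integralZr//; last exact/measurable_EFinP/measurable_indic.
by rewrite integral_indic ?setIT.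
Qed.

End iid_sequence.

(** * Disintegration along a real coordinate *)

Section disintegration_real.
Context d (T : measurableType d) (R : realType).
Variable J : probability (T * R)%type R.

Definition ray_slice (r : R) (A : set T) : \bar R := J (A `*` `]-oo, r[%classic).

Let ray_slice0 r : ray_slice r set0 = 0.
Proof. by rewrite /ray_slice set0X measure0. Qed.

Let ray_slice_ge0 r A : 0 <= ray_slice r A.
Proof. exact: measure_ge0. Qed.

Let mray (A : set T) r : measurable A -> measurable (A `*` (`]-oo, r[%classic : set R)).
Proof. by move=> mA; apply: measurableX => //; exact: measurable_itv. Qed.

Let ray_slice_additive r : semi_sigma_additive (ray_slice r).
Proof.
move=> F mF tF mUF; rewrite /ray_slice.
rewrite (_ : (\bigcup_n F n) `*` _ = \bigcup_n (F n `*` `]-oo, r[%classic)).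
  apply: measure_semi_sigma_additive.
  - by move=> i; exact: mray.
  - move=> i j _ _ [[a s] [[/= Fi _] [Fj _]]]; apply: (tF i j) => //.
    by exists a.
  - by apply: bigcupT_measurable => i; exact: mray.
apply/seteqP; split=> [[a s] [[n _ Fn] /= sr]|[a s] [n _ [/= Fn sr]]].
  by exists n.
by split => //; exists n.
Qed.

HB.instance Definition _ r := isMeasure.Build _ _ _ (ray_slice r)
  (ray_slice0 r) (ray_slice_ge0 r) (@ray_slice_additive r).

Let ray_slice_fin r : fin_num_fun (ray_slice r).
Proof. by move=> A mA; apply: fin_num_measure; exact: mray. Qed.

HB.instance Definition _ r := Measure_isFinite.Build _ _ _ (ray_slice r)
  (@ray_slice_fin r).

Variable nu : probability T R.
Hypothesis nuE : forall A, measurable A -> nu A = J (A `*` setT).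

(** A version of the conditional probability that the real coordinate is below [r]. For distinct [r]
    the versions are unrelated: monotonicity and the bound 1 hold only almost everywhere. *)
Definition cond_cdf (r : R) (a : T) : R :=
  fine (Radon_Nikodym_SigmaFinite.f (ray_slice r) nu a).

Let slice_le r A : measurable A -> ray_slice r A <= nu A.
Proof.
move=> mA; rewrite nuE//; apply: le_measure; rewrite ?inE//; first exact: mray.
  by apply: measurableX.
by move=> [a s] [].
Qed.

Let dominated r : ray_slice r `<< nu.
Proof.
apply/null_content_dominatesP => A mA A0; apply/eqP.
by rewrite eq_le measure_ge0 andbT -A0 slice_le.
Qed.

Let cond_cdfE r a : (cond_cdf r a)%:E = Radon_Nikodym_SigmaFinite.f (ray_slice r) nu a.
Proof. by rewrite /cond_cdf fineK//; exact: (Radon_Nikodym_SigmaFinite.f_fin_num (dominated r)). Qed.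

Let cond_cdf_ge0 r a : (0 <= cond_cdf r a)%R.
Proof. by rewrite -lee_fin cond_cdfE; exact: (Radon_Nikodym_SigmaFinite.f_ge0 (dominated r)). Qed.

Let integrable_cond_cdf r : nu.-integrable setT (EFin \o cond_cdf r).
Proof.
rewrite (_ : EFin \o _ = Radon_Nikodym_SigmaFinite.f (ray_slice r) nu).
  exact: (Radon_Nikodym_SigmaFinite.f_integrable (dominated r)).
by apply/funext => a /=; rewrite cond_cdfE.
Qed.

Let measurable_cond_cdf r : measurable_fun [set: T] (cond_cdf r).
Proof. by apply/measurable_EFinP; exact: measurable_int (integrable_cond_cdf r). Qed.

Let integral_cond_cdf r A : measurable A ->
  \int[nu]_(a in A) (cond_cdf r a)%:E = ray_slice r A.
Proof.
move=> mA; rewrite (Radon_Nikodym_SigmaFinite.f_integral (dominated r) mA).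
by apply: eq_integral => a _; rewrite cond_cdfE.
Qed.

(** On the set where [g < f] the assumed inequality and the trivial one make all integrals agree, so
    [f = g] almost everywhere there. *)
Let ae_le_of_integral (f g : T -> R) :
  nu.-integrable setT (EFin \o f) -> nu.-integrable setT (EFin \o g) ->
  (forall A, measurable A ->
    \int[nu]_(a in A) (f a)%:E <= \int[nu]_(a in A) (g a)%:E) ->
  \forall a \ae nu, (f a <= g a)%R.
Proof.
move=> If Ig fg; pose D := [set a | (g a < f a)%R].
have mf : measurable_fun setT f by apply/measurable_EFinP; exact: measurable_int If.
have mg : measurable_fun setT g by apply/measurable_EFinP; exact: measurable_int Ig.
have mD : measurable D by rewrite -[D]setTI; exact: measurable_fun_ltr.
have IfD : nu.-integrable D (EFin \o f) by apply: integrableS If.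
have IgD : nu.-integrable D (EFin \o g) by apply: integrableS Ig.
have : ae_eq nu D (EFin \o f) (EFin \o g).
  apply: integral_ae_eq => //; first exact: measurable_int IgD.
  move=> A AD mA; apply/eqP; rewrite eq_le fg//=.
  apply: le_integral => //.
  - by apply: integrableS Ig.
  - by apply: integrableS If.
  - by move=> a; rewrite inE => /AD /ltW; rewrite lee_fin.
apply: filterS => a /= h; rewrite leNgt; apply/negP => gf.
by have := h gf; move=> -[fga]; rewrite fga ltxx in gf.
Qed.

Let cond_cdf_le r r' : (r <= r')%R -> \forall a \ae nu, (cond_cdf r a <= cond_cdf r' a)%R.
Proof.
move=> rr'; apply: ae_le_of_integral; try exact: integrable_cond_cdf.
move=> A mA; rewrite !integral_cond_cdf//; apply: le_measure.
- by rewrite inE; exact: mray.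
- by rewrite inE; exact: mray.
- move=> [a s] [/= Aa]; rewrite !in_itv/= => sr; split => //=.
  exact: lt_le_trans rr'.
Qed.

Let cond_cdf_le1 r : \forall a \ae nu, (cond_cdf r a <= 1)%R.
Proof.
apply: (ae_le_of_integral (g := fun=> 1%R)); first exact: integrable_cond_cdf.
  exact: finite_measure_integrable_cst.
by move=> A mA; rewrite integral_cond_cdf// integral_cst// mul1e slice_le.
Qed.

(** An enumeration of the rationals; numbers that encode no rational give 0. *)
Let q (n : nat) : R := ratr (odflt 0%Q (choice.unpickle n)).

Let q_dense x y : (x < y)%R -> exists n, (x < q n < y)%R.
Proof.
move=> /rat_in_itvoo[z]; rewrite in_itv/= => xzy.
by exists (choice.pickle z); rewrite /q choice.pickleK.
Qed.

Let munit : measurable (`[0%R, 1%R]%classic : set R).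
Proof. exact: measurable_itv. Qed.

Let unif : exists P : probability R R,
  forall c, (0 <= c <= 1)%R -> P [set v | (v < c)%R] = c%:E.
Proof.
pose I01 : set R := `[0%R, 1%R]%classic.
have mk C : measurable C -> measurable_fun I01 (fun x : R => (\d_x C : \bar R)).
  by move=> mC; apply/measurable_EFinP/measurable_funTS/measurable_indic.
have [L LE _] := lebesgue_measure_real R.
have [M ME _] := @mixture_measure _ _ R R R L I01 (fun=> 1%R)
  (fun x : R => \d_(x : R) : {measure set R -> \bar R}) munit (measurable_cst _) (fun=> ler01) mk.
have {}ME C : measurable C -> M C = lebesgue_measure (C `&` `[0%R, 1%R]%classic).
  move=> mC; rewrite ME; under eq_integral do rewrite mul1e.
  by rewrite -LE; [rewrite -integral_indic|exact: measurableI].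
have M1 : M setT = 1.
  by rewrite ME// setTI lebesgue_measure_itv/= lte_fin ltr01 oppr0 adde0.
have [P PE] := probability_of_measure M1; exists P => c /andP[c0 c1].
rewrite PE ME; last by rewrite -[X in measurable X]setTI; exact: measurable_fun_ltr.
rewrite (_ : _ `&` _ = [set` `[0%R, c[]).
  rewrite lebesgue_measure_itv/= lte_fin.
  move: c0; rewrite le_eqVlt => /predU1P[<-|->]; first by rewrite ltxx.
  by rewrite oppr0 adde0.
apply/seteqP; split=> v /=; rewrite !in_itv/=.
  by move=> [vc /andP[-> _]].
by move=> /andP[-> vc]; split => //=; rewrite (le_trans (ltW vc) c1).
Qed.

(* The conditional quantile: [quantile (a, v) < r] iff [v < cond_cdf (q n) a] for
   some rational [q n < r]. *)
Let quantile (z : T * R) : \bar R :=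
  ereal_inf [set (q n)%:E | n in [set n | (z.2 < cond_cdf (q n) z.1)%R]].

Let quantile_lt z r : (quantile z < r%:E) =
  `[< exists n, (q n < r)%R /\ (z.2 < cond_cdf (q n) z.1)%R >].
Proof.
apply/idP/asboolP.
  by move/ereal_inf_lt => [_ [n zn <-]]; rewrite lte_fin => qr; exists n.
move=> [n [qr zn]]; apply: (@le_lt_trans _ _ (q n)%:E); last by rewrite lte_fin.
by apply: ereal_inf_lbound; exists n.
Qed.

Let measurable_quantile : measurable_fun [set: T * R] quantile.
Proof.
apply: (@measurability _ _ _ _ _ _ (@ErealGenInftyO.G R)).
  exact: ErealGenInftyO.measurableE.
move=> _ [_ [r ->] <-]; rewrite setTI.
rewrite (_ : _ @^-1` _ = \bigcup_n [set z | (q n < r)%R /\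
    (z.2 < cond_cdf (q n) z.1)%R]).
  apply: bigcupT_measurable => n.
  have [qr|qr] := pselect (q n < r)%R.
    rewrite (_ : [set z | _] = [set z | (z.2 < cond_cdf (q n) z.1)%R]); last first.
      by apply/seteqP; split=> z //= [].
    rewrite -[X in measurable X]setTI; apply: measurable_fun_ltr => //.
    exact: measurableT_comp.
  by rewrite (_ : [set z | _] = set0)//; apply/seteqP; split=> z // [].
apply/seteqP; split=> z /=.
  by rewrite in_itv/= quantile_lt => /asboolP[n h]; exists n.
by move=> [n _ h]; rewrite in_itv/= quantile_lt; apply/asboolP; exists n.
Qed.

(** [Q a] is the law of the conditional quantile at a uniform variable. It is a probability for
    every [a], although the [cond_cdf] behave like distribution functions only almost everywhere. *)
Lemma disintegration_real : exists Q : R.-pker T ~> R,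
  forall A B, measurable A -> measurable B -> J (A `*` B) = \int[nu]_(a in A) Q a B.
Proof.
have [P PE] := unif.
have mset (C : set (T * R)) : measurable C ->
    measurable_fun [set: T] (fun a => P [set v | C (a, v)]).
  move=> mC; rewrite (_ : (fun a => _) = P \o xsection C).
    exact: measurable_fun_xsection.
  apply/funext => a /=; congr (P _).
  by apply/seteqP; split=> v; rewrite /xsection/= inE.
have mcut (C : set (T * R)) a : measurable C -> measurable [set v | C (a, v)].
  move=> mC; rewrite (_ : [set v | _] = xsection C a); first exact: measurable_xsection.
  by apply/seteqP; split=> v; rewrite /xsection/= inE.
pose below r := [set z : T * R | quantile z < r%:E].
have mbelow r : measurable (below r).
  rewrite (_ : below r = setT `&` quantile @^-1` `]-oo, r%:E[%classic).
    by apply: measurable_quantile => //; exact: emeasurable_itv.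
  by apply/seteqP; split=> z /=; rewrite in_itv/=; [split|case].
(* The section of [below r] contains [v < cond_cdf (q n) a] for each rational [q n < r], and almost
   everywhere it lies in [v < cond_cdf r a]. *)
have below_int A r : measurable A ->
    \int[nu]_(a in A) P [set v | below r (a, v)] = ray_slice r A.
  move=> mA; apply/eqP; rewrite eq_le; apply/andP; split.
    rewrite -integral_cond_cdf//; apply: ae_ge0_le_integral => //.
    - exact/measurable_funTS/mset.
    - by move=> a _; rewrite lee_fin.
    - exact/measurable_funTS/measurable_EFinP.
    have aeq : \forall a \ae nu, forall n, (q n < r)%R ->
        (cond_cdf (q n) a <= cond_cdf r a)%R.
      apply/ae_foralln => n; have [qr|qr] := boolP (q n < r)%R.
        by apply: filterS (cond_cdf_le (ltW qr)).
      by apply: nearW.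
    move: aeq (cond_cdf_le1 r); apply: filterS2 => a qa a1 _.
    rewrite -PE ?cond_cdf_ge0//; apply: le_measure; rewrite ?inE.
    + exact: mcut.
    + by rewrite -[X in measurable X]setTI; exact: measurable_fun_ltr.
    + move=> v /=; rewrite /below/= quantile_lt => /asboolP[n [qr vn]].
      exact: lt_le_trans (qa _ qr).
  have lower n : (q n < r)%R ->
      ray_slice (q n) A <= \int[nu]_(a in A) P [set v | below r (a, v)].
    move=> qr; rewrite -integral_cond_cdf//; apply: ae_ge0_le_integral => //.
    - by move=> a _; rewrite lee_fin.
    - exact/measurable_funTS/measurable_EFinP.
    - exact/measurable_funTS/mset.
    move: (cond_cdf_le1 (q n)); apply: filterS => a a1 _.
    rewrite -PE ?cond_cdf_ge0//; apply: le_measure; rewrite ?inE.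
    + by rewrite -[X in measurable X]setTI; exact: measurable_fun_ltr.
    + exact: mcut.
    + by move=> v /= vn; rewrite /below/= quantile_lt; apply/asboolP; exists n.
  (* The half-lines are open, so [ray_slice] is continuous from the left in [r] and rationals just
     below [r] suffice. *)
  have cvgJ : (fun k => ray_slice (r - k.+1%:R^-1)%R A) @ \oo --> ray_slice r A.
    rewrite {2}/ray_slice (_ : A `*` _ =
      \bigcup_k (A `*` `]-oo, (r - k.+1%:R^-1)%R[%classic)).
      apply: nondecreasing_cvg_mu.
      - by move=> k; exact: mray.
      - by apply: bigcupT_measurable => k; exact: mray.
      - move=> k l kl; apply/subsetPset => -[a s] [/= Aa]; rewrite !in_itv/= => h.
        split => //=; rewrite (lt_le_trans h)// lerD2l lerN2.
        by rewrite lef_pV2 ?posrE// ler_nat.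
    apply/seteqP; split=> [[a s]|[a s]].
      move=> [/= Aa]; rewrite in_itv/= => sr.
      have [k hk] : exists k : nat, ((r - s)^-1 < k.+1%:R)%R.
        by exists (Num.truncn (r - s)^-1); exact: truncnS_gt.
      exists k => //; split => //=; rewrite in_itv/= ltrBrDr -ltrBrDl.
      by rewrite -[ltRHS]invrK ltf_pV2 ?posrE ?invr_gt0 ?subr_gt0.
    move=> [k _ [/= Aa]]; rewrite !in_itv/= => h; split => //=.
    by rewrite (lt_trans h)// ltrBlDr ltrDl invr_gt0.
  rewrite -(cvg_lim _ cvgJ)//; apply: lime_le.
    by apply/cvg_ex; exists (ray_slice r A).
  apply: nearW => k; have [n /andP[n1 n2]] : exists n, (r - k.+1%:R^-1 < q n < r)%R.
    by apply: q_dense; rewrite ltrBlDr ltrDl invr_gt0.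
  apply: le_trans (lower n n2); apply: le_measure; rewrite ?inE; try exact: mray.
  move=> [a s] [/= Aa]; rewrite !in_itv/= => h; split => //=.
  by rewrite (lt_trans h).
(* [fine] sends an infinite quantile to 0, so [h] and [quantile] can be compared only outside
   [infin], which is shown to be negligible. *)
pose h z := fine (quantile z).
have mh : measurable_fun [set: T * R] h.
  by apply: measurableT_comp measurable_quantile; exact: fine_measurable.
pose infin := [set z : T * R | quantile z \isn't a fin_num].
have minfin : measurable infin.
  rewrite (_ : infin = ~` [set z | quantile z \is a fin_num]).
    apply: measurableC; rewrite -[X in measurable X]setTI.
    by apply: emeasurable_fin_num => //; exact: measurable_quantile.
  by apply/seteqP; split=> z /=; move/negP.
have infin0 : \int[nu]_a P [set v | infin (a, v)] = 0.
  (* An infinite quantile is either below [- k] or not below [k], and the two bounds vanish as [k]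
     grows. *)
  have ub k : \int[nu]_a P [set v | infin (a, v)] <=
      ray_slice (- k%:R)%R setT + (1 - ray_slice k%:R setT).
    rewrite -!below_int//.
    have -> : 1 - \int[nu]_a P [set v | below k%:R (a, v)] =
        \int[nu]_a (1 - P [set v | below k%:R (a, v)]).
      rewrite integralB//.
      - by rewrite integral_cst// mul1e; congr (_ - _); apply/esym/probability_setT.
      - exact: finite_measure_integrable_cst.
      - apply: (le_integrable measurableT _ _ (finite_measure_integrable_cst nu 1 measurableT)).
          exact: mset.
        by move=> a _; rewrite gee0_abs//= normr1 probability_le1//; exact: mcut.
    rewrite -ge0_integralD//; first last.
    - by apply: emeasurable_funB => //; exact: mset.
    - move=> a _; have p1 : P [set v | below k%:R (a, v)] <= 1.
        by rewrite probability_le1//; exact: mcut.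
      by rewrite sube_ge0; [exact: p1|apply/orP; right].
    - exact: mset.
    apply: ge0_le_integral => //.
    - exact: mset.
    - by apply: emeasurable_funD; [exact: mset|apply: emeasurable_funB => //; exact: mset].
    move=> a _; have mb r := mcut _ a (mbelow r).
    apply: (@le_trans _ _ (P ([set v | below (- k%:R)%R (a, v)] `|`
        ~` [set v | below k%:R (a, v)]))).
      apply: le_measure; rewrite ?inE; first exact: mcut.
        by apply: measurableU => //; exact: measurableC.
      move=> v; rewrite /infin /below/=; case: (quantile (a, v)) => [r|_|_]//.
      - by right.
      - by left; rewrite ltNyr.
    apply: (le_trans (measureU2 _ _ _)) => //; first exact: measurableC.
    rewrite leeD2l// le_eqVlt; apply/orP; left; apply/eqP.
    exact: (probability_setC P (mb k%:R)).
  have mrayT r : measurable ([set: T] `*` (`]-oo, r[%classic : set R)) by exact: mray.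
  have c1 : (fun k : nat => ray_slice (- k%:R)%R setT) @ \oo --> 0.
    rewrite -(measure0 J) (_ : set0 = \bigcap_k ([set: T] `*` `]-oo, (- k%:R)%R[%classic)).
      apply: nonincreasing_cvg_mu => //.
      - by rewrite (le_lt_trans (probability_le1 _ _))// ltry.
      - by apply: bigcapT_measurable.
      - move=> k l kl; apply/subsetPset => -[a s] [/= _]; rewrite !in_itv/= => hs.
        by split => //=; rewrite (lt_le_trans hs)// lerN2 ler_nat.
    apply/seteqP; split => // -[a s] /= hs.
    have [_] := hs (Num.truncn (- s)%R).+1 Logic.I; rewrite /= in_itv/=.
    by rewrite ltrNr ltNge => /negP; apply; exact/ltW/truncnS_gt.
  have c2 : (fun k : nat => ray_slice k%:R setT) @ \oo --> 1.
    rewrite -(probability_setT J) (_ : setT = \bigcup_k ([set: T] `*` `]-oo, k%:R[%classic)).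
      apply: nondecreasing_cvg_mu => //; first exact: bigcupT_measurable.
      move=> k l kl; apply/subsetPset => -[a s] [/= _]; rewrite !in_itv/= => hs.
      by split => //=; rewrite (lt_le_trans hs)// ler_nat.
    apply/seteqP; split => // -[a s] _; exists (Num.truncn s).+1 => //.
    by split => //=; rewrite in_itv/= truncnS_gt.
  have c3 : (fun k : nat => ray_slice (- k%:R)%R setT + (1 - ray_slice k%:R setT)) @ \oo --> 0.
    rewrite -[X in _ --> X]adde0 -{2}(subee (x := 1))//.
    apply: cvgeD => //; apply: cvgeB => //; exact: cvg_cst.
  apply/eqP; rewrite eq_le integral_ge0// andbT -(cvg_lim _ c3)//.
  apply: lime_ge; first by apply/cvg_ex; exists 0.
  exact: nearW.
have infinA A : measurable A -> \int[nu]_(a in A) P [set v | infin (a, v)] = 0.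
  move=> mA; apply/eqP; rewrite eq_le integral_ge0// andbT -infin0.
  by apply: ge0_subset_integral => //; exact: mset.
have /choice[K HK] a : exists M : {measure set R -> \bar R},
    forall C, measurable C -> M C = P [set v | C (h (a, v))].
  have mha : measurable_fun [set: R] (fun v => h (a, v)).
    by apply: measurableT_comp mh _; exact: measurable_fun_pair.
  by have [M M1 _] := law_measure P mha; exists M.
have mhB C : measurable C -> measurable [set z | C (h z)].
  by move=> mC; rewrite -[X in measurable X]setTI; exact: mh.
have mK C : measurable C -> measurable_fun [set: T] (K ^~ C).
  move=> mC; under eq_fun do rewrite HK//.
  exact: (mset _ (mhB _ mC)).
have K1 a : K a setT = 1.
  by rewrite HK// (_ : [set _ | _] = setT)// probability_setT.
pose Ka := isKernel.Build _ _ T R R K mK.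
pose Kk : R.-ker T ~> R := HB.pack K Ka.
pose Kb := Kernel_isProbability.Build _ _ T R R Kk K1.
pose Q : R.-pker T ~> R := HB.pack K Ka Kb.
exists Q => A B mA mB.
(* For fixed [A] both sides are measures in [B], and the half-lines, closed under intersection,
   determine them. *)
have [M1 M1E _] := law_measure (mrestr J (measurableX mA measurableT)) (@measurable_snd _ _ T R).
have [M2 M2E _] := @mixture_measure _ _ T R R nu A (fun=> 1%R) K mA
  (measurable_cst _) (fun=> ler01) (fun C mC => measurable_funTS (mK C mC)).
have e1 C : measurable C -> M1 C = J (A `*` C).
  move=> mC; rewrite M1E// /mrestr; congr (J _).
  by apply/seteqP; split=> -[a s] /=; [move=> [? [? _]]|move=> []].
have e2 C : M2 C = \int[nu]_(a in A) K a C.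
  by rewrite M2E; apply: eq_integral => a _; rewrite mul1e.
rewrite -e1// -[RHS]e2.
apply: (@measure_unique _ _ R (@RGenInftyO.G R) (fun k => `]-oo, k%:R[%classic)) => //.
- exact: RGenInftyO.measurableE.
- move=> _ _ [x ->] [y ->]; exists (Num.min x y).
  by apply/seteqP; split=> s /=; rewrite !in_itv/= lt_min; [move=> [-> ->]|move/andP].
- by move=> k; exists k%:R.
- apply/seteqP; split => // s _; exists (Num.truncn s).+1 => //=.
  by rewrite in_itv/= truncnS_gt.
- move=> _ [r ->]; have mr : measurable (`]-oo, r[%classic : set R) by [].
  rewrite e1// -[LHS]/(ray_slice r A) e2 -below_int//.
  have cmp (C D : set (T * R)) : measurable C -> measurable D ->
      C `<=` D `|` infin ->
      \int[nu]_(a in A) P [set v | C (a, v)] <= \int[nu]_(a in A) P [set v | D (a, v)].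
    move=> mC mD CD; rewrite -[leRHS]adde0 -(infinA A mA) -ge0_integralD//; first last.
    - exact/measurable_funTS/mset.
    - exact/measurable_funTS/mset.
    apply: ge0_le_integral => //.
    - exact/measurable_funTS/mset.
    - by apply: emeasurable_funD; exact/measurable_funTS/mset.
    move=> a _; apply: (@le_trans _ _ (P ([set v | D (a, v)] `|` [set v | infin (a, v)]))).
      apply: le_measure; rewrite ?inE; first exact: mcut.
        by apply: measurableU; exact: mcut.
      by move=> v /CD.
    by apply: measureU2; exact: mcut.
  under [RHS]eq_integral do rewrite HK//.
  have hlt z : ~ infin z -> (h z < r)%R = (quantile z < r%:E).
    by move=> /negP; rewrite negbK => zf; rewrite /h -lte_fin fineK.
  apply/eqP; rewrite eq_le; apply/andP; split.
    apply: (cmp _ [set z | `]-oo, r[%classic (h z)]) => //; first exact: mhB.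
    move=> z zr; have [zi|zi] := pselect (infin z); [by right|left].
    by rewrite /= in_itv/= hlt.
  apply: (cmp [set z | `]-oo, r[%classic (h z)]) => //; first exact: mhB.
  move=> z; rewrite /= in_itv/= => zr; have [zi|zi] := pselect (infin z); [by right|left].
  by rewrite /below/= -hlt.
- by move=> k; rewrite e1// (le_lt_trans (probability_le1 _ _)) ?ltry//; exact: mray.
Qed.

End disintegration_real.

(** * Measurability of limits of real sequences *)

Section measurable_limit.
Context d (U : measurableType d) (R : realType).

Lemma cvgn_realP (v : nat -> R) : cvgn v <->
  forall m : nat, exists N, forall i, (N <= i)%N -> (`|v i - v N| <= m.+1%:R^-1)%R.
Proof.
split=> [/cvg_ex[l vl] m|h].
  have e0 : (0 < (m.+1%:R^-1 / 2 : R))%R by rewrite divr_gt0.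
  have /cvgrPdist_le /(_ _ e0) [N _ hN] := vl.
  exists N => i Ni; have hi := hN i Ni; have hNN := hN N (leqnn N).
  rewrite (_ : v i - v N = (l - v N) - (l - v i))%R; last by ring.
  by rewrite (le_trans (ler_normB _ _))// [leRHS]splitr lerD.
apply: cauchy_cvg; apply: cauchy_exP => e e0.
have [m hm] : exists m : nat, (m.+1%:R^-1 < e)%R.
  exists (Num.truncn e^-1); rewrite -[ltRHS]invrK ltf_pV2 ?posrE ?invr_gt0//.
  exact: truncnS_gt.
have [N hN] := h m; exists (v N); exists N => // i /= Ni.
by rewrite /ball/= distrC (le_lt_trans (hN i Ni)).
Qed.

(** Needed because [Z] is a limit that may fail to exist. The Cauchy criterion with countable
    quantifiers makes the convergence set measurable, and off it [limn] is the constant [point]. *)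
Lemma measurable_limn (f : nat -> U -> R) :
  (forall n, measurable_fun [set: U] (f n)) ->
  measurable_fun [set: U] (fun u => limn (f ^~ u)).
Proof.
move=> mf; pose C := [set u | cvgn (f ^~ u)].
have mC : measurable C.
  have -> : C = \bigcap_m \bigcup_N \bigcap_i
      [set u | (N <= i)%N -> (`|f i u - f N u| <= m.+1%:R^-1)%R].
    apply/seteqP; split=> u.
      move=> /cvgn_realP h m _; have [N hN] := h m.
      by exists N => // i _ /= Ni; exact: hN.
    move=> h; apply/cvgn_realP => m; have [N _ hN] := h m Logic.I.
    by exists N => i Ni; exact: (hN i Logic.I).
  apply: bigcapT_measurable => m; apply: bigcupT_measurable => N.
  apply: bigcapT_measurable => i; case: (leqP N i) => Ni; last first.
    rewrite (_ : [set u | _] = setT); first exact: measurableT.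
    by apply/seteqP; split.
  rewrite (_ : [set u | _] = setT `&` [set u | (`|f i u - f N u| <= m.+1%:R^-1)%R]).
    apply: measurable_fun_ler => //; apply: measurableT_comp => //.
    exact: measurable_funB.
  by apply/seteqP; split=> u /=; [move=> /(_ isT)|case].
rewrite (_ : (fun u => _) = fun u => if u \in C then limn (f ^~ u) else point).
  apply: measurable_fun_if => //.
  - apply: (measurable_fun_bool true); rewrite setTI (_ : _ @^-1` _ = C)//.
    by apply/seteqP; split=> u /=; [move/set_mem|move/mem_set].
  - rewrite setTI (_ : _ @^-1` _ = C); last first.
      by apply/seteqP; split=> u /=; [move/set_mem|move/mem_set].
    apply: (measurable_fun_cvg (h := f)) => //.
    by move=> n; exact: measurable_funTS.
apply/funext => u; case: ifPn => //; rewrite notin_setE => nC.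
by apply: getPN => l ul; apply: nC; apply/cvg_ex; exists l.
Qed.

End measurable_limit.

Lemma integral_law d (U : measurableType d) (R : realType) (P : {measure set U -> \bar R})
    d2 (T : measurableType d2) (M : {measure set T -> \bar R}) (Y : U -> T)
    (D : set T) (f : T -> \bar R) :
  measurable_fun [set: U] Y -> (forall B, measurable B -> P (Y @^-1` B) = M B) ->
  measurable D -> measurable_fun [set: T] f -> (forall y, 0 <= f y) ->
  \int[P]_(u in Y @^-1` D) f (Y u) = \int[M]_(y in D) f y.
Proof.
move=> mY PY mD mf f0; have [L LE Lf] := law_measure P mY.
transitivity (\int[L]_y (f \_ D) y).
  rewrite Lf; last 2 first.
  - by apply/(measurable_restrictT _ _).1 => //; exact: measurable_funTS.
  - by apply: erestrict_ge0.
  rewrite integral_mkcond; apply: eq_integral => u _.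
  by rewrite /patch; congr (if _ then _ else _).
rewrite -integral_mkcond; apply: eq_measure_integral => B mB _.
by rewrite LE// PY.
Qed.

(** * Independence from the product formula on initial segments *)

Section iid_of_product.
Context d (U : measurableType d) (R : realType) (P : probability U R).
Context d2 (T : measurableType d2) (Q : probability T R) (c : nat -> U -> T).
Hypothesis mc : forall i, measurable_fun [set: U] (c i).
Hypothesis cQ : forall n (B : nat -> set T), (forall i, measurable (B i)) ->
  P [set u | forall i, (i < n)%N -> B i (c i u)] = \prod_(i < n) Q (B i).

Lemma marginal_of_product i B : measurable B -> P (c i @^-1` B) = Q B.
Proof.
move=> mB; have := @cQ i.+1 (fun k => if k == i then B else setT).
rewrite (bigD1 ord_max)//= eqxx big1 ?mule1; last first.
  move=> k ki; rewrite (_ : (k : nat) == i = false) ?probability_setT//.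
  by apply: contra_neqF ki => /eqP ki; exact/val_inj.
move=> <-; last by move=> k; case: ifP.
congr (P _); apply/seteqP; split=> u /= h.
  by move=> k _; case: eqVneq => [->|].
by have := h i (ltnSn i); rewrite eqxx.
Qed.

(** A finite list of distinct indices is padded to the initial segment up to its maximum, with
    [setT] at the missing indices. *)
Lemma iid_of_product : iid P c.
Proof.
split; last by move=> i B mB; rewrite !marginal_of_product.
move=> J A uJ AJ.
have /choice[B HB] i : exists B, measurable B /\ (i \in J -> A i = c i @^-1` B).
  case: (boolP (i \in J)) => iJ; last by exists setT.
  by have [B mB <-] := AJ i iJ; exists B; rewrite setTI.
pose n := (\max_(i <- J) i).+1.
have Jn i : i \in J -> (i < n)%N by move=> iJ; rewrite ltnS; exact: leq_bigmax_seq.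
pose B' i := if i \in J then B i else setT.
have -> : \bigcap_(i in [set` J]) A i = [set u | forall i, (i < n)%N -> B' i (c i u)].
  apply/seteqP; split=> u h i.
    move=> _; rewrite /B'; case: ifPn => // iJ.
    by have := h i iJ; rewrite (HB i).2.
  move=> iJ; have := h i (Jn i iJ); rewrite /B' [i \in J]iJ.
  by rewrite (HB i).2.
rewrite cQ; last by move=> i; rewrite /B'; case: ifP => // _; exact: (HB i).1.
rewrite -(big_mkord xpredT (fun i => Q (B' i))).
transitivity (\prod_(0 <= i < n | i \in J) Q (B i)).
  rewrite [RHS]big_mkcond; apply: eq_bigr => i _; rewrite /B'.
  by case: ifP => // _; exact: probability_setT.
rewrite -big_filter; transitivity (\prod_(i <- J) Q (B i)).
  apply: perm_big; apply: uniq_perm => //; first by rewrite filter_uniq// iota_uniq.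
  move=> i; rewrite mem_filter mem_index_iota/=; apply: andb_idr => /Jn; exact.
apply: eq_big_seq => i iJ; rewrite (HB i).2//.
by rewrite marginal_of_product//; exact: (HB i).1.
Qed.

Lemma integral_prod_iid n (f : nat -> T -> R) :
  (forall i, measurable_fun [set: T] (f i)) -> (forall i t, (0 <= f i t <= 1)%R) ->
  \int[P]_u (\prod_(i < n) f i (c i u))%:E =
  (\prod_(i < n) fine (\int[Q]_t (f i t)%:E))%:E.
Proof.
move=> mf f01; pose kap k u : {measure set T -> \bar R} := \d_(c k u).
have kapE (h : nat -> T -> R) : (forall k, measurable_fun setT (h k)) ->
    forall k u, factor (fun _ _ => true) kap h k u = h k (c k u).
  move=> mh k u; rewrite /factor integral_dirac ?diracT ?mul1e//.
  exact/measurable_EFinP.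
have cst_int (r : R) : \int[P]_u r%:E = r%:E.
  by rewrite integral_cst// -[RHS]mule1; congr (_ * _); exact: probability_setT.
transitivity (\int[P]_u (\prod_(k < n) factor (fun _ _ => true) kap f k u)%:E).
  by apply: eq_integral => u _; congr EFin; apply: eq_bigr => k _; rewrite kapE.
rewrite -[RHS]cst_int.
apply: (@integral_prod_factor_replace _ U R P _ T (fun _ _ => true) _ kap
   (fun _ _ => Q) measurable) => //.
- by move=> k; rewrite (_ : [set _ | _] = setT)//; exact/seteqP.
- move=> k B mB; apply/measurable_EFinP => /=.
  by apply: measurableT_comp => //; exact: measurable_indic.
- by move=> k u; rewrite [leLHS](_ : _ = 1)//; exact: diracT.
- by move=> k u; rewrite [leLHS](_ : _ = 1)//; exact: probability_setT.
- by rewrite sigma_algebra_id//; exact: sigma_algebra_measurable.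
- by move=> A B; exact: measurableI.
move=> B mB.
have mind k : measurable_fun setT (\1_(B k) : _ -> R) by exact: measurable_indic.
under eq_integral do under eq_bigr do rewrite kapE//.
transitivity (\int[P]_u (\1_[set u | forall k : 'I_n, (c k @^-1` B k) u] u)%:E).
  by apply: eq_integral => u _; rewrite -prod_indic.
have E : [set u | forall k : 'I_n, (c k @^-1` B k) u] =
    [set u | forall i, (i < n)%N -> B i (c i u)].
  apply/seteqP; split=> u h k; last by exact: h.
  by move=> kn; exact: (h (Ordinal kn)).
have mE : measurable [set u | forall i, (i < n)%N -> B i (c i u)].
  rewrite (_ : [set u | _] = \bigcap_(i in [set i | (i < n)%N]) (c i @^-1` B i)).
    apply: bigcap_measurableType => i _.
    by rewrite -[X in measurable X]setTI; exact: mc.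
  by apply/seteqP; split.
rewrite E integral_indic// setIT; transitivity (\prod_(k < n) Q (B k)); first exact: cQ.
transitivity (\int[P]_u (\prod_(k < n) fine (Q (B k)))%:E); last first.
  apply: eq_integral => u _; congr EFin; apply: eq_bigr => k _.
  by rewrite /factor integral_indic ?setIT// mul1e.
rewrite cst_int -prodEFin; apply: eq_bigr => k _; rewrite fineK//.
exact: fin_num_measure.
Qed.

End iid_of_product.

(** * Compound Poisson sums *)

(** The generating function at [t] is the Laplace transform at [- ln t], whence the positivity of
    [t]. *)
Lemma integral_exprn_poisson {R : realType} (r t : R) :
  (0 <= r)%R -> (0 < t <= 1)%R ->
  \int[poisson_prob r 0%N]_n (t ^+ n)%:E = (expR (- (r * (1 - t))))%:E.
Proof.
move=> r0 /andP[t0 t1]; pose c := (- ln t)%R.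
have ct : expR (- c) = t by rewrite opprK lnK.
have c0 : (0 <= c)%R by rewrite oppr_ge0 ln_le0.
have := @integral_eexpN_poisson _ nat R (poisson_prob r 0%N)
  (fun n => n%:R%:E) r%:E c _ c0 _.
rewrite ct -EFinM eexpN_EFin ?mulr_ge0 ?subr_ge0// [(_ * r)%R]mulrC => <- //.
- apply: eq_integral => n _.
  by rewrite -EFinM eexpN_EFin ?mulr_ge0// -mulNr expRM_natr ct.
- by move=> n; congr (poisson_prob r 0%N _); apply/seteqP; split=> k /=;
    [move=> /eqP; rewrite eqe eqr_nat => /eqP|move=> ->].
Qed.

Lemma integral_itv01 d (T : measurableType d) (R : realType) (Q : probability T R)
    (f : T -> R) : measurable_fun [set: T] f -> (forall x, (0 <= f x <= 1)%R) ->
  \int[Q]_x (f x)%:E = (fine (\int[Q]_x (f x)%:E))%:E /\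
  (0 <= fine (\int[Q]_x (f x)%:E) <= 1)%R.
Proof.
move=> mf f01.
have i0 : 0 <= \int[Q]_x (f x)%:E.
  by apply: integral_ge0 => x _; rewrite lee_fin; have /andP[] := f01 x.
have i1 : \int[Q]_x (f x)%:E <= 1.
  apply: (@le_trans _ _ (\int[Q]_x (cst 1 x))).
    apply: ge0_le_integral => //.
    - by move=> x _; rewrite lee_fin; have /andP[] := f01 x.
    - exact/measurable_EFinP.
    - by move=> x _; rewrite lee_fin; have /andP[] := f01 x.
  rewrite integral_cst// mul1e; exact: probability_le1.
have fi : \int[Q]_x (f x)%:E \is a fin_num by rewrite ge0_fin_numE// (le_lt_trans i1)// ltry.
by rewrite fineK// -!lee_fin fineK// i0.
Qed.

Lemma integral_itv01_gt0 d (T : measurableType d) (R : realType) (Q : probability T R)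
    (f : T -> R) : measurable_fun [set: T] f -> (forall x, (0 < f x <= 1)%R) ->
  (0 < fine (\int[Q]_x (f x)%:E))%R.
Proof.
move=> mf f01.
have f01' x : (0 <= f x <= 1)%R by have /andP[/ltW ->] := f01 x.
have [E /andP[i0 i1]] := integral_itv01 Q mf f01'.
rewrite lt_def i0 andbT; apply/eqP => i00; move: E; rewrite i00 => E.
have mfE : measurable_fun [set: T] (fun x => (f x)%:E) by exact/measurable_EFinP.
have := (ae_eq_integral_abs Q measurableT mfE).1.
under eq_integral do rewrite gee0_abs ?lee_fin ?(andP (f01' _)).1//.
rewrite E => /(_ erefl) [N [mN N0 hN]].
have NT : N = setT.
  apply/seteqP; split=> // x _; apply: hN => /= /(_ Logic.I) /eqP.
  by rewrite eqe gt_eqF//; have /andP[] := f01 x.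
suff /eqP : 1 = 0 :> \bar R by rewrite onee_eq0.
by rewrite -N0 NT; apply/esym; exact: probability_setT.
Qed.

Lemma measurable_fun_nat_index d d' (U : measurableType d) (T : measurableType d')
    (xi : U -> nat) (f : nat -> U -> T) :
  measurable_fun [set: U] xi -> (forall n, measurable_fun [set: U] (f n)) ->
  measurable_fun [set: U] (fun u => f (xi u) u).
Proof.
move=> mxi mf _ B mB; rewrite setTI.
rewrite (_ : _ @^-1` B = \bigcup_n (xi @^-1` [set n] `&` (f n @^-1` B))); last first.
  by apply/seteqP; split=> u /= => [h|[n _ [<-]]//]; exists (xi u).
apply: bigcupT_measurable => n; apply: measurableI.
  by rewrite -[X in measurable X]setTI; exact: mxi.
by rewrite -[X in measurable X]setTI; exact: mf.
Qed.


(** Tonelli integrates out the second sequence while the number of factors and the first sequence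
    are frozen. It is applied once to the locations and once to the marks. *)
Lemma integral_prod_iid_indexed d (V : measurableType d) (R : realType)
    (PV : probability V R) d2 (S2 : measurableType d2) (P2 : probability S2 R)
    e1 (T1 : measurableType e1) e2 (T2 : measurableType e2)
    (Q2 : probability T2 R) (xi : V -> nat) (x : nat -> V -> T1) (c2 : nat -> S2 -> T2)
    (h : T1 * T2 -> R) :
  measurable_fun [set: V] xi -> (forall i, measurable_fun [set: V] (x i)) ->
  (forall i, measurable_fun [set: S2] (c2 i)) ->
  (forall n (B : nat -> set T2), (forall i, measurable (B i)) ->
    P2 [set u | forall i, (i < n)%N -> B i (c2 i u)] = \prod_(i < n) Q2 (B i)) ->
  measurable_fun [set: T1 * T2] h -> (forall z, (0 <= h z <= 1)%R) ->
  \int[PV \x P2]_u (\prod_(i < xi u.1) h (x i u.1, c2 i u.2))%:E =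
  \int[PV]_v (\prod_(i < xi v) fine (\int[Q2]_y (h (x i v, y))%:E))%:E.
Proof.
move=> mxi mx mc2 cQ2 mh h01.
have mF : measurable_fun [set: V * S2]
    (fun u => (\prod_(i < xi u.1) h (x i u.1, c2 i u.2))%:E).
  apply/measurable_EFinP.
  apply: (@measurable_fun_nat_index _ _ _ _ (fun u : V * S2 => xi u.1)
    (fun n u => \prod_(i < n) h (x i u.1, c2 i u.2))%R).
    exact: measurableT_comp.
  move=> n; apply: measurable_prod => i _; apply: measurableT_comp => //.
  by apply: measurable_fun_pair; exact: measurableT_comp.
rewrite fubini_tonelli1//; last first.
  move=> u; rewrite lee_fin; apply: prodr_ge0 => i _.
  by have /andP[] := h01 (x i u.1, c2 i u.2).
apply: eq_integral => v _; rewrite /fubini_F/=.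
rewrite (integral_prod_iid mc2 cQ2 (xi v) (f := fun i y => h (x i v, y)))//.
by move=> i; apply: (measurableT_comp mh); exact: measurable_fun_pair.
Qed.

Section laplace_compound.
Context {R : realType} (r : R) (r0 : (0 <= r)%R).
Context d1 (S1 : measurableType d1) (P1 : probability S1 R).
Context e1 (T1 : measurableType e1) (Q1 : probability T1 R) (c1 : nat -> S1 -> T1).
Hypothesis mc1 : forall i, measurable_fun [set: S1] (c1 i).
Hypothesis cQ1 : forall n (B : nat -> set T1), (forall i, measurable (B i)) ->
  P1 [set u | forall i, (i < n)%N -> B i (c1 i u)] = \prod_(i < n) Q1 (B i).
Context d2 (S2 : measurableType d2) (P2 : probability S2 R).
Context e2 (T2 : measurableType e2) (Q2 : probability T2 R) (c2 : nat -> S2 -> T2).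
Hypothesis mc2 : forall i, measurable_fun [set: S2] (c2 i).
Hypothesis cQ2 : forall n (B : nat -> set T2), (forall i, measurable (B i)) ->
  P2 [set u | forall i, (i < n)%N -> B i (c2 i u)] = \prod_(i < n) Q2 (B i).

Lemma laplace_compound (h : T1 * T2 -> R) : measurable_fun [set: T1 * T2] h ->
  (forall z, (0 < h z <= 1)%R) ->
  \int[(poisson_prob r 0%N \x P1) \x P2]_u
    (\prod_(i < u.1.1) h (c1 i u.1.2, c2 i u.2))%:E =
  (expR (- (r * (1 - fine (\int[Q1]_x (fine (\int[Q2]_y (h (x, y))%:E))%:E)))))%:E.
Proof.
move=> mh h01.
have h01' z : (0 <= h z <= 1)%R by have /andP[/ltW ->] := h01 z.
have mhx x : measurable_fun [set: T2] (fun y => h (x, y)).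
  by apply: (measurableT_comp mh); exact: measurable_fun_pair.
pose f x := fine (\int[Q2]_y (h (x, y))%:E).
have f01 x : (0 < f x <= 1)%R.
  have [_ /andP[_ f1]] := integral_itv01 Q2 (mhx x) (fun y => h01' (x, y)).
  by rewrite f1 andbT; exact: integral_itv01_gt0.
have f01' x : (0 <= f x <= 1)%R by have /andP[/ltW ->] := f01 x.
have mf : measurable_fun [set: T1] f.
  apply: measurableT_comp => //.
  apply: (@measurable_fun_fubini_tonelli_F _ _ _ _ _ Q2 (fun z => (h z)%:E)).
    exact/measurable_EFinP.
  by move=> z; rewrite lee_fin; have /andP[] := h01' z.
have [_ /andP[_ t1]] := integral_itv01 Q1 mf f01'.
have tp := integral_itv01_gt0 Q1 mf f01.
have step1 := @integral_prod_iid_indexed _ (nat * S1)%type R (poisson_prob r 0%N \x P1)%E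
  _ _ P2 _ _ _ _ Q2 fst (fun i v => c1 i v.2) c2 h.
rewrite [LHS]step1//; last by move=> i; exact: measurableT_comp.
have step2 := @integral_prod_iid_indexed _ nat R (poisson_prob r 0%N)
  _ _ P1 _ unit _ _ Q1 id (fun _ _ => tt) c1 (fun z => f z.2).
rewrite [LHS]step2//; last first.
- by apply: measurableT_comp.
rewrite -integral_exprn_poisson//; last by rewrite tp.
by apply: eq_integral => n _; rewrite prodr_const card_ord.
Qed.

End laplace_compound.

(** * Equality in law from Laplace functionals *)

Lemma sum_all_ge0 (R : realType) (I : Type) (l : seq (R * I)) (f : I -> R) :
  all (fun x : R * I => (0 <= x.1)%R) l -> (forall i, (0 <= f i)%R) ->
  (0 <= \sum_(x <- l) x.1 * f x.2)%R.
Proof.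
move=> l0 f0; elim: l l0 => [|x l IH] /=; first by rewrite big_nil.
by move=> /andP[x0 l0]; rewrite big_cons addr_ge0 ?mulr_ge0// IH.
Qed.

Section atom_sum_theory.
Context d (U : measurableType d) (R : realType) dS (S : measurableType dS).
Variables (live : nat -> U -> bool) (x : nat -> U -> S).

Lemma atom_sum_ge0 (g : S -> R) u : (forall s, (0 <= g s)%R) -> 0 <= atom_sum live x g u.
Proof. by move=> g0; apply: nneseries_ge0 => k _ _; rewrite lee_fin. Qed.

Lemma atom_sum_eq0 (g : S -> R) u : (forall s, g s = 0)%R -> atom_sum live x g u = 0.
Proof. by move=> g0; apply: eseries0 => k _ _; rewrite g0. Qed.

(** The shape [c * f + g] is one step of the fold by which linear combinations are built in
    [Y_laplace]. *)
Lemma atom_sumZD (c : R) (f g : S -> R) u : (0 <= c)%R ->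
  (forall s, (0 <= f s)%R) -> (forall s, (0 <= g s)%R) ->
  atom_sum live x (fun s => c * f s + g s)%R u =
  c%:E * atom_sum live x f u + atom_sum live x g u.
Proof.
move=> c0 f0 g0; rewrite /atom_sum -nneseriesZl; last by move=> k _; rewrite lee_fin.
rewrite -nneseriesD//.
- by move=> k _ _; rewrite mule_ge0 ?lee_fin.
- by move=> k _ _; rewrite lee_fin.
Qed.

Lemma cvg_atom_sum (g : S -> R) u : (forall s, (0 <= g s)%R) ->
  atom_sum live x g u < +oo ->
  (fun n => \sum_(0 <= k < n | live k u) g (x k u))%R @ \oo -->
  fine (atom_sum live x g u).
Proof.
move=> g0 gfin.
rewrite (_ : (fun n => _) = fine \o (fun n => \sum_(0 <= k < n | live k u) (g (x k u))%:E)).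
  apply: fine_cvg; rewrite fineK ?ge0_fin_numE ?atom_sum_ge0//.
  by apply: is_cvg_nneseries => k _ _; rewrite lee_fin.
by apply/funext => n /=; rewrite sumEFin.
Qed.

(* A finite sum of zeros and ones has finitely many nonzero terms. *)
Lemma atom_sum_indic_lty (D : set S) (g : S -> R) u : (forall s, (0 <= g s)%R) ->
  (forall s, ~ D s -> g s = 0%R) ->
  atom_sum live x (\1_D : S -> R) u < +oo -> atom_sum live x g u < +oo.
Proof.
move=> g0 gD Dfin.
have D0 s : (0 <= \1_D s :> R)%R by [].
have cD := cvg_atom_sum D0 Dfin.
have : (fun k => if live k u then \1_D (x k u) else 0 : R)%R @ \oo --> (0 : R)%R.
  apply: cvg_series_cvg_0; apply/cvg_ex; exists (fine (atom_sum live x (\1_D : S -> R) u)).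
  rewrite (_ : series _ = fun n => \sum_(0 <= k < n | live k u) \1_D (x k u))%R//.
  by apply/funext => n; rewrite /series/= [RHS]big_mkcond.
move=> /cvgrPdist_lt /(_ 1%R ltr01) [N _ hN].
have gN k : (N <= k)%N -> live k u -> g (x k u) = 0%R.
  move=> Nk lk; apply: gD => Dx; have := hN k Nk.
  by rewrite /= lk sub0r normrN indicE mem_set// normr1 ltxx.
rewrite /atom_sum eseries_mkcond (nneseries_split _ N)//; last first.
  by move=> k _; case: ifP => // _; rewrite lee_fin.
rewrite [X in _ + X]eseries0 ?adde0; last first.
  by move=> k Nk _; case: ifP => // lk; rewrite gN.
rewrite (_ : (\sum_(_ <= _ < _) _)%R = (\sum_(0 <= k < 0 + N | live k u) g (x k u))%:E) ?ltry//.
by rewrite -sumEFin [RHS]big_mkcond; apply: eq_bigr => k _.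
Qed.

End atom_sum_theory.

Section eq_law.
Context d (U : measurableType d) d' (U' : measurableType d') (R : realType)
  (P : probability U R) (P' : probability U' R) dT (T : measurableType dT) (p : nat).
Local Notation E := (p.-tuple R).
Variables (live : nat -> U -> bool) (omega : nat -> U -> T) (A : nat -> U -> E).
Variables (Z : U -> set T -> E) (xi : U' -> nat) (X : nat -> U' -> E)
  (omega' : nat -> U' -> T).
Hypotheses (mlive : forall k, measurable [set u | live k u])
  (momega : forall k, measurable_fun [set: U] (omega k))
  (mA : forall k, measurable_fun [set: U] (A k))
  (mxi : measurable_fun [set: U'] xi)
  (mX : forall k, measurable_fun [set: U'] (X k))
  (momega' : forall k, measurable_fun [set: U'] (omega' k)).
Hypothesis ZE : forall u C, measurable C ->
  Z u C = [tuple limn (fun n : nat =>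
    \sum_(0 <= k < n | live k u) tnth (A k u) j * \1_C (omega k u))%R | j < p].

Local Notation atoms := (fun k u => (omega k u, A k u)).
Local Notation a0 := [tuple 0%R | _ < p].

Lemma measurable_nonzero : measurable (@nonzero R p).
Proof.
rewrite (_ : @nonzero R p = \bigcup_(j in [set: 'I_p])
    ((fun a : E => tnth a j) @^-1` [set~ 0%R])).
  apply: fin_bigcup_measurable => // j _; rewrite -[X in measurable X]setTI.
  have /measurable_fun_tnthP := @measurable_id _ E setT.
  by move=> /(_ j) h; apply: h => //; apply: measurableC.
apply/seteqP; split=> a /=.
  move=> /eqP aN; apply: contra_notP aN => h; apply/eq_from_tnth => j.
  rewrite tnth_mktuple; apply: contra_notP h => aj; by exists j.
by move=> [j _ /=] aj; apply/eqP => a0E; apply: aj; rewrite a0E tnth_mktuple.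
Qed.

Hypothesis laplaceE : forall g : T * E -> R, measurable_fun [set: T * E] g ->
  (forall z, (0 <= g z)%R) -> (forall t, g (t, a0) = 0%R) ->
  \int[P]_u (eexpN (atom_sum live atoms g u))%:E =
  \int[P']_u (\prod_(i < xi u) expR (- g (omega' i u, X i u)))%:E.

Let matoms k : measurable_fun [set: U] (atoms k).
Proof. exact: measurable_fun_pair. Qed.

Let matoms' k : measurable_fun [set: U'] (fun u => (omega' k u, X k u)).
Proof. exact: measurable_fun_pair. Qed.

Let D0 : set (T * E) := [set z | nonzero z.2].
Let Fin := [set u | atom_sum live atoms (\1_D0 : T * E -> R) u < +oo].

Let mD0 : measurable D0.
Proof.
rewrite (_ : D0 = snd @^-1` @nonzero R p)// -[X in measurable X]setTI.
by apply: measurable_snd => //; exact: measurable_nonzero.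
Qed.

Let mFin : measurable Fin.
Proof.
rewrite -[X in measurable X]setTI.
by apply: emeasurable_fun_infty_o => //; apply: measurable_atom_sum.
Qed.

Let measurable_sum_xi (g : T * E -> R) : measurable_fun [set: T * E] g ->
  measurable_fun [set: U'] (fun u => \sum_(i < xi u) g (omega' i u, X i u))%R.
Proof.
move=> mg; apply: (measurable_fun_nat_index
  (f := fun n u => \sum_(i < n) g (omega' i u, X i u))%R) => // n.
by apply: measurable_sum => i; exact: measurableT_comp.
Qed.

Let prodE (g : T * E -> R) u :
  (\prod_(i < xi u) expR (- g (omega' i u, X i u)) =
   expR (- \sum_(i < xi u) g (omega' i u, X i u)))%R.
Proof. by rewrite -sumrN expR_sum. Qed.

Let D00 t : D0 (t, a0) -> False.
Proof. by rewrite /D0 /nonzero/= eqxx. Qed.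

(* The Laplace transform of the number of nonzero atoms tends to 1 at 0. *)
Let PFin : P Fin = 1.
Proof.
pose S0 u : R := (\sum_(i < xi u) \1_D0 (omega' i u, X i u))%R.
have mS0 : measurable_fun [set: U'] S0 by exact: measurable_sum_xi.
have S00 u : (0 <= S0 u)%R by apply: sumr_ge0.
(* As [eexpN] vanishes at infinity, the functional at [t = 1 / (n + 1)] is bounded by the indicator
   of [Fin]. The summand 0 in [g] gives it the shape required by [atom_sumZD]. *)
have le_n n : \int[P']_u (expR (- (n.+1%:R^-1 * S0 u)))%:E <= P Fin.
  pose g z : R := (n.+1%:R^-1 * \1_D0 z + 0)%R.
  have mg : measurable_fun [set: T * E] g.
    by apply: measurable_funD => //; apply: measurable_funM.
  have g0 z : (0 <= g z)%R by rewrite /g addr0 mulr_ge0.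
  rewrite [leLHS](_ : _ = \int[P]_u (eexpN (atom_sum live atoms g u))%:E); last first.
    rewrite laplaceE//; last first.
      by move=> t; rewrite /g indicE memNset ?mulr0 ?addr0// => /D00.
    apply: eq_integral => u _; rewrite prodE; congr (expR (- _))%:E.
    by rewrite mulr_sumr; apply: eq_bigr => i _; rewrite /g addr0.
  rewrite -[leRHS]mul1e -[leRHS]/(1%:E * P Fin) -(setIT Fin) -integral_indic// -ge0_integralZl//.
  apply: ge0_le_integral => //.
  - by move=> u _; rewrite lee_fin; have /andP[] := eexpN_itv01 (atom_sum live atoms g u).
  - apply/measurable_EFinP; apply: measurableT_comp; first exact: measurable_eexpN.
    exact: measurable_atom_sum.
  - apply: emeasurable_funM => //; apply/measurable_EFinP.
    exact: measurable_indic.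
  move=> u _; rewrite mul1e lee_fin indicE; have [uF|uF] := pselect (Fin u).
    by rewrite mem_set//; have /andP[] := eexpN_itv01 (atom_sum live atoms g u).
  rewrite memNset// [atom_sum _ _ _ _](_ : _ =
      n.+1%:R^-1%:E * atom_sum live atoms (\1_D0 : T * E -> R) u +
      atom_sum live atoms (fun=> 0%R : R) u); last by rewrite -atom_sumZD.
  rewrite (atom_sum_eq0 _ _ (g := fun=> 0%R))// adde0.
  have -> : atom_sum live atoms (\1_D0 : T * E -> R) u = +oo.
    by move: uF; rewrite /Fin/= ltey => /negP; rewrite negbK => /eqP.
  by rewrite gt0_muley ?lte_fin// eexpNy.
  exact/measurable_EFinP/measurable_indic.
have cv : \int[P']_u (expR (- (n.+1%:R^-1 * S0 u)))%:E @[n --> \oo] -->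
    \int[P']_u (expR 0)%:E.
  apply: bounded_cvg_integral => //.
  - move=> n; apply: measurableT_comp => //; apply: measurableT_comp => //.
    exact: measurable_funM.
  - move=> n u; rewrite expR_ge0/= -[leRHS]expR0 ler_expR oppr_le0.
    by rewrite mulr_ge0.
  move=> u; apply: continuous_cvg; first exact: continuous_expR.
  rewrite -oppr0; apply: cvgN; rewrite -(mul0r (S0 u)); apply: cvgMl.
  exact: cvg_harmonic.
apply/eqP; rewrite eq_le probability_le1//=.
have : \int[P']_u (expR 0)%:E <= P Fin by apply: (cvge_to_le cv); exact: nearW.
rewrite integral_cst// expR0 mul1e; apply: le_trans.
by rewrite [leRHS](_ : _ = 1); [|exact: probability_setT].
Qed.

Let PFinI B : measurable B -> P B = P (Fin `&` B).
Proof.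
move=> mB; have FC0 : P (~` Fin) = 0.
  transitivity (1 - P Fin); first exact: probability_setC.
  by rewrite [X in 1 - X](_ : _ = 1); [rewrite subee|exact: PFin].
rewrite (measureDI P mB mFin) setIC [X in X + _](_ : _ = 0) ?add0e//.
apply: (subset_measure0 (B := ~` Fin)) => //.
- exact: measurableD.
- exact: measurableC.
Qed.

Let atom_sum_lty (g : T * E -> R) u : (forall z, (0 <= g z)%R) ->
  (forall t, g (t, a0) = 0%R) -> Fin u -> atom_sum live atoms g u < +oo.
Proof.
move=> g0 ga0; apply: atom_sum_indic_lty => // -[t a].
by rewrite /D0 /nonzero/= => /negP; rewrite negbK => /eqP ->.
Qed.

(** A measurable set, a coordinate, and a flag that selects the negative part in [gam] when [true]
    and the positive part when [false]. Each evaluation of [Z] is thus split into nonnegative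
    sums. *)
Let I := ({C : set T | measurable C} * 'I_p * bool)%type.

Let gam (i : I) (z : T * E) : R :=
  (\1_(sval i.1.1) z.1 *
   Num.max (if i.2 then - tnth z.2 i.1.2 else tnth z.2 i.1.2) 0)%R.

Let gam0 i z : (0 <= gam i z)%R.
Proof. by rewrite mulr_ge0// le_max lexx orbT. Qed.

Let gama0 i t : gam i (t, a0) = 0%R.
Proof. by rewrite /gam/= tnth_mktuple oppr0 if_same maxxx mulr0. Qed.

Let mgam i : measurable_fun [set: T * E] (gam i).
Proof.
have mt : measurable_fun [set: T * E] (fun z : T * E => tnth z.2 i.1.2).
  have /measurable_fun_tnthP/(_ i.1.2) := @measurable_snd _ _ T E.
  by [].
apply: measurable_funM.
  apply: measurableT_comp; last exact: measurable_fst.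
  by apply: measurable_indic; exact: (svalP i.1.1).
apply: measurable_maxr => //; case: i.2 => //; exact: measurableT_comp.
Qed.

Let gamB C (mC : measurable C) j t (a : E) :
  (gam ((exist _ C mC, j), false) (t, a) - gam ((exist _ C mC, j), true) (t, a) =
   tnth a j * \1_C t)%R.
Proof.
rewrite /gam/= -mulrBr mulrC; congr (_ * _)%R.
case: (leP 0%R (tnth a j)) => h.
  by rewrite (max_idPr _) ?subr0// oppr_le0.
by rewrite (max_idPl _) ?sub0r ?opprK// oppr_ge0 ltW.
Qed.

Let Y i u : R := fine (atom_sum live atoms (gam i) u).
Let Y' i u : R := (\sum_(k < xi u) gam i (omega' k u, X k u))%R.

Let mY i : measurable_fun [set: U] (Y i).
Proof. by apply: measurableT_comp => //; exact: measurable_atom_sum. Qed.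

Let Y_laplace l : all (fun x : R * I => (0 <= x.1)%R) l ->
  \int[P]_u (laplace Y l u)%:E = \int[P']_u (laplace Y' l u)%:E.
Proof.
move=> l0.
have foldE l' z : foldr (fun x s => x.1 * gam x.2 z + s)%R 0%R l' =
    (\sum_(x <- l') x.1 * gam x.2 z)%R.
  by elim: l' => [|x l' IH]; rewrite ?big_nil//= big_cons IH.
(* A fold instead of a big sum, so that [atom_sumZD] peels off one term definitionally. *)
pose g z : R := foldr (fun x s => x.1 * gam x.2 z + s)%R 0%R l.
have gS z : g z = (\sum_(x <- l) x.1 * gam x.2 z)%R.
  exact: foldE.
have mg : measurable_fun [set: T * E] g.
  rewrite (_ : g = fun z => \sum_(x <- l) x.1 * gam x.2 z)%R; last exact/funext.
  by apply: measurable_sum => x; exact: measurable_funM.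
have g0 z : (0 <= g z)%R.
  by rewrite gS; exact: (sum_all_ge0 l0 (fun i => gam0 i z)).
have ga0 t : g (t, a0) = 0%R.
  by rewrite gS big1// => x _; rewrite gama0 mulr0.
transitivity (\int[P]_u (eexpN (atom_sum live atoms g u))%:E); last first.
  rewrite laplaceE//; apply: eq_integral => u _; rewrite prodE /laplace.
  congr (expR (- _))%:E; rewrite /Y'.
  under eq_bigr do rewrite gS.
  by rewrite exchange_big/=; apply: eq_bigr => x _; rewrite mulr_sumr.
have sumE u : Fin u -> atom_sum live atoms g u = (\sum_(x <- l) x.1 * Y x.2 u)%:E.
  move=> uF; rewrite /g; elim: (l) l0 => [_|x l' IH /= /andP[x0 l0]].
    by rewrite big_nil atom_sum_eq0.
  have s0 z : (0 <= foldr (fun x s => x.1 * gam x.2 z + s) 0 l')%R.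
    by rewrite foldE; exact: (sum_all_ge0 l0 (fun i => gam0 i z)).
  rewrite atom_sumZD// IH// big_cons EFinD EFinM /Y fineK//.
  by rewrite ge0_fin_numE ?atom_sum_ge0// atom_sum_lty.
apply: ge0_ae_eq_integral => //.
- apply/measurable_EFinP; apply: measurableT_comp => //.
  apply: measurableT_comp => //; apply: measurable_sum => x.
  exact: measurable_funM.
- apply/measurable_EFinP; apply: measurableT_comp; first exact: measurable_eexpN.
  exact: measurable_atom_sum.
- by move=> u _; rewrite lee_fin expR_ge0.
- by move=> u _; rewrite lee_fin; have /andP[] := eexpN_itv01 (atom_sum live atoms g u).
exists (~` Fin); split; first exact: measurableC.
  transitivity (P (Fin `&` ~` Fin)); first by apply: PFinI; exact: measurableC.
  by rewrite setICr measure0.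
move=> u /= h uF; apply: h => _; rewrite sumE// eexpN_EFin//.
by apply: (sum_all_ge0 (f := Y ^~ u) l0) => i; rewrite fine_ge0// atom_sum_ge0.
Qed.

Let tup (y : I -> R) C (mC : measurable C) : E :=
  [tuple (y ((exist _ C mC, j), false) - y ((exist _ C mC, j), true))%R | j < p].

(** On [Fin] the positive and the negative sums both converge, so the limit defining [Z] is the
    difference of the two. *)
Let ZY u C (mC : measurable C) : Fin u -> Z u C = tup (Y ^~ u) mC.
Proof.
move=> uF; rewrite ZE//; apply: eq_from_tnth => j; rewrite !tnth_mktuple.
apply: cvg_lim => //.
rewrite (_ : (fun n => _) = (fun n =>
  \sum_(0 <= k < n | live k u) gam ((exist _ C mC, j), false) (omega k u, A k u) -
  \sum_(0 <= k < n | live k u) gam ((exist _ C mC, j), true) (omega k u, A k u))%R).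
  by apply: cvgB; apply: cvg_atom_sum => //; exact: atom_sum_lty.
by apply/funext => n; rewrite -sumrB; apply: eq_bigr => k _; rewrite gamB.
Qed.

Let ZY' u C (mC : measurable C) :
  compound_sum xi X omega' u C = tup (Y' ^~ u) mC.
Proof.
apply: eq_from_tnth => j; rewrite !tnth_mktuple /Y' -sumrB.
by apply: eq_bigr => k _; rewrite gamB.
Qed.

Let mZ C : measurable C -> measurable_fun [set: U] (Z ^~ C).
Proof.
move=> mC; rewrite (_ : Z ^~ C = fun u => [tuple limn (fun n : nat =>
    \sum_(0 <= k < n | live k u) tnth (A k u) j * \1_C (omega k u))%R | j < p]);
  last by apply/funext => u; exact: ZE.
apply/measurable_fun_tnthP => j.
rewrite (_ : _ \o _ = fun u => limn (fun n : nat =>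
    \sum_(0 <= k < n | live k u) tnth (A k u) j * \1_C (omega k u))%R);
  last by apply/funext => u /=; rewrite tnth_mktuple.
apply: (measurable_limn (f := fun n u =>
  \sum_(0 <= k < n | live k u) tnth (A k u) j * \1_C (omega k u))%R) => n.
under eq_fun do rewrite big_mkcond.
apply: measurable_sum => k; apply: measurable_fun_ifT => //.
  by apply: (measurable_fun_bool true); rewrite setTI; exact: mlive.
apply: measurable_funM; first by have /measurable_fun_tnthP/(_ j) := mA k.
by apply: measurableT_comp => //; exact: measurable_indic.
Qed.

Let gens := [set H | exists (i : I) (c : R), H = [set y : I -> R | (c < y i)%R]].

Let tup_measurable C (mC : measurable C) (B : set E) : measurable B ->
  <<s gens >> [set y | B (tup y mC)].
Proof.
move=> mB; pose V := g_sigma_algebraType gens.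
have coord i : measurable_fun [set: V] (fun y : V => (y : I -> R) i).
  apply: (measurability _ (RGenOInfty.measurableE R)) => _ [_ [c ->] <-].
  rewrite setTI; apply: sub_sigma_algebra; exists i, c.
  by apply/seteqP; split=> y /=; rewrite in_itv/= andbT.
have : measurable_fun [set: V] (fun y : V => tup (y : I -> R) mC).
  apply/measurable_fun_tnthP => j.
  rewrite (_ : _ \o _ = fun y : V => ((y : I -> R) ((exist _ C mC, j), false) -
    (y : I -> R) ((exist _ C mC, j), true))%R).
    exact: measurable_funB.
  by apply/funext => y /=; rewrite tnth_mktuple.
by move=> /(_ measurableT B mB); rewrite setTI.
Qed.

(** Every event on evaluations pulls back along [tup] to an event on families indexed by [I]. For
    [Z] this correspondence holds on [Fin] only, so [good] records the measurability of its preimage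
    separately. *)
Lemma eq_law_of_laplace : eq_law P Z P' (compound_sum xi X omega').
Proof.
pose good F := exists Ft : set (I -> R), [/\ <<s gens >> Ft, measurable (Z @^-1` F),
  forall u, Fin u -> F (Z u) <-> Ft (Y ^~ u) &
  forall u, F (compound_sum xi X omega' u) <-> Ft (Y' ^~ u)].
have goodF F : eval_sigma F -> good F.
  move: F; apply: smallest_sub; last first.
    move=> _ [C [B [mC mB ->]]]; exists [set y | B (tup y mC)]; split.
    - exact: tup_measurable.
    - by rewrite -[X in measurable X]setTI; exact: mZ.
    - by move=> u uF; rewrite /= (ZY mC).
    - by move=> u; rewrite /= (ZY' _ mC).
  have [s0 sD sU] := smallest_sigma_algebra setT gens.
  split.
  - by exists set0; split=> //; rewrite preimage_set0.
  - move=> F [Ft [sFt mF FE F'E]]; exists (setT `\` Ft); split; first exact: sD.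
    + by rewrite setTD preimage_setC; exact: measurableC.
    + by move=> u uF; split=> -[_ h]; split=> // h'; apply: h; apply/FE.
    + by move=> u; split=> -[_ h]; split=> // h'; apply: h; apply/F'E.
  - move=> F /choice[Ft h]; exists (\bigcup_n Ft n); split.
    + by apply: sU => n; have [] := h n.
    + by rewrite preimage_bigcup; apply: bigcupT_measurable => n; have [] := h n.
    + by move=> u uF; split=> -[n _ Fu]; exists n => //; have [_ _ e _] := h n; apply/e.
    + by move=> u; split=> -[n _ Fu]; exists n => //; have [_ _ _ e] := h n; apply/e.
move=> F /goodF[Ft [sFt mF FE F'E]].
have Y'0 i u : (0 <= Y' i u)%R by apply: sumr_ge0.
have [mYF _ PE] := laplace_unique mY
  (fun i u => fine_ge0 (atom_sum_ge0 live atoms u (gam0 i)))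
  (fun i => measurable_sum_xi (mgam i)) Y'0 Y_laplace sFt.
rewrite PFinI// (_ : Fin `&` _ = Fin `&` [set u | Ft (Y ^~ u)]); last first.
  by apply/seteqP; split=> u [uF Fu]; split=> //; apply/FE.
rewrite -PFinI// [LHS]PE; congr (P' _); apply/seteqP; split=> u; by move/F'E.
Qed.

End eq_law.

(** * Independence on product spaces *)

Lemma rv_sigma_comp d (U : measurableType d) d1 (V : measurableType d1)
    d2 (T : measurableType d2) (f : U -> V) (X : V -> T) :
  measurable_fun [set: V] X -> rv_sigma (X \o f) `<=` rv_sigma f.
Proof.
move=> mX _ [B mB <-]; exists (X @^-1` B) => //.
by rewrite -[X in measurable X]setTI; exact: mX.
Qed.

Lemma seq_sigma_comp d (U : measurableType d) d1 (V : measurableType d1)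
    d2 (T : measurableType d2) (f : U -> V) (X : nat -> V -> T) :
  (forall i, measurable_fun [set: V] (X i)) ->
  seq_sigma (fun i => X i \o f) `<=` rv_sigma f.
Proof.
move=> mX; apply: smallest_sub.
  by apply: sigma_algebra_preimage; exact: sigma_algebra_measurable.
by move=> A [i _ /rv_sigma_comp]; apply.
Qed.

Section product_projections.
Context d1 (V : measurableType d1) d2 (W : measurableType d2) (R : realType)
  (P : probability V R) (Q : probability W R).

Lemma product_fst A : measurable A -> (P \x Q) (fst @^-1` A) = P A.
Proof.
move=> mA; rewrite (_ : _ @^-1` _ = A `*` setT); last by apply/seteqP; split=> // z [].
rewrite product_measure1E// -[RHS]mule1; congr (_ * _); exact: probability_setT.
Qed.

Lemma product_snd B : measurable B -> (P \x Q) (snd @^-1` B) = Q B.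
Proof.
move=> mB; rewrite (_ : _ @^-1` _ = setT `*` B); last by apply/seteqP; split=> // z [].
rewrite product_measure1E// -[RHS]mul1e; congr (_ * _); exact: probability_setT.
Qed.

Lemma indep_projections :
  indep (P \x Q)%E (rv_sigma (fst : V * W -> V)) (rv_sigma (snd : V * W -> W)).
Proof.
move=> _ _ [A mA <-] [B mB <-]; rewrite !setTI.
transitivity (P A * Q B); first exact: product_measure1E.
by congr (_ * _); apply/esym; [exact: product_fst|exact: product_snd].
Qed.

End product_projections.

Lemma indepS d (U : measurableType d) (R : realType) (P : probability U R)
    (F F' G G' : set (set U)) :
  F `<=` F' -> G `<=` G' -> indep P F' G' -> indep P F G.
Proof. by move=> FF' GG' h A B /FF' fA /GG' gB; exact: h. Qed.

(** The space is the product of [nat * S1] with [S2]. This nesting makes the pair of count and marks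
    a single projection, so its independence from the locations is independence of the two
    factors. *)
Lemma compound_poisson_space {R : realType} (r : R) (r0 : (0 <= r)%R)
    e1 (T1 : measurableType e1) (Q1 : probability T1 R)
    e2 (T2 : measurableType e2) (Q2 : probability T2 R) :
  exists (dU' : measure_display) (U' : measurableType dU') (P' : probability U' R)
    (xi : U' -> nat) (x1 : nat -> U' -> T1) (x2 : nat -> U' -> T2),
  [/\ measurable_fun [set: U'] xi, forall i, measurable_fun [set: U'] (x1 i) &
      forall i, measurable_fun [set: U'] (x2 i)] /\
  [/\ iid P' x1 /\ (forall i B, measurable B -> P' (x1 i @^-1` B) = Q1 B),
      (forall n, P' (xi @^-1` [set n]) = poisson_prob r 0%N [set n]),
      indep P' (rv_sigma xi) (seq_sigma x1),
      iid P' x2 /\ (forall i B, measurable B -> P' (x2 i @^-1` B) = Q2 B) &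
      indep P' (seq_sigma x2) <<s rv_sigma xi `|` seq_sigma x1 >>] /\
  forall h : T1 * T2 -> R, measurable_fun [set: T1 * T2] h ->
    (forall z, (0 < h z <= 1)%R) ->
    \int[P']_u (\prod_(i < xi u) h (x1 i u, x2 i u))%:E =
    (expR (- (r * (1 - fine (\int[Q1]_x (fine (\int[Q2]_y (h (x, y))%:E))%:E)))))%:E.
Proof.
have [d1 [S1 [P1 [c1 [mc1 cQ1]]]]] := iid_sequence_exists Q1.
have [d2 [S2 [P2 [c2 [mc2 cQ2]]]]] := iid_sequence_exists Q2.
pose V := (nat * S1)%type; pose PV : probability V R := (poisson_prob r 0%N \x P1)%E.
pose U' := (V * S2)%type; pose P' : probability U' R := (PV \x P2)%E.
exists _, U', P', (fun u => u.1.1), (fun i u => c1 i u.1.2), (fun i u => c2 i u.2).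
have mbox d (S : measurableType d) e (T : measurableType e) (c : nat -> S -> T) n B :
    (forall i, measurable_fun [set: S] (c i)) -> (forall i, measurable (B i)) ->
    measurable [set s | forall i, (i < n)%N -> B i (c i s)].
  move=> mc mB.
  rewrite (_ : [set u | _] = \bigcap_(i in [set i | (i < n)%N]) (c i @^-1` B i)).
    apply: bigcap_measurableType => i _.
    by rewrite -[X in measurable X]setTI; exact: mc.
  by apply/seteqP; split.
have m1 i : measurable_fun [set: U'] (fun u : U' => c1 i u.1.2).
  by apply: measurableT_comp => //; apply: measurableT_comp.
have m2 i : measurable_fun [set: U'] (fun u : U' => c2 i u.2).
  exact: measurableT_comp.
have cP1 n (B : nat -> set T1) : (forall i, measurable (B i)) ->
    P' [set u | forall i, (i < n)%N -> B i (c1 i u.1.2)] = \prod_(i < n) Q1 (B i).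
  move=> mB; rewrite -cQ1//.
  have mb := mbox _ _ _ _ _ n _ mc1 mB.
  rewrite -(product_snd (poisson_prob r 0%N) P1 mb).
  rewrite -[RHS](product_fst PV P2)//.
  by rewrite -[X in measurable X]setTI; exact: measurable_snd.
have cP2 n (B : nat -> set T2) : (forall i, measurable (B i)) ->
    P' [set u | forall i, (i < n)%N -> B i (c2 i u.2)] = \prod_(i < n) Q2 (B i).
  move=> mB; rewrite -cQ2//.
  have mb := mbox _ _ _ _ _ n _ mc2 mB.
  by rewrite -(product_snd PV P2 mb).
have mfst2 (A : set nat) : measurable (fst @^-1` A : set V).
  by rewrite -[X in measurable X]setTI; exact: measurable_fst.
split; first by split=> //; exact: measurableT_comp.
split; last by move=> h mh h01;
    exact: (@laplace_compound R r r0 _ S1 P1 _ T1 Q1 c1 mc1 cQ1 _ S2 P2 _ T2 Q2 c2 mc2 cQ2 h).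
split.
- split; first exact: iid_of_product cP1.
  by move=> i B mB; exact: marginal_of_product cP1 _ _ mB.
- move=> n; rewrite -(product_fst (poisson_prob r 0%N) P1)//.
  by rewrite -[RHS](product_fst PV P2).
- move=> A B [C mC <-] fB; rewrite setTI.
  have [D mD <-] : rv_sigma (snd \o (fst : U' -> V) : U' -> S1) B.
    exact: (@seq_sigma_comp _ U' _ S1 _ T1 (snd \o fst) c1).
  rewrite setTI; have mC' : measurable (fst @^-1` C : set V) by exact: mfst2.
  have mD' : measurable (snd @^-1` D : set V).
    by rewrite -[X in measurable X]setTI; exact: measurable_snd.
  transitivity (PV (fst @^-1` C `&` snd @^-1` D)).
    by rewrite -(product_fst PV P2)//; exact: measurableI.
  transitivity (PV (fst @^-1` C) * PV (snd @^-1` D)).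
    apply: (@indep_projections _ _ _ _ R (poisson_prob r 0%N) P1).
      by exists C => //; rewrite setTI.
    by exists D => //; rewrite setTI.
  by congr (_ * _); rewrite -(product_fst PV P2).
- split; first exact: iid_of_product cP2.
  by move=> i B mB; exact: marginal_of_product cP2 _ _ mB.
- apply: (indepS (F' := rv_sigma (snd : U' -> S2)) (G' := rv_sigma (fst : U' -> V))).
  + exact: (@seq_sigma_comp _ U' _ S2 _ T2 snd c2).
  + apply: smallest_sub.
      by apply: sigma_algebra_preimage; exact: sigma_algebra_measurable.
    move=> A [|].
      exact: (@rv_sigma_comp _ U' _ V _ nat fst fst).
    apply: (@seq_sigma_comp _ U' _ V _ T1 fst (fun i v => c1 i v.2)).
    by move=> i; exact: measurableT_comp.
  + move=> A B fA gB; rewrite setIC muleC.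
    exact: (@indep_projections _ _ _ _ R PV P2).
Qed.

(** * The law of a nonzero mark *)

Lemma prob_kernel_exists d1 (X : measurableType d1) d2 (Y : measurableType d2)
    (R : realType) (k : X -> {measure set Y -> \bar R}) :
  (forall C, measurable C -> measurable_fun [set: X] (k ^~ C)) ->
  (forall x, k x setT = 1) -> exists K : R.-pker X ~> Y, forall x, K x = k x.
Proof.
move=> mk k1; pose Ka := isKernel.Build _ _ X Y R k mk.
pose Kk : R.-ker X ~> Y := HB.pack k Ka.
pose Kb := Kernel_isProbability.Build _ _ X Y R Kk k1.
by exists (HB.pack k Ka Kb : R.-pker X ~> Y).
Qed.

Lemma prob_kernel_fin_num d1 (X : measurableType d1) d2 (Y : measurableType d2)
    (R : realType) (K : R.-pker X ~> Y) x C : measurable C -> K x C \is a fin_num.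
Proof.
move=> mC; rewrite ge0_fin_numE// (@le_lt_trans _ _ (K x setT))//.
  by apply: le_measure; rewrite ?inE.
by rewrite prob_kernel ltry.
Qed.

Lemma measurable_fun_integral_kernel_in d1 (S : measurableType d1)
    d2 (T : measurableType d2) (R : realType) (K : R.-pker S ~> T) (N : set T)
    (f : S * T -> \bar R) : measurable N -> measurable_fun [set: S * T] f ->
  (forall z, 0 <= f z) ->
  measurable_fun [set: S] (fun s => \int[K s]_(t in N) f (s, t)).
Proof.
move=> mN mf f0; pose g (z : S * T) := (f \_ [set z | N z.2]) z.
rewrite (_ : (fun s => _) = fun s => \int[K s]_t g (s, t)).
  apply: measurable_fun_integral_finite_kernel.
    by move=> z; exact: erestrict_ge0.
  apply/(measurable_restrictT _ _).1; last exact: measurable_funTS.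
  by rewrite -[X in measurable X]setTI; apply: measurable_snd.
apply/funext => s; rewrite integral_mkcond; apply: eq_integral => t _.
by rewrite /g /patch; congr (if _ then _ else _).
Qed.

(** Two nested mixtures: Dirac masses at [(s, t)] over [K s], then the results over [L]. It yields
    both the Poisson intensity and the joint law of [(H, X)]. *)
Lemma section_mixture d1 (S : measurableType d1) d2 (T : measurableType d2)
    (R : realType) (L : {measure set S -> \bar R}) (D : set S) (w : S -> R)
    (K : R.-pker S ~> T) (N : set T) :
  measurable D -> measurable_fun D w -> (forall s, (0 <= w s)%R) -> measurable N ->
  exists M : {measure set (S * T) -> \bar R}, forall f : S * T -> \bar R,
    measurable_fun [set: S * T] f -> (forall z, 0 <= f z) ->
    \int[M]_z f z = \int[L]_(s in D) ((w s)%:E * \int[K s]_(t in N) f (s, t)).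
Proof.
move=> mD mw w0 mN.
have /choice[Ms MsE] : forall s : S, exists M : {measure set (S * T) -> \bar R},
    forall f : S * T -> \bar R, measurable_fun [set: S * T] f -> (forall z, 0 <= f z) ->
    \int[M]_z f z = \int[K s]_(t in N) f (s, t).
  move=> s.
  have mpair C : measurable C -> measurable_fun N (fun t => (\d_(s, t) C : \bar R)).
    move=> mC; apply: measurable_funTS.
    rewrite (_ : (fun t => _) = EFin \o (fun t => \1_C (s, t))); last by apply/funext.
    apply/measurable_EFinP; apply: measurableT_comp; first exact: measurable_indic.
    exact: measurable_fun_pair.
  have [M _ MI] := @mixture_measure _ _ T (S * T)%type R (K s) N (fun=> 1%R)
    (fun t => \d_(s, t)) mN (measurable_cst _) (fun=> ler01) mpair.
  exists M => f mf f0; rewrite MI//; apply: eq_integral => t _.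
  by rewrite mul1e integral_dirac// diracT mul1e.
have mMs C : measurable C -> measurable_fun D (fun s => Ms s C).
  move=> mC; apply: measurable_funTS.
  rewrite (_ : (fun s => _) = fun s => \int[K s]_(t in N) (\1_C (s, t))%:E).
    apply: (measurable_fun_integral_kernel_in K (f := fun z => (\1_C z)%:E)) => //.
    exact/measurable_EFinP/measurable_indic.
  apply/funext => s; rewrite -(MsE s (fun z => (\1_C z)%:E)).
  - by rewrite integral_indic// setIT.
  - exact/measurable_EFinP/measurable_indic.
  - by move=> z; rewrite lee_fin.
have [M _ MI] := @mixture_measure _ _ S (S * T)%type R L D w Ms mD mw w0 mMs.
by exists M => f mf f0; rewrite MI//; apply: eq_integral => s _; rewrite MsE.
Qed.

Lemma measurable_funV_ge0 d (T : measurableType d) (R : realType) (f : T -> R) :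
  measurable_fun [set: T] f -> (forall x, (0 <= f x)%R) ->
  measurable_fun [set: T] (fun x => (f x)^-1)%R.
Proof.
move=> mf f0; rewrite (_ : (fun x => _) = (@powR R ^~ (-1)%R) \o f).
  by apply: measurableT_comp => //; exact: measurable_powR.
by apply/funext => x /=; rewrite powR_inv1.
Qed.

Lemma integral_probability1B d (T : measurableType d) (R : realType)
    (Q : {measure set T -> \bar R}) (f : T -> R) : Q setT = 1 ->
  measurable_fun [set: T] f -> (forall x, (0 <= f x <= 1)%R) ->
  \int[Q]_x (1 - f x)%:E = (1 - fine (\int[Q]_x (f x)%:E))%:E.
Proof.
move=> /probability_of_measure[Q' Q'E] mf f01.
have QQ' (g : T -> \bar R) : \int[Q]_x g x = \int[Q']_x g x.
  by apply: eq_measure_integral => A mA _; apply/esym; exact: Q'E.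
rewrite !QQ'; have [fE _] := integral_itv01 Q' mf f01.
have mf1 : measurable_fun [set: T] (fun x => 1 - f x)%R by exact: measurable_funB.
have : \int[Q']_x (1 - f x)%:E + \int[Q']_x (f x)%:E = 1.
  rewrite -ge0_integralD//; last 4 first.
  - by move=> x _; rewrite lee_fin subr_ge0; have /andP[] := f01 x.
  - exact/measurable_EFinP.
  - by move=> x _; rewrite lee_fin; have /andP[] := f01 x.
  - exact/measurable_EFinP.
  transitivity (\int[Q']_x (cst 1 x)).
    by apply: eq_integral => x _; rewrite -EFinD subrK.
  rewrite integral_cst// mul1e; exact: probability_setT.
rewrite fE => h; rewrite EFinB -h addeK//.
Qed.

Section mixture_law.
Context {R : realType} (p : nat) (G : R.-pker R ~> p.-tuple R).
Local Notation E := (p.-tuple R).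
Local Notation pos := (`]0%R, +oo[%classic : set R).
Local Notation nz := (@nonzero R p).
Variables (L : {measure set R -> \bar R}) (w : R -> R) (phi : R).
Hypotheses (mw : measurable_fun pos w) (w0 : forall s, (0 <= w s)%R)
  (phi0 : (0 < phi)%R)
  (phiE : \int[L]_(s in pos) ((w s)%:E * G s nz) = phi%:E).

Let mnz : measurable nz. Proof. exact: measurable_nonzero. Qed.
Let mpos : measurable pos. Proof. exact: measurable_itv. Qed.

Let wphi_ge0 s : (0 <= w s / phi)%R.
Proof. by rewrite divr_ge0// ltW. Qed.

Let mwphi : measurable_fun pos (fun s => w s / phi)%R.
Proof. exact: measurable_funM. Qed.

Let integral_phi (f : R -> \bar R) : measurable_fun pos f ->
  (forall s, pos s -> 0 <= f s) ->
  phi%:E * \int[L]_(s in pos) ((w s / phi)%:E * f s) =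
  \int[L]_(s in pos) ((w s)%:E * f s).
Proof.
move=> mf f0; rewrite -ge0_integralZl//; last 3 first.
- by apply: emeasurable_funM => //; exact/measurable_EFinP.
- by move=> s ps; rewrite mule_ge0 ?lee_fin// f0.
- by rewrite lee_fin ltW.
by apply: eq_integral => s _; rewrite muleA -EFinM mulrC mulfVK// gt_eqF.
Qed.

(** [m] is the law of one pair [(H, X)]; the hypothesis [phiE] says exactly that its total mass is
    1. *)
Lemma mark_law_exists : exists m : probability (R * E)%type R,
  forall f : R * E -> \bar R, measurable_fun [set: R * E] f -> (forall z, 0 <= f z) ->
    \int[m]_z f z =
    \int[L]_(s in pos) ((w s / phi)%:E * \int[G s]_(a in nz) f (s, a)).
Proof.
have [M MI] := section_mixture L G mpos mwphi wphi_ge0 mnz.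
have M1 : M setT = 1.
  transitivity (\int[M]_z (cst 1 z)); first by rewrite integral_cst// mul1e.
  have phiI : phi%:E * \int[L]_(s in pos) ((w s / phi)%:E * \int[G s]_(a in nz) cst 1 (s, a)) =
      phi%:E.
    rewrite integral_phi; last 2 first.
    - apply: measurable_funTS.
      exact: (@measurable_fun_integral_kernel_in _ R _ E R G nz (cst 1)).
    - by move=> s _; exact: integral_ge0.
    rewrite -[RHS]phiE; apply: eq_integral => s _.
    by rewrite integral_cst// mul1e.
  rewrite MI//; move: phiI; set I := (X in _ * X = _) => phiI.
  transitivity ((phi^-1)%:E * (phi%:E * I)).
    by rewrite muleA -EFinM mulVf ?mul1e ?gt_eqF.
  by rewrite phiI -EFinM mulVf ?gt_eqF.
have [m mE] := probability_of_measure M1; exists m => f mf f0.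
by rewrite -MI//; apply: eq_measure_integral => A mA _; exact: mE.
Qed.

Variable m : probability (R * E)%type R.
Hypothesis mI : forall f : R * E -> \bar R, measurable_fun [set: R * E] f ->
  (forall z, 0 <= f z) -> \int[m]_z f z =
    \int[L]_(s in pos) ((w s / phi)%:E * \int[G s]_(a in nz) f (s, a)).

Lemma mark_law_setX A B : measurable A -> measurable B ->
  m (A `*` B) = \int[L]_(s in A `&` pos) ((w s / phi)%:E * G s (B `&` nz)).
Proof.
move=> mA mB; have mAB : measurable (A `*` B) by exact: measurableX.
transitivity (\int[m]_z (\1_(A `*` B) z)%:E); first by rewrite integral_indic// setIT.
rewrite mI//; last exact/measurable_EFinP/measurable_indic.
rewrite integral_mkcondl; apply: eq_integral => s _.
rewrite /patch; case: ifPn => [/set_mem As|/negP sA].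
  congr (_ * _); transitivity (\int[G s]_(a in nz) (\1_B a)%:E); last first.
    by rewrite integral_indic.
  apply: eq_integral => a _.
  rewrite !indicE; congr (_%:R%:E); apply: congr1; apply/idP/idP => /set_mem.
    by move=> [_ /mem_set].
  by move=> Ba; apply/mem_set.
rewrite integral0_eq ?mule0// => a _.
by rewrite indicE memNset// => -[/mem_set].
Qed.

Lemma integral_mark_law1 (f : R -> \bar R) A : measurable A ->
  measurable_fun [set: R] f -> (forall s, 0 <= f s) ->
  \int[m]_(z in A `*` setT) f z.1 =
  \int[L]_(s in A `&` pos) ((w s / phi)%:E * (f s * G s nz)).
Proof.
move=> mA mf f0.
have mAT : measurable (A `*` [set: E]) by exact: measurableX.
have mf1 : measurable_fun [set: R * E] (fun z : R * E => f z.1).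
  exact: measurableT_comp.
rewrite integral_mkcond mI; last 2 first.
- exact: (measurable_restrictT _ mAT).1 (measurable_funTS mf1).
- by move=> z; exact: erestrict_ge0.
rewrite [RHS]integral_mkcondl; apply: eq_integral => s _.
rewrite /patch; case: ifPn => [/set_mem As|/negP sA].
  congr (_ * _); rewrite -integral_cst//; apply: eq_integral => a _.
  by rewrite mem_set.
rewrite integral0_eq ?mule0// => a _.
by rewrite memNset// => -[/mem_set].
Qed.

Section joint_law.
Context d (U : measurableType d) (P : probability U R) (H : U -> R) (X : U -> E).
Hypotheses (mH : measurable_fun [set: U] H) (mX : measurable_fun [set: U] X)
  (PHX : forall C, measurable C -> P ((fun u => (H u, X u)) @^-1` C) = m C).

Let mHX : measurable_fun [set: U] (fun u => (H u, X u)).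
Proof. exact: measurable_fun_pair. Qed.

Lemma regular_cond_law_mark : regular_cond_law P X H (cond_nonzero G).
Proof.
have mGB B : measurable B -> measurable_fun [set: R] (fun s => fine (G s (B `&` nz))).
  move=> mB; apply: measurableT_comp => //; apply: measurable_kernel.
  exact: measurableI.
have mcond B : measurable B -> measurable_fun [set: R] (cond_nonzero G ^~ B).
  move=> mB; apply/measurable_EFinP; apply: measurable_funM; first exact: mGB.
  apply: measurable_funV_ge0; last by move=> s; rewrite fine_ge0.
  by apply: measurableT_comp => //; exact: measurable_kernel.
have cond0 B s : 0 <= cond_nonzero G s B.
  by rewrite lee_fin divr_ge0// fine_ge0.
(* On [A0] the function [cond_nonzero G s] is 0 and not a probability. [H] avoids [A0] almost
   surely, because its density carries the factor [pi_A]. *)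
pose A0 := [set s | pi_A G s = 0%R].
have mA0 : measurable A0.
  rewrite (_ : A0 = (fun s => G s nz) @^-1` [set 0]).
    by rewrite -[X in measurable X]setTI; apply: measurable_kernel.
  apply/seteqP; split=> s; rewrite /A0/= /pi_A; last by move=> ->.
  by move=> h; rewrite -(fineK (prob_kernel_fin_num G s mnz)) h.
split => //.
- exists (H @^-1` A0); split.
  + by rewrite -[X in measurable X]setTI; exact: mH.
  + transitivity (m (A0 `*` setT)).
      rewrite -PHX; last exact: measurableX.
      by congr (P _); apply/seteqP; split=> u // [].
    rewrite mark_law_setX// integral0_eq// => s [As _].
    rewrite setTI -(fineK (prob_kernel_fin_num G s mnz)).
    by rewrite -[fine _]/(pi_A G s) As mule0.
  move=> u; apply: contra_notP => /= uA0.
  have pi0 : (0 <= (pi_A G (H u))^-1)%R by rewrite invr_ge0 fine_ge0.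
  pose M := mscale (NngNum pi0) (mrestr (G (H u)) mnz).
  have ME B : measurable B -> cond_nonzero G (H u) B = M B.
    move=> mB; rewrite /M /mscale/= /mrestr /cond_nonzero mulrC EFinM fineK//.
    by apply: prob_kernel_fin_num; exact: measurableI.
  have M1 : M setT = 1.
    by rewrite -ME// /cond_nonzero setTI divff//; exact/eqP.
  by have [Q QE] := probability_of_measure M1; exists Q => B mB; rewrite QE ME.
move=> A B mA mB.
transitivity (m (A `*` B)).
  by rewrite -PHX; [congr (P _)|exact: measurableX].
transitivity (\int[m]_(z in A `*` setT) cond_nonzero G z.1 B).
  rewrite mark_law_setX// (integral_mark_law1 (f := fun s => cond_nonzero G s B) mA (mcond _ mB) (cond0 B)).
  apply: eq_integral => s _; congr (_ * _).
  rewrite -[X in _ * X](fineK (prob_kernel_fin_num G s mnz)) -EFinM.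
  rewrite -[LHS](fineK (prob_kernel_fin_num G s _)); last exact: measurableI.
  (* Where [pi_A] vanishes, the mass of the nonzero marks in [B] vanishes too, so the identity
     survives the division by 0. *)
  have [p0|p0] := eqVneq (pi_A G s) 0%R; last first.
    by rewrite -[fine (G s nz)]/(pi_A G s) mulfVK.
  rewrite -[fine (G s nz)]/(pi_A G s) p0 mulr0; congr EFin.
  apply/eqP; rewrite eq_le fine_ge0// andbT -p0 fine_le//.
  - by apply: prob_kernel_fin_num; exact: measurableI.
  - exact: prob_kernel_fin_num.
  - by apply: le_measure; rewrite ?inE//; exact: measurableI.
rewrite -(@integral_law _ U R P _ (R * E)%type m (fun u => (H u, X u)) (A `*` setT)
  (fun z => cond_nonzero G z.1 B))//.
- by congr (integral P _ _); apply/seteqP; split=> u // [].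
- exact: measurableX.
- exact: (measurableT_comp (mcond _ mB) measurable_fst).
Qed.

(** [nu] is [phi] times the law of [X] and the joint measure is [phi] times the law of the pair, so
    the normalisation cancels and every disintegration is a conditional law. *)
Lemma regular_cond_law_disintegration (nu : {measure set E -> \bar R})
    (Q : R.-pker E ~> R) :
  (forall A, measurable A -> nu A = phi%:E * m (setT `*` A)) ->
  (forall A B, measurable A -> measurable B ->
    phi%:E * m (B `*` A) = \int[nu]_(a in A) Q a B) ->
  regular_cond_law P H X (fun a => Q a).
Proof.
move=> nuE JQ; split.
- by move=> B mB; exact: measurable_kernel.
- apply/aeW => u; have [Q' Q'E] := probability_of_measure (@prob_kernel _ _ _ _ _ Q (X u)).
  by exists Q' => B _; rewrite Q'E.
move=> A B mA mB.
have ip : (0 <= phi^-1)%R by rewrite invr_ge0 ltW.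
have PX C : measurable C -> P (X @^-1` C) = mscale (NngNum ip) nu C.
  move=> mC; rewrite /mscale/= nuE// muleA -EFinM mulVf ?gt_eqF// mul1e.
  rewrite -PHX; last exact: measurableX.
  by congr (P _); apply/seteqP; split=> u // [].
rewrite (@integral_law _ U R P _ E (mscale (NngNum ip) nu) X A (fun a => Q a B))//;
  last exact: measurable_kernel.
rewrite ge0_integral_mscale//; last exact/measurable_funTS/measurable_kernel.
rewrite -JQ// muleA -EFinM mulVf ?gt_eqF// mul1e.
rewrite -PHX; last exact: measurableX.
by congr (P _); apply/seteqP; split=> u [].
Qed.

End joint_law.

(** The coordinates are swapped to put the real one second, the probability is disintegrated, and
    the marginal is rescaled by [phi]. *)
Lemma mark_law_disintegration : exists (nu : {measure set E -> \bar R}) (Q : R.-pker E ~> R),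
  (forall A, measurable A -> nu A = phi%:E * m (setT `*` A)) /\
  (forall A B, measurable A -> measurable B ->
    phi%:E * m (B `*` A) = \int[nu]_(a in A) Q a B).
Proof.
have mswap : measurable_fun [set: R * E] (fun z : R * E => (z.2, z.1)).
  by apply: measurable_fun_pair.
have [J0 J0E _] := law_measure m mswap.
have J01 : J0 setT = 1 by rewrite J0E// preimage_setT; exact: probability_setT.
have [J JE] := probability_of_measure J01.
have [nu0 nu0E _] := law_measure m (@measurable_snd _ _ R E).
have nu01 : nu0 setT = 1 by rewrite nu0E// preimage_setT; exact: probability_setT.
have [nu nuE] := probability_of_measure nu01.
have JX A B : measurable A -> measurable B -> J (A `*` B) = m (B `*` A).
  move=> mA mB; rewrite JE J0E; last exact: measurableX.
  by congr (m _); apply/seteqP; split=> z [].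
have nuX A : measurable A -> nu A = m (setT `*` A).
  by move=> mA; rewrite nuE nu0E//; congr (m _); apply/seteqP; split=> z // [].
have [|Q QE] := @disintegration_real _ E R J nu.
  by move=> A mA; rewrite JX// nuX.
have pp : (0 <= phi)%R by exact: ltW.
exists (mscale (NngNum pp) nu), Q; split=> [A mA|A B mA mB].
  by rewrite /mscale/=; congr (_ * _); exact: nuX.
rewrite ge0_integral_mscale//; last exact/measurable_funTS/measurable_kernel.
by rewrite -QE// JX.
Qed.

(** The left side has the mark inside and the location outside, the right side the reverse; Tonelli
    exchanges them for fixed [s]. Restricting to nonzero marks costs nothing since [f = 1] at the
    zero mark. *)
Lemma marked_exponentE d (T : measurableType d) (B0 : probability T R)
    (g : T * E -> R) : measurable_fun [set: T * E] g -> (forall z, (0 <= g z)%R) ->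
  (forall t, g (t, [tuple 0%R | _ < p]) = 0%R) ->
  \int[L]_(s in pos) ((w s)%:E *
     \int[B0]_t (1 - fine (\int[G s]_a (expR (- g (t, a)))%:E))%:E) =
  (phi * (1 - fine (\int[m]_x (fine (\int[B0]_t (expR (- g (t, x.2)))%:E))%:E)))%:E.
Proof.
move=> mg g0 ga0; pose h z := expR (- g z).
have mh : measurable_fun [set: T * E] h.
  by apply: measurableT_comp => //; exact: measurableT_comp.
have h01 z : (0 <= h z <= 1)%R.
  by rewrite expR_ge0/= -[leRHS]expR0 ler_expR oppr_le0.
have mht t : measurable_fun [set: E] (fun a => h (t, a)).
  by apply: (measurableT_comp mh); exact: measurable_fun_pair.
have mha a : measurable_fun [set: T] (fun t => h (t, a)).
  by apply: (measurableT_comp mh); exact: measurable_fun_pair.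
pose f a := fine (\int[B0]_t (h (t, a))%:E).
have f01 a : (0 <= f a <= 1)%R.
  by have [_] := integral_itv01 B0 (mha a) (fun t => h01 (t, a)).
have mf : measurable_fun [set: E] f.
  apply: measurableT_comp => //.
  apply: (@measurable_fun_fubini_tonelli_G _ _ _ _ _ B0 (fun z => (h z)%:E)).
    exact/measurable_EFinP.
  by move=> z; rewrite lee_fin; have /andP[] := h01 z.
have mf2 : measurable_fun [set: R * E] (fun x : R * E => f x.2).
  exact: measurableT_comp.
have f1_ge0 a : 0 <= (1 - f a)%:E by rewrite lee_fin subr_ge0; have /andP[] := f01 a.
have mf1 : measurable_fun [set: E] (fun a => (1 - f a)%:E).
  by apply/measurable_EFinP; exact: measurable_funB.
have fa0 : f [tuple 0%R | _ < p] = 1%R.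
  rewrite /f (_ : \int[B0]_t _ = \int[B0]_t (cst 1 t)).
    by rewrite integral_cst// mul1e [X in fine X](_ : _ = 1)//; exact: probability_setT.
  by apply: eq_integral => t _; rewrite /h ga0 oppr0 expR0.
rewrite EFinM -(integral_probability1B (probability_setT m) mf2); last first.
  by move=> x; exact: f01.
rewrite mI; last 2 first.
- by apply: (measurableT_comp mf1); exact: measurable_snd.
- by move=> z; exact: f1_ge0.
rewrite integral_phi; last 2 first.
- apply: measurable_funTS.
  apply: (measurable_fun_integral_kernel_in G (f := fun z => (1 - f z.2)%:E)) => //.
  + by apply: (measurableT_comp mf1); exact: measurable_snd.
- by move=> s _; apply: integral_ge0 => a _; exact: f1_ge0.
apply: eq_integral => s _; congr (_ * _).
have h1_ge0 z : 0 <= (1 - h z)%:E by rewrite lee_fin subr_ge0; have /andP[] := h01 z.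
have [Gs GsE] := probability_of_measure (@prob_kernel _ _ _ _ _ G s).
have GsI (D : set E) (k : E -> \bar R) : \int[G s]_(a in D) k a = \int[Gs]_(a in D) k a.
  by apply: eq_measure_integral => A mA _; apply/esym; exact: GsE.
transitivity (\int[B0]_t \int[Gs]_a (1 - h (t, a))%:E).
  apply: eq_integral => t _; rewrite GsI.
  by rewrite (integral_probability1B (probability_setT Gs) (mht t)).
rewrite (@fubini_tonelli _ _ _ _ _ B0 Gs (fun z => (1 - h z)%:E))//; last first.
  by apply/measurable_EFinP; exact: measurable_funB.
rewrite GsI [RHS]integral_mkcond; apply: eq_integral => a _.
rewrite (integral_probability1B (probability_setT B0) (mha a))// /patch.
case: ifPn => // /negP anz; rewrite [X in (1 - X)%:E](_ : _ = 1%R) ?subrr//.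
rewrite -[LHS]/(f a) -fa0; congr f; apply/eqP.
by apply: contra_notT anz => /mem_set.
Qed.

End mixture_law.

Definition mfun_of d d' (U : measurableType d) (T : measurableType d') (f : U -> T)
    (mf : measurable_fun [set: U] f) : {mfun U >-> T} :=
  HB.pack_for {mfun U >-> T} f (isMeasurableFun.Build _ _ _ _ f mf).

(** * The Laplace functional of the IBP *)

Section ibp_laplace.
Context {R : realType} (p : nat) (G : R.-pker R ~> p.-tuple R).
Context d (T : measurableType d) (B0 : probability T R).
Local Notation E := (p.-tuple R).
Local Notation pos := (`]0%R, +oo[%classic : set R).
Variables (L : {measure set R -> \bar R}) (rho w : R -> R).
Hypotheses (LI : forall (D : set R) (f : R -> \bar R), measurable D ->
    measurable_fun D f -> (forall x, D x -> 0 <= f x) ->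
    \int[L]_(x in D) f x = \int[lebesgue_measure]_(x in D) f x)
  (mw : measurable_fun pos w) (w0 : forall s, (0 <= w s)%R)
  (wE : forall s, pos s -> w s = rho s).

Let mpos : measurable pos. Proof. exact: measurable_itv. Qed.

(** [crm_intensity] is a mere set function; the Laplace functional of a Poisson measure calls for a
    measure with an integral formula. *)
Lemma crm_intensity_measure : exists2 nu : {measure set (R * T) -> \bar R},
  forall C, measurable C -> nu C = crm_intensity rho B0 C &
  forall f : R * T -> \bar R, measurable_fun [set: R * T] f -> (forall z, 0 <= f z) ->
    \int[nu]_z f z = \int[L]_(s in pos) ((w s)%:E * \int[B0]_t f (s, t)).
Proof.
have [KB KBE] : exists K : R.-pker R ~> T, forall x, K x = B0 :> {measure set T -> \bar R}.
  apply: (prob_kernel_exists (k := fun _ : R => B0 : {measure set T -> \bar R})).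
    by move=> C mC; exact: measurable_cst.
  by move=> x; exact: probability_setT.
have [nu nuI] := section_mixture L KB mpos mw w0 measurableT.
have nuI' (f : R * T -> \bar R) : measurable_fun [set: R * T] f ->
    (forall z, 0 <= f z) ->
    \int[nu]_z f z = \int[L]_(s in pos) ((w s)%:E * \int[B0]_t f (s, t)).
  by move=> mf f0; rewrite nuI//; apply: eq_integral => s _; rewrite KBE.
exists nu => // C mC.
transitivity (\int[nu]_z (\1_C z)%:E); first by rewrite integral_indic// setIT.
rewrite nuI'//; last exact/measurable_EFinP/measurable_indic.
transitivity (\int[L]_(s in pos) ((w s)%:E * B0 (xsection C s))).
  apply: eq_integral => s _; congr (_ * _).
  rewrite -[RHS]mul1e -[1%E]/(1%R%:E) -integral_cst//; last exact: measurable_xsection.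
  rewrite [RHS]integral_mkcond; apply: eq_integral => t _.
  by rewrite indicE /patch mem_xsection; case: ifP.
rewrite LI//.
- by apply: eq_integral => s /set_mem ps; rewrite wE.
- apply: emeasurable_funM; first exact/measurable_EFinP.
  exact/measurable_funTS/measurable_fun_xsection.
- by move=> s _; rewrite mule_ge0 ?lee_fin.
Qed.

Lemma laplace_ibp dU (U : measurableType dU) (P : probability U R)
    (live : nat -> U -> bool) (tau : nat -> U -> R) (omega : nat -> U -> T)
    (A : nat -> U -> E) (phi : R) (m : probability (R * E)%type R) (g : T * E -> R) :
  (forall k, measurable [set u | live k u]) ->
  (forall k, measurable_fun [set: U] (tau k)) ->
  (forall k, measurable_fun [set: U] (omega k)) ->
  (forall k, measurable_fun [set: U] (A k)) ->
  (forall (D : set U) (n : nat) (B : nat -> set E),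
    atom_sigma live (fun k u => (tau k u, omega k u)) D ->
    (forall k, measurable (B k)) ->
    P (D `&` [set u | forall k, (k < n)%N -> live k u -> B k (A k u)]) =
    \int[P]_(u in D) \prod_(0 <= k < n | live k u) G (tau k u) (B k)) ->
  poisson_random_measure P (crm_intensity rho B0)
    (atomic_measure R live (fun k u => (tau k u, omega k u))) ->
  (0 < phi)%R ->
  (forall f : R * E -> \bar R, measurable_fun [set: R * E] f -> (forall z, 0 <= f z) ->
    \int[m]_z f z = \int[L]_(s in pos)
      ((w s / phi)%:E * \int[G s]_(a in @nonzero R p) f (s, a))) ->
  measurable_fun [set: T * E] g -> (forall z, (0 <= g z)%R) ->
  (forall t, g (t, [tuple 0%R | _ < p]) = 0%R) ->
  \int[P]_u (eexpN (atom_sum live (fun k u => (omega k u, A k u)) g u))%:E =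
  (expR (- (phi * (1 - fine (\int[m]_x
    (fine (\int[B0]_t (expR (- g (t, x.2)))%:E))%:E)))))%:E.
Proof.
move=> mlive mtau momega mA mark prm phi0 mI mg g0 ga0.
have [K KE] : exists K : R.-pker (R * T)%type ~> E,
    forall x, K x = G x.1 :> {measure set E -> \bar R}.
  apply: (prob_kernel_exists (k := fun x : R * T => G x.1 : {measure set E -> \bar R})).
    move=> C mC; exact: (measurableT_comp (measurable_kernel G C mC) measurable_fst).
  by move=> x; exact: prob_kernel.
have [nu nuE nuI] := crm_intensity_measure.
pose x k u : R * T := (tau k u, omega k u).
have mx k : measurable_fun [set: U] (x k) by exact: measurable_fun_pair.
(* The test function ignores the jump size, which acts only through the law of the mark. *)
pose g' (z : R * T * E) := g (z.1.2, z.2).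
have mg' : measurable_fun [set: R * T * E] g'.
  apply: (measurableT_comp mg); apply: measurable_fun_pair; last exact: measurable_snd.
  exact: measurableT_comp.
have prm' : poisson_random_measure P nu (atomic_measure R live x).
  have [p1 p2 p3] := prm; split=> // C mC.
  by rewrite nuE//; exact: p2.
have markK (D : set U) (n : nat) (B : nat -> set E) :
    atom_sigma live x D -> (forall k, measurable (B k)) ->
    P (D `&` [set u | forall k, (k < n)%N -> live k u -> B k (A k u)]) =
    \int[P]_(u in D) \prod_(0 <= k < n | live k u) K (x k u) (B k).
  move=> sD mB; rewrite mark//; apply: eq_integral => u _.
  by apply: eq_bigr => k _; rewrite KE.
have := laplace_marked mlive mx mA markK prm' mg' (fun z => g0 (z.1.2, z.2)).
rewrite [X in X = _ -> _](_ : _ = \int[P]_u (eexpN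
  (atom_sum live (fun k u => (omega k u, A k u)) g u))%:E)// => ->.
pose F z := (1 - fine (\int[K z]_a (expR (- g' (z, a)))%:E))%:E.
have FE z : F z = (1 - expR (- marked_exponent K g' z))%:E.
  by rewrite /F expR_marked_exponent// => z'; exact: g0.
have F0 z : 0 <= F z.
  rewrite FE lee_fin subr_ge0 -[leRHS]expR0 ler_expR oppr_le0.
  by apply: marked_exponent_ge0 => // z'; exact: g0.
have mF : measurable_fun [set: R * T] F.
  rewrite (_ : F = fun z => (1 - expR (- marked_exponent K g' z))%:E); last exact/funext.
  apply/measurable_EFinP; apply: measurable_funB => //; apply: measurableT_comp => //.
  apply: measurableT_comp => //; apply: measurable_marked_exponent => // z'.
have IE : \int[nu]_z F z = (phi * (1 - fine (\int[m]_x
    (fine (\int[B0]_t (expR (- g (t, x.2)))%:E))%:E)))%:E.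
  rewrite nuI// -(marked_exponentE mw w0 phi0 mI B0 mg g0 ga0).
  by apply: eq_integral => s _; congr (_ * _); apply: eq_integral => t _; rewrite /F KE.
rewrite [X in eexpN X]IE eexpN_EFin// -lee_fin -IE; exact: integral_ge0.
Qed.

End ibp_laplace.

Theorem proposition2p2 (R : realType) (p : nat)
    (Omega : completePseudoMetricType R) (hOmega : polish Omega)
    (B0 : probability (borel Omega) R)
    (rho : R -> R) (hrho : levy_density rho)
    (G : R.-pker R ~> (p.-tuple R))
    (hG : forall s : R, (0 < s)%R -> 0 < G s [set [tuple 0%R | _ < p]])
    (hphi0 : 0 < varphi rho G) (hphi : varphi rho G < +oo)
    (dU : measure_display) (U : measurableType dU) (P : probability U R)
    (live : nat -> {mfun U >-> bool}) (tau : nat -> {mfun U >-> R})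
    (omega : nat -> {mfun U >-> borel Omega})
    (mu : U -> set (borel Omega) -> \bar R)
    (hmu : is_crm P rho B0 (fun k => live k) (fun k => tau k) (fun k => omega k) mu)
    (Z : U -> set (borel Omega) -> p.-tuple R)
    (hZ : is_ibp P G (fun k => live k) (fun k => tau k) (fun k => omega k) Z) :
  exists (dU' : measure_display) (U' : measurableType dU') (P' : probability U' R)
    (H : nat -> {mfun U' >-> R}) (X : nat -> {mfun U' >-> p.-tuple R})
    (xi : {mfun U' >-> nat}) (omega' : nat -> {mfun U' >-> borel Omega}),
    let HX := fun i u => (H i u, X i u) in
    [/\ [/\ iid P' HX,
            (forall n : nat,
               P' (xi @^-1` [set n]) = poisson_prob (fine (varphi rho G)) 0%N [set n]),
            indep P' (rv_sigma xi) (seq_sigma HX),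
            iid P' (fun i => omega' i) /\
            (forall i C, measurable C -> P' (omega' i @^-1` C) = B0 C) &
            indep P' (seq_sigma (fun i => omega' i))
                     <<s rv_sigma xi `|` seq_sigma HX >>],
        eq_law P Z P' (compound_sum xi (fun i => X i) (fun i => omega' i)),
        (forall i,
           regular_cond_law P' (X i) (H i) (cond_nonzero G) /\
           (forall S : set R, measurable S ->
              P' (H i @^-1` S) =
              \int[lebesgue_measure]_(s in S `&` `]0%R, +oo[)
                 (pi_A G s * rho s / fine (varphi rho G))%:E)) &
        (forall i (B : set (p.-tuple R)), measurable B ->
           P' (X i @^-1` B) =
           (\int[lebesgue_measure]_(s in `]0%R, +oo[)
              (G s (B `&` @nonzero R p) * (rho s)%:E))
           * (fine (varphi rho G))^-1%:E) /\
        (exists Q : R.-pker (p.-tuple R) ~> R,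
           disintegration (joint_measure rho G) Q) /\
        (forall i (Q : R.-pker (p.-tuple R) ~> R),
           disintegration (joint_measure rho G) Q ->
           regular_cond_law P' (H i) (X i) (fun a => Q a))].
Proof.
have [mrho rho0 _] := hrho.
have [live_pos prm _] := hmu.
have [A [mark ZE]] := hZ.
have mpos : measurable (`]0%R, +oo[%classic : set R) by exact: measurable_itv.
have mnz := @measurable_nonzero R p.
pose phi := fine (varphi rho G).
have phiE : varphi rho G = phi%:E by rewrite fineK// ge0_fin_numE// ltW.
have phi0 : (0 < phi)%R by rewrite -lte_fin -phiE.
have [L _ LI] := lebesgue_measure_real R.
(* Mixtures take a weight that is nonnegative on the whole line, whereas [rho] is controlled on the
   positive half-line only. *)
pose w s := if (0 < s)%R then rho s else 0%R.
have w0 s : (0 <= w s)%R by rewrite /w; case: ifP => // /rho0.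
have wE s : (`]0%R, +oo[%classic : set R) s -> w s = rho s.
  by rewrite /= in_itv/= andbT /w => ->.
have mw : measurable_fun (`]0%R, +oo[%classic : set R) w.
  by apply: (eq_measurable_fun rho) => // s /set_mem ps; rewrite wE.
have nzE s : G s (@nonzero R p) = (pi_A G s)%:E.
  by rewrite fineK//; exact: prob_kernel_fin_num.
(* The factor [c] is 1 for the Lévy density itself and the inverse of [phi] for the normalised
   one. *)
have LwI (S : set R) (B : set (p.-tuple R)) (c : R) : measurable S -> measurable B ->
    (0 <= c)%R ->
    \int[L]_(s in S `&` `]0%R, +oo[) ((w s * c)%:E * G s B) =
    \int[lebesgue_measure]_(s in S `&` `]0%R, +oo[) ((rho s * c)%:E * G s B).
  move=> mS mB c0; rewrite LI.
  - by apply: eq_integral => s /set_mem[_ ps]; rewrite wE.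
  - exact: measurableI.
  - apply: emeasurable_funM; last exact/measurable_funTS/measurable_kernel.
    apply/measurable_EFinP; apply: measurable_funM => //.
    by apply: measurable_funS mw => // s [].
  - by move=> s _; rewrite mule_ge0 ?lee_fin ?mulr_ge0.
have phiL : \int[L]_(s in `]0%R, +oo[) ((w s)%:E * G s (@nonzero R p)) = phi%:E.
  rewrite -phiE -[X in \int[L]_(s in X) _]setTI.
  under eq_integral do rewrite -[w _]mulr1.
  rewrite LwI// setTI; apply: eq_integral => s _.
  by rewrite mulr1 nzE -EFinM mulrC.
have [m mI] := mark_law_exists mw w0 phi0 phiL.
have phiV : (0 <= phi^-1)%R by rewrite invr_ge0 ltW.
have mX S B : measurable S -> measurable B -> m (S `*` B) =
    \int[lebesgue_measure]_(s in S `&` `]0%R, +oo[)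
      ((rho s / phi)%:E * G s (B `&` @nonzero R p)).
  move=> mS mB; rewrite (mark_law_setX mI)// LwI//.
  exact: measurableI.
have phi_mX S B : measurable S -> measurable B -> phi%:E * m (S `*` B) =
    \int[lebesgue_measure]_(s in S `&` `]0%R, +oo[)
      ((rho s)%:E * G s (B `&` @nonzero R p)).
  move=> mS mB; have mBnz : measurable (B `&` @nonzero R p) by exact: measurableI.
  transitivity (\int[L]_(s in S `&` `]0%R, +oo[)
      ((w s * 1)%:E * G s (B `&` @nonzero R p))); last first.
    by rewrite LwI//; under eq_integral do rewrite mulr1.
  rewrite (mark_law_setX mI)// -ge0_integralZl//.
  - by apply: eq_integral => s _; rewrite muleA -EFinM mulrC mulfVK ?mulr1// gt_eqF.
  - exact: measurableI.
  - apply: emeasurable_funM; last exact/measurable_funTS/measurable_kernel.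
    apply/measurable_EFinP; apply: measurable_funM => //.
    by apply: measurable_funS mw => // s [].
  - by move=> s _; rewrite mule_ge0// lee_fin mulr_ge0.
  - by rewrite lee_fin ltW.
have joint A' B : measurable A' -> measurable B ->
    joint_measure rho G (A' `*` B) = phi%:E * m (B `*` A').
  move=> mA' mB; rewrite phi_mX// integral_mkcondl; apply: eq_integral => s _.
  rewrite /patch; case: ifPn => [/set_mem Bs|/negP sB].
    rewrite muleC; congr (_ * G s (_ `&` _)).
    by apply/seteqP; split=> a; rewrite /ysection/= inE => // -[].
  rewrite (_ : ysection _ _ = set0) ?set0I ?measure0 ?mul0e//.
  apply/seteqP; split=> a //; rewrite /ysection/= inE => -[_ /mem_set].
  by move=> /sB.
(* The pairs are one iid sequence of law [m] in the product space, [H] and [X] being its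
   coordinates, so [H i] and [X i] keep their joint law. *)
have [dU' [U' [P' [xi [x1 [x2 [[mxi mx1 mx2] [[iid1 poi ind iid2 ind2] lap]]]]]]]] :=
  compound_poisson_space (ltW phi0) m B0.
have mH i : measurable_fun [set: U'] (fun u => (x1 i u).1) by exact: measurableT_comp.
have mXi i : measurable_fun [set: U'] (fun u => (x1 i u).2) by exact: measurableT_comp.
exists dU', U', P', (fun i => mfun_of (mH i)), (fun i => mfun_of (mXi i)), (mfun_of mxi),
  (fun i => mfun_of (mx2 i)) => HX.
have HXE : HX = x1.
  by apply/funext => i; apply/funext => u; rewrite /HX/= -surjective_pairing.
have PHX i C : measurable C ->
    P' ((fun u => ((x1 i u).1, (x1 i u).2)) @^-1` C) = m C.
  move=> mC; rewrite -(iid1.2 i C mC); congr (P' _); apply/seteqP.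
  by split=> u; rewrite /preimage/= -surjective_pairing.
have PX i B : measurable B -> P' ((fun u => (x1 i u).2) @^-1` B) = m (setT `*` B).
  move=> mB; rewrite -(PHX i); last exact: measurableX.
  by congr (P' _); apply/seteqP; split=> u // [].
split.
- by rewrite HXE; split=> //; exact: iid1.1.
- have mlive k : measurable [set u | live k u].
    by rewrite -[X in measurable X]setTI; exact: (measurable_funPT (live k)).
  apply: (@eq_law_of_laplace _ _ _ _ _ _ _ _ _ _ (fun k => live k) (fun k => omega k)
    (fun k => A k)) => //.
  move=> g mg g0 ga0.
  rewrite (laplace_ibp LI mw w0 wE mlive _ _ _ mark prm phi0 mI mg g0 ga0)//.
  (* The compound functional takes the pair first and the location second, whereas [g] expects
     location and mark. *)
  pose h (z : R * p.-tuple R * borel Omega) := expR (- g (z.2, z.1.2)).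
  rewrite -(lap h)//.
  + apply: measurableT_comp => //; apply: measurableT_comp => //.
    apply: (measurableT_comp mg); apply: measurable_fun_pair; first exact: measurable_snd.
    exact: measurableT_comp.
  + by move=> z; rewrite expR_gt0/= -[leRHS]expR0 ler_expR oppr_le0.
- move=> i; split.
    exact: (regular_cond_law_mark mI (mH i) (mXi i) (PHX i)).
  move=> S mS; transitivity (m (S `*` setT)).
    rewrite -(PHX i); last exact: measurableX.
    by congr (P' _); apply/seteqP; split=> u // [].
  rewrite mX//; apply: eq_integral => s _.
  by rewrite setTI nzE -EFinM mulrC mulrA.
- split.
    move=> i B mB; rewrite [LHS]PX//.
    transitivity (phi%:E * m (setT `*` B) * phi^-1%:E).
      by rewrite muleAC -EFinM divff ?gt_eqF// mul1e.
    rewrite phi_mX// setTI; congr (_ * _).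
    by apply: eq_integral => s _; rewrite muleC.
  split.
    have [nu [Q [nuE QE]]] := mark_law_disintegration phi0 m.
    exists Q, nu => [A' mA'|A' B mA' mB]; first by rewrite nuE// joint.
    by rewrite joint// QE.
  move=> i Q [nu nuE QE].
  apply: (regular_cond_law_disintegration phi0 (mXi i) (PHX i) (nu := nu)).
    by move=> A' mA'; rewrite nuE// joint.
  by move=> A' B mA' mB; rewrite -QE// joint.
Qed.
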